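(* Let $r_0\ge3$, $r\ge r_0$, $s\ge0$ and $M>0$ be fixed. Assume that $P\in\mathcal P_{r_0}$ and that $$\alpha_h(x)=\beta(x)\,\mathbf 1_{x<c}(x)$$ for a constant $c<c_r$, where $c_r=\beta^{-1}\big(\frac{2\pi}r\big)$. Then there exist constants $h_0$ and $C_r$ such that for all $h\le h_0$ there exists a real polynomial Hamiltonian $H_h$ such that for all $z\in B^s_M$, $$\big\|\Phi_P^h\circ\Phi_{A_0}^1(z)-\Phi_{H_h}^h(z)\big\|_{\ell^1_s}\le C_rh^{N(r)},\qquad N(r)=\frac{r-2}{r_0-2}+1.$$ If moreover $P\in\mathcal{SP}_{r_0}$ and $\omega_a\ge0$ for all $a\in\mathcal N$, then the same result holds true under the weaker condition $$c<c_{r/2}=\beta^{-1}\Big(\frac{4\pi}r\Big).$$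
   Context: Phase space. Let $d\ge1$ and $\mathcal N=\mathbb Z^d$ or $\mathbb N^d$; for $a\in\mathcal N$ put $|a|^2=\max(1,a_1^2+\cdots+a_d^2)$. Let $\mathcal Z=\mathcal N\times\{\pm1\}$; for $j=(a,\delta)\in\mathcal Z$ put $|j|=|a|$ and $\overline j=(a,-\delta)$. A pair $(\xi,\eta)\in\mathbb C^{\mathcal N}\times\mathbb C^{\mathcal N}$ is identified with $z=(z_j)_{j\in\mathcal Z}$ by $z_{(a,1)}=\xi_a$, $z_{(a,-1)}=\eta_a$. For $s\ge0$, $\ell^1_s$ is the space of $z\in\mathbb C^{\mathcal Z}$ with $\|z\|_{\ell^1_s}=\sum_{j\in\mathcal Z}|j|^s|z_j|<\infty$, and $B^s_M=\{z\in\ell^1_s:\|z\|_{\ell^1_s}\le M\}$. $z$ is real if $z_{\overline j}=\overline{z_j}$ for all $j$; a function $H(z)$ is real if $H(z)\in\mathbb R$ for all real $z$. The Hamiltonian vector field is $(X_H)_{(a,1)}=-i\,\partial H/\partial\eta_a$, $(X_H)_{(a,-1)}=i\,\partial H/\partial\xi_a$, and $\Phi_H^t$ is the flow at time $t$ of $\dot z=X_H(z)$. Polynomials. For $\boldsymbol j=(j_1,\dots,j_\ell)\in\mathcal Z^\ell$, $j_i=(a_i,\delta_i)$, put $z_{\boldsymbol j}=z_{j_1}\cdots z_{j_\ell}$, $\overline{\boldsymbol j}=(\overline{j_1},\dots,\overline{j_\ell})$, $\mathcal M(\boldsymbol j)=\sum_i\delta_ia_i$, and $\mathcal I_\ell=\{\boldsymbol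 j\in\mathcal Z^\ell:\mathcal M(\boldsymbol j)=0\}$. $\mathcal P_k$ is the set of real polynomial Hamiltonians of degree $k$, with a zero of order at least $2$ at $z=0$, of the form $P(z)=\sum_{\ell=2}^k\sum_{\boldsymbol j\in\mathcal I_\ell}a_{\boldsymbol j}z_{\boldsymbol j}$, with $a_{\overline{\boldsymbol j}}=\overline{a_{\boldsymbol j}}$ and bounded coefficients. $\mathcal{SP}_k$ is the set of $P\in\mathcal P_k$ such that $a_{\boldsymbol j}\ne0$ implies that $\boldsymbol j$ contains as many entries with $\delta_i=+1$ as with $\delta_i=-1$. Linear part. The frequencies $\omega_a\in\mathbb R$ ($a\in\mathcal N$) satisfy $|\omega_a|\le C|a|^m$ for some constants $C,m>0$. $h>0$ is the stepsize, $\lambda_a=\alpha_h(h\omega_a)$, $A_0(z)=\sum_{a}\lambda_a\xi_a\eta_a$, and $\Phi_{A_0}^1$ is its time-one flow: $(\Phi_{A_0}^1(z))_j=\exp(-i\delta\lambda_a)z_j$ for $j=(a,\delta)$. Here $\beta$ is a filter function independent of $h$, with $\beta(0)=0$ and $\beta(x)\simeq x$ for small $x$, increasing on $[0,\infty)$ (so that $\beta^{-1}$ makes sense, with $\beta^{-1}(y)=+\infty$ for $y\ge\sup\beta$); the main cases are $\beta(x)=x$ and $\beta(x)=2\arctan(x/2)$. $\mathbf 1_{x<c}$ is the indicator function of $\{x<c\}$.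
   Formalization: For x<0 the filter is taken odd, α_h(x)=−β(|x|)1_{|x|<c}, since a one-sided cutoff leaves unbounded negative frequencies resonant; N(r) uses the integer part of (r−2)/(r_0−2), since the order-n term has degree n(r_0−2)+2 and only degrees ≤ r are non-resonant. *)

(* Defs.v *)
From HB Require Import structures.
From mathcomp Require Import all_boot all_order all_algebra.
From mathcomp Require Import all_classical all_reals all_analysis.
From mathcomp Require Import complex.

Set Implicit Arguments.
Unset Strict Implicit.
Unset Printing Implicit Defensive.
Import Order.TTheory GRing.Theory Num.Theory.
Import numFieldNormedType.Exports.

Local Open Scope classical_set_scope.
Local Open Scope ring_scope.

Definition in_lattice (nonneg : bool) (d : nat) (a : 'rV[int]_d) : bool :=
  nonneg ==> [forall i, 0 <= a 0 i].

(* Z^d when [nonneg] is false, N^d when it is true. *)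
Definition lattice (nonneg : bool) (d : nat) : Type :=
  {a : 'rV[int]_d | in_lattice nonneg a}.

(* The index set lattice * {+1, -1}; [true] stands for +1. *)
Definition mode (nonneg : bool) (d : nat) : Type := (lattice nonneg d * bool)%type.

Section phase_space.
Variables (R : realType) (nonneg : bool) (d : nat).
Local Notation N := (lattice nonneg d).
Local Notation Z := (mode nonneg d).
Local Notation C := R[i].

Definition anorm (a : N) : R :=
  Num.sqrt (Num.max 1 (\sum_i (val a 0 i)%:~R ^+ 2)).

Definition ibar (j : Z) : Z := (j.1, ~~ j.2).

Definition phase : Type := Z -> C.

Definition l1norm (s : R) (z : phase) : \bar R :=
  \esum_(j in [set: Z]) ((anorm j.1 `^ s) * Normc.normc (z j))%:E.

Definition l1ball (s M : R) : set phase := [set z | (l1norm s z <= M%:E)%E].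

Definition momentum (w : seq Z) : 'rV[int]_d :=
  \sum_(j <- w) (if j.2 then val j.1 else - val j.1).

Definition zero_momentum (l : nat) : set (seq Z) :=
  [set w | size w = l /\ momentum w = 0].

Definition monomial (w : seq Z) (z : phase) : C := \prod_(j <- w) z j.

(* Unordered sum of a family; only meaningful when it is absolutely summable. *)
Definition rsum (T : choiceType) (A : set T) (f : T -> R) : R :=
  fine (esum A (EFin \o f)^\+ - esum A (EFin \o f)^\-)%E.
Definition csum (T : choiceType) (A : set T) (f : T -> C) : C :=
  (rsum A (fun x => complex.Re (f x)) +i* rsum A (fun x => complex.Im (f x)))%C.

Definition polynomial_of (k : nat) (a : seq Z -> C) (z : phase) : C :=
  \sum_(2 <= l < k.+1) csum (zero_momentum l) (fun w => a w * monomial w z).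

Definition real_coef (a : seq Z -> C) : Prop :=
  forall w, a (map ibar w) = ((a w)^*)%C.

Definition bounded_coef (a : seq Z -> C) : Prop :=
  exists K : R, forall w, Normc.normc (a w) <= K.

Definition balanced_coef (a : seq Z -> C) : Prop :=
  forall w, a w != 0 ->
    count (fun j : Z => j.2) w = count (fun j : Z => ~~ j.2) w.

(* The coefficients on words of length < 2 or > k, or of nonzero momentum,
   do not enter [polynomial_of]. *)
Definition calP (k : nat) : set (phase -> C) :=
  [set H | exists a, [/\ real_coef a, bounded_coef a & H = polynomial_of k a]].

Definition calSP (k : nat) : set (phase -> C) :=
  [set H | exists a, [/\ real_coef a, bounded_coef a, balanced_coef a
                       & H = polynomial_of k a]].

Definition partial (H : phase -> C) (j : Z) (z : phase) : C :=
  derive1 (fun t : C => H (fun k : Z => if k == j then z k + t else z k) : C^o) 0.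

Definition hamiltonian_field (H : phase -> C) (z : phase) : phase :=
  fun j => (if j.2 then - 'i%C else 'i%C) * partial H (ibar j) z.

(* Strong solution, in the norm of l^1_s, on the closed interval [0, T]
   (one-sided derivatives at the end points). *)
Definition solution (s : R) (X : phase -> phase) (T : R) (u : R -> phase) : Prop :=
  forall t : R, 0 <= t <= T ->
    (l1norm s (u t) < +oo)%E /\
    l1norm s (fun j => ((t' - t)^-1)%:C%C * (u t' j - u t j) - X (u t) j)
      @[t' --> within `[0, T] (t^')] --> 0%E.

(* [flow s X T z w]: the time-T flow of X is defined at z, with value w. *)
Definition flow (s : R) (X : phase -> phase) (T : R) (z w : phase) : Prop :=
  exists u, [/\ solution s X T u, u 0 = z & u T = w].

(* The time-one flow of the quadratic Hamiltonian \sum_a lambda_a xi_a eta_a. *)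
Definition linear_flow (lambda : N -> R) (z : phase) : phase :=
  fun j => let th := if j.2 then - lambda j.1 else lambda j.1 in
           (cos th +i* sin th)%C * z j.

End phase_space.

Section filter.
Variable R : realType.

Definition filter_function (beta : R -> R) : Prop :=
  [/\ beta 0 = 0,
      beta x / x @[x --> 0^'+] --> (1 : R)
    & forall x y : R, 0 <= x -> x < y -> beta x < beta y].

(* The infimum of the empty set is +oo, so the value is +oo when
   y >= sup beta. *)
Definition beta_inv (beta : R -> R) (y : R) : \bar R :=
  ereal_inf [set x%:E | x in [set x | 0 <= x /\ y <= beta x]].

(* beta(x) 1_{x < c} for x >= 0, extended to x < 0 as an odd function, so that
   the cutoff acts on |x|: a one-sided cutoff would leave the phases of
   unbounded negative frequencies free to be resonant. *)
Definition truncated_filter (beta : R -> R) (c x : R) : R :=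
  Num.sg x * (if `|x| < c then beta `|x| else 0).

End filter.

(* N(r) = (r - 2) / (r0 - 2) + 1, counted as a number of steps (integer part of
   the quotient): the term of order n in h has degree n (r0 - 2) + 2, and only
   terms of degree <= r are controlled by the condition on c. *)
Definition interp_order (r0 r : nat) : nat := ((r - 2) %/ (r0 - 2)).+1.

Section estimate.
Variables (R : realType) (nonneg : bool) (d : nat).
Local Notation N := (lattice nonneg d).
Local Notation phase := (phase R nonneg d).
Local Notation C := R[i].

Definition interpolated (r0 r : nat) (s M : R) (alpha : R -> R)
    (omega : N -> R) (P : phase -> C) : Prop :=
  exists h0 Cr : R, 0 < h0 /\ forall h : R, 0 < h -> h <= h0 ->
    exists H : phase -> C, (exists k, calP k H) /\
      forall z, l1ball s M z ->
        exists w1 w2 : phase,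
          [/\ flow s (hamiltonian_field P) h
                (linear_flow (fun a => alpha (h * omega a)) z) w1,
              flow s (hamiltonian_field H) h z w2
            & (l1norm s (fun j => (w1 j - w2 j)%R)
                 <= (Cr * h ^+ interp_order r0 r)%R%:E)%E].

End estimate.

(* Main.v *)
Require Import Defs.
From HB Require Import structures.
From mathcomp Require Import all_boot all_order all_algebra.
From mathcomp Require Import all_classical all_reals all_analysis.
From mathcomp Require Import complex.
From mathcomp Require Import ring lra zify.
Import Order.TTheory GRing.Theory Num.Theory.
Import numFieldNormedType.Exports.
Set Implicit Arguments.
Unset Strict Implicit.
Unset Printing Implicit Defensive.
Local Open Scope classical_set_scope.
Local Open Scope ring_scope.

(** This is backward error analysis for a splitting method, carried out on
    coefficient functions rather than on functions of z.

    Formal part.  A polynomial Hamiltonian is given by its coefficient function A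
    on words of modes, and its vector field acts on coefficient functions by the
    derivation [L (hf 'i A)].  The coordinate z_j is the word of one letter j, and
    the m-th Taylor coefficient of the flow of a field X, times m!, is the m-th
    iterate of [L X] on that letter, evaluated at the initial point
    ([lie_series_coef]).  So the flow of K at time one is the exponential of L_K,
    and the splitting method is exp(L_{A0}) exp(h L_P).  One looks for
    K(t) = A0 + t Z_1 + ... + t^n Z_n such that exp(L_{K(t)}) and
    exp(L_{A0}) exp(t L_P) agree up to order n in t.  The derivative of
    exp(L_{K(t)}) is exp(L_{K(t)}) L_{Q(t)}, with Q the sum over p of
    ad_K^p(K') / (p+1)!, because L is a representation of the Poisson bracket
    ([L_comm], [L_hf_comm]).  Hence it is enough to have Q = P modulo t^n.  At each
    order the new unknown Z_{l+1} occurs in this equation only through powers of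
    ad_{A0}, which is diagonal: on a word w it is multiplied by
    (l+1) phi1(i theta_w), where phi1(x) = (exp(x) - 1)/x and theta_w is the signed
    sum of the phases lambda along w.  Since Z_{l+1} has degree at most
    (l+1)(r0-2) + 2, only words of length at most r matter, and phi1 stays away
    from zero when |theta_w| <= t0 < 2 pi.  This is what the bound on c gives: each
    phase is smaller than 2 pi / r, or, if all phases are nonnegative and the
    letters of a word are balanced, half of the letters contribute with each sign
    and 4 pi / r is enough.  The lemmas are [solution_exists] and [Eterm_matching].

    Analytic part.  The coefficients of K are bounded uniformly in h, as the
    phases are bounded and the divisors are bounded below.  The field of K(h)
    is therefore a linear diagonal part of size at most Lam, uniformly in h, plus
    a part of size O(h).  The l^1_s norms Y_m of the Taylor coefficients of its
    flow satisfy (m+1) Y_{m+1} <= Lam Y_m + e sum_l (Y^{*l})_m with e small, and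
    [scalar_bound] deduces that the sum of 2^m Y_m is bounded: the flow exists up
    to time one, as a power series in time.  The same bound for the majorant field,
    where h is replaced by a fixed T0 >= h and all coefficients by their absolute
    values, controls the expansion in powers of h, whose tail after order n is
    at most (h/T0)^(n+1) times a constant ([series_tail]).  Applied to K(h) at z
    and to h P at the image of z under the flow of A0, it leaves identical terms
    up to order n, and the remainders give the estimate ([interpolation]). *)

(** * Unordered sums *)

Section csum_theory.
Variable R : realType.
Local Notation C := R[i].
Local Notation nc := (@Normc.normc R).

Definition rnsum (T : choiceType) (f : T -> R) : \bar R :=
  \esum_(x in [set: T]) `|f x|%:E.

Definition nsum (T : choiceType) (f : T -> C) : \bar R :=
  \esum_(x in [set: T]) (nc (f x))%:E.

Lemma nc_ge0 (x : C) : 0 <= nc x.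
Proof. by case: x => a b /=; rewrite sqrtr_ge0. Qed.

Lemma nsum_ge0 (T : choiceType) (f : T -> C) : (0 <= nsum f)%E.
Proof. by apply: esum_ge0 => x _; rewrite lee_fin nc_ge0. Qed.

(** The value of [rsum] does not depend on the way in which the family is
    written as a difference of nonnegative summable families; linearity
    follows from this by choosing convenient differences. *)
Lemma rsum_sub (T : choiceType) (f g h : T -> R) :
  (forall x, 0 <= g x) -> (forall x, 0 <= h x) -> (forall x, f x = g x - h x) ->
  (\esum_(x in [set: T]) (g x)%:E < +oo)%E ->
  (\esum_(x in [set: T]) (h x)%:E < +oo)%E ->
  rsum [set: T] f = fine (\esum_(x in [set: T]) (g x)%:E)
                    - fine (\esum_(x in [set: T]) (h x)%:E).
Proof.
move=> g0 h0 fE sg sh.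
rewrite /rsum.
have -> : EFin \o f = ((EFin \o g) \- (EFin \o h))%E.
  by apply/funext => x /=; rewrite fE EFinB.
rewrite esumB /=.
- rewrite fineB// ge0_fin_numE//; apply: esum_ge0 => x _; by rewrite lee_fin.
- apply: le_lt_trans sg; apply: le_esum => x _ /=; by rewrite ger0_norm.
- apply: le_lt_trans sh; apply: le_esum => x _ /=; by rewrite ger0_norm.
- by move=> x _; rewrite lee_fin.
- by move=> x _; rewrite lee_fin.
Qed.

Lemma rsum_ge0E (T : choiceType) (f : T -> R) :
  (forall x, 0 <= f x) -> (\esum_(x in [set: T]) (f x)%:E < +oo)%E ->
  rsum [set: T] f = fine (\esum_(x in [set: T]) (f x)%:E).
Proof.
move=> f0 sf; rewrite (@rsum_sub _ f f (fun=> 0))//.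
- by rewrite (esum1 (a := fun=> 0%:E))//= subr0.
- by move=> x; rewrite subr0.
- by rewrite esum1.
Qed.

Definition rpos (f : R) := Num.max f 0.
Definition rneg (f : R) := Num.max (- f) 0.
Lemma rposB f : f = rpos f - rneg f.
Proof. by rewrite /rpos /rneg; case: (leP f 0); case: (leP (-f) 0); lra. Qed.
Lemma rpos_ge0 f : 0 <= rpos f. Proof. by rewrite /rpos le_max lexx orbT. Qed.
Lemma rneg_ge0 f : 0 <= rneg f. Proof. by rewrite /rneg le_max lexx orbT. Qed.
Lemma rpos_le f : rpos f <= `|f|.
Proof. by rewrite /rpos ge_max normr_ge0 ler_norm. Qed.
Lemma rneg_le f : rneg f <= `|f|.
Proof. by rewrite /rneg ge_max normr_ge0 -normrN ler_norm. Qed.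

Lemma rsum_posneg (T : choiceType) (f : T -> R) : (rnsum f < +oo)%E ->
  [/\ (\esum_(x in [set: T]) (rpos (f x))%:E < +oo)%E,
   (\esum_(x in [set: T]) (rneg (f x))%:E < +oo)%E &
   rsum [set: T] f = fine (\esum_(x in [set: T]) (rpos (f x))%:E)
                    - fine (\esum_(x in [set: T]) (rneg (f x))%:E)].
Proof.
move=> sf.
have h1 : (\esum_(x in [set: T]) (rpos (f x))%:E < +oo)%E.
  by apply: le_lt_trans sf; apply: le_esum => x _; rewrite lee_fin rpos_le.
have h2 : (\esum_(x in [set: T]) (rneg (f x))%:E < +oo)%E.
  by apply: le_lt_trans sf; apply: le_esum => x _; rewrite lee_fin rneg_le.
split => //; apply: rsum_sub => // x; rewrite ?rpos_ge0 ?rneg_ge0//.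
exact: rposB.
Qed.

Lemma rsumD (T : choiceType) (f g : T -> R) : (rnsum f < +oo)%E -> (rnsum g < +oo)%E ->
  rsum [set: T] (fun x => f x + g x) = rsum [set: T] f + rsum [set: T] g.
Proof.
move=> sf sg.
have [f1 f2 ->] := rsum_posneg sf; have [g1 g2 ->] := rsum_posneg sg.
have E (a b : T -> R) : (forall x, 0 <= a x) -> (forall x, 0 <= b x) ->
  (\esum_(x in [set: T]) (a x + b x)%:E =
   \esum_(x in [set: T]) (a x)%:E + \esum_(x in [set: T]) (b x)%:E)%E.
  move=> a0 b0; rewrite -esumD//; move=> x _; by rewrite lee_fin.
have F (a : T -> R) : (forall x, 0 <= a x) -> (\esum_(x in [set: T]) (a x)%:E < +oo)%E ->
   \esum_(x in [set: T]) (a x)%:E \is a fin_num.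
  by move=> a0 sa; rewrite ge0_fin_numE//; apply: esum_ge0 => x _; rewrite lee_fin.
have p0 (a : T -> R) x := rpos_ge0 (a x); have n0 (a : T -> R) x := rneg_ge0 (a x).
rewrite (@rsum_sub _ _ (fun x => rpos (f x) + rpos (g x)) (fun x => rneg (f x) + rneg (g x))).
- rewrite !E//; try by move=> x; rewrite ?rpos_ge0 ?rneg_ge0.
  rewrite !fineD ?F//; lra.
- by move=> x; rewrite addr_ge0.
- by move=> x; rewrite addr_ge0.
- by move=> x; rewrite {1}(rposB (f x)) {1}(rposB (g x)); lra.
- by rewrite E// lte_add_pinfty.
- by rewrite E// lte_add_pinfty.
Qed.

Lemma esumZ (T : choiceType) (r : R) (f : T -> R) : 0 <= r -> (forall x, 0 <= f x) ->
  (\esum_(x in [set: T]) (r * f x)%:E = r%:E * \esum_(x in [set: T]) (f x)%:E)%E.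
Proof.
move=> r0 f0.
have le (s : R) (g : T -> R) : 0 <= s -> (forall x, 0 <= g x) ->
   (\esum_(x in [set: T]) (s * g x)%:E <= s%:E * \esum_(x in [set: T]) (g x)%:E)%E.
  move=> s0 g0; apply: ge_ereal_sup => _ [X [finX XI] <-].
  have -> : (\sum_(x \in X) (s * g x)%:E = s%:E * \sum_(x \in X) (g x)%:E)%E.
    rewrite !fsbig_finite//= ge0_sume_distrr; last by move=> i _; rewrite lee_fin.
    by apply: eq_bigr => i _; rewrite EFinM.
  apply: lee_wpmul2l; first by rewrite lee_fin.
  by apply: ereal_sup_ubound; exists X.
apply/eqP; rewrite eq_le le//=.
have [->|rp] := eqVneq r 0.
  by rewrite mul0e; apply: esum_ge0 => x _; rewrite mul0r.
have {rp}r0 : 0 < r by rewrite lt_neqAle eq_sym rp.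
have ri : 0 <= r^-1 by rewrite invr_ge0 ltW.
have rf x : 0 <= r * f x by rewrite mulr_ge0// ltW.
have := le r^-1 (fun x => r * f x) ri rf; under eq_esum do rewrite mulrA mulVf ?gt_eqF// mul1r.
move=> H; apply: le_trans (lee_wpmul2l _ H) _; first by rewrite lee_fin ltW.
by rewrite muleA -EFinM divff ?gt_eqF// mul1e.
Qed.

Lemma rsumN (T : choiceType) (f : T -> R) :
  (rnsum f < +oo)%E -> rsum [set: T] (fun x => - f x) = - rsum [set: T] f.
Proof.
move=> sf; have [f1 f2 ->] := rsum_posneg sf.
rewrite opprB; apply: rsum_sub => // x; rewrite ?rpos_ge0 ?rneg_ge0//.
by rewrite {1}(rposB (f x)) opprB.
Qed.

Lemma rsumZ (T : choiceType) (r : R) (f : T -> R) :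
  (rnsum f < +oo)%E -> rsum [set: T] (fun x => r * f x) = r * rsum [set: T] f.
Proof.
move=> sf; have [f1 f2 fE] := rsum_posneg sf.
have main s : 0 <= s -> rsum [set: T] (fun x => s * f x) = s * rsum [set: T] f.
  move=> s0; rewrite (@rsum_sub _ _ (fun x => s * rpos (f x)) (fun x => s * rneg (f x))).
  - rewrite !esumZ//; try by move=> x; rewrite ?rpos_ge0 ?rneg_ge0.
    by rewrite !fineM ?ge0_fin_numE ?ltry ?esum_ge0 ?lee_fin//= ?fE ?mulrBr// => x _;
       rewrite lee_fin ?rpos_ge0 ?rneg_ge0.
  - by move=> x; rewrite mulr_ge0// rpos_ge0.
  - by move=> x; rewrite mulr_ge0// rneg_ge0.
  - by move=> x; rewrite {1}(rposB (f x)) mulrBr.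
  - rewrite esumZ//; last by move=> x; rewrite rpos_ge0.
    by rewrite lte_mul_pinfty.
  - rewrite esumZ//; last by move=> x; rewrite rneg_ge0.
    by rewrite lte_mul_pinfty.
case: (leP 0 r) => r0; first exact: main.
rewrite -[in LHS](opprK r); under eq_fun do rewrite mulNr.
rewrite rsumN; last first.
  rewrite /rnsum; under eq_esum do rewrite normrM.
  by rewrite esumZ// lte_mul_pinfty.
by rewrite main ?oppr_ge0 ?ltW// mulNr opprK.
Qed.

Lemma rsum_fubini (T1 T2 : choiceType) (f : T1 * T2 -> R) : (rnsum f < +oo)%E ->
  [/\ forall x, (rnsum (fun y => f (x, y)) < +oo)%E,
      (rnsum (fun x => rsum [set: T2] (fun y => f (x, y))) < +oo)%E
   & rsum [set: T1] (fun x => rsum [set: T2] (fun y => f (x, y))) = rsum [set: T1 * T2] f].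
Proof.
move=> sf.
have tonelli (g : T1 * T2 -> R) : (forall p, 0 <= g p) ->
   (\esum_(p in [set: T1 * T2]) (g p)%:E =
    \esum_(x in [set: T1]) \esum_(y in [set: T2]) (g (x, y))%:E)%E.
  move=> g0; rewrite (@esum_esum _ _ _ _ (fun=> setT) (fun x y => (g (x, y))%:E)); last first.
    by move=> x y _ _; rewrite lee_fin.
  rewrite [X in _ = esum X _](_ : _ = setT); first by apply: eq_esum => -[].
  by apply/seteqP; split.
have sec (g : T1 * T2 -> R) : (forall p, 0 <= g p) -> (forall p, g p <= `|f p|) ->
   [/\ forall x, (\esum_(y in [set: T2]) (g (x, y))%:E)%E =
                 (fine (\esum_(y in [set: T2]) (g (x, y))%:E))%:E &
     (\esum_(p in [set: T1 * T2]) (g p)%:E < +oo)%E].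
  move=> g0 gf.
  have s : (\esum_(p in [set: T1 * T2]) (g p)%:E < +oo)%E.
    by apply: le_lt_trans sf; apply: le_esum => x _; rewrite lee_fin.
  split => // x; rewrite fineK// ge0_fin_numE; last by apply: esum_ge0 => y _; rewrite lee_fin.
  apply: le_lt_trans s; rewrite tonelli//.
  rewrite (esumID [set x])//; last by move=> i _; apply: esum_ge0 => y _; rewrite lee_fin.
  rewrite setTI esum_set1 ?leeDl//; last by apply: esum_ge0 => y _; rewrite lee_fin.
  by apply: esum_ge0 => i _; apply: esum_ge0 => y _; rewrite lee_fin.
have [a1 a2] := sec (fun p => `|f p|) (fun p => normr_ge0 _) (fun p => lexx _).
have [p1 p2] := sec (fun p => rpos (f p)) (fun p => rpos_ge0 _) (fun p => rpos_le _).
have [n1 n2] := sec (fun p => rneg (f p)) (fun p => rneg_ge0 _) (fun p => rneg_le _).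
have sx x : (rnsum (fun y => f (x, y)) < +oo)%E by rewrite /rnsum a1 ltry.
have [_ _ fE] := rsum_posneg sf.
have E x : rsum [set: T2] (fun y => f (x, y)) =
   fine (\esum_(y in [set: T2]) (rpos (f (x, y)))%:E)
   - fine (\esum_(y in [set: T2]) (rneg (f (x, y)))%:E).
  by have [] := rsum_posneg (sx x).
have ge0 (g : T1 * T2 -> R) : (forall p, 0 <= g p) ->
   forall x, 0 <= fine (\esum_(y in [set: T2]) (g (x, y))%:E).
  by move=> g0 x; apply: fine_ge0; apply: esum_ge0 => y _; rewrite lee_fin.
have P0 := ge0 _ (fun p => rpos_ge0 (f p)).
have N0 := ge0 _ (fun p => rneg_ge0 (f p)).
have sP : (\esum_(x in [set: T1]) (fine (\esum_(y in [set: T2]) (rpos (f (x, y)))%:E))%:E < +oo)%E.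
  under eq_esum do rewrite -p1.
  by rewrite -(tonelli (fun p => rpos (f p)))// => p; rewrite rpos_ge0.
have sN : (\esum_(x in [set: T1]) (fine (\esum_(y in [set: T2]) (rneg (f (x, y)))%:E))%:E < +oo)%E.
  under eq_esum do rewrite -n1.
  by rewrite -(tonelli (fun p => rneg (f p)))// => p; rewrite rneg_ge0.
split => //.
- rewrite /rnsum.
  apply: (@le_lt_trans _ _ (\esum_(x in [set: T1]) ((fine (\esum_(y in [set: T2]) (rpos (f (x, y)))%:E))%:E + (fine (\esum_(y in [set: T2]) (rneg (f (x, y)))%:E))%:E))%E).
    apply: le_esum => x _; rewrite E -EFinD lee_fin.
    by rewrite (le_trans (ler_normB _ _))// !ger0_norm.
  by rewrite esumD//; [rewrite lte_add_pinfty| |] => // x _; rewrite lee_fin.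
- rewrite (@rsum_sub _ _ _ _ P0 N0 E sP sN) fE.
  congr (fine _ - fine _); under eq_esum do rewrite -?p1 -?n1.
    by rewrite (tonelli (fun p => rpos (f p)))// => p; rewrite rpos_ge0.
  by rewrite (tonelli (fun p => rneg (f p)))// => p; rewrite rneg_ge0.
Qed.

End csum_theory.

(** * Absolutely summable complex families *)

Section isum_theory.
Variable R : realType.
Local Notation C := R[i].
Local Notation nc := (@Normc.normc R).
Local Notation Re := (@complex.Re R).
Local Notation Im := (@complex.Im R).

(** Summability is part of the statement, so that sums can be added, scaled,
    exchanged and reindexed without separate side conditions. *)
Definition isum (T : choiceType) (f : T -> C) (c : C) : Prop :=
  (nsum f < +oo)%E /\ csum [set: T] f = c.

Lemma ncD (x y : C) : nc (x + y) <= nc x + nc y.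
Proof. exact: le_normcD. Qed.

Lemma ncN (x : C) : nc (- x) = nc x.
Proof. exact: normcN. Qed.

Lemma ncZ (r : R) : nc (r%:C)%C = `|r|.
Proof. by rewrite /= expr0n addr0 sqrtr_sqr. Qed.

Lemma ncR (r : R) : 0 <= r -> nc (r%:C)%C = r.
Proof. by move=> r0; rewrite ncZ ger0_norm. Qed.

Lemma Re_nc (x : C) : `|Re x| <= nc x.
Proof.
by case: x => a b /=; rewrite -sqrtr_sqr ler_wsqrtr// lerDl sqr_ge0.
Qed.

Lemma Im_nc (x : C) : `|Im x| <= nc x.
Proof.
by case: x => a b /=; rewrite -sqrtr_sqr ler_wsqrtr// lerDr sqr_ge0.
Qed.

Lemma nc_ReIm (x : C) : nc x <= `|Re x| + `|Im x|.
Proof.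
rewrite {1}(complexE x) (le_trans (ncD _ _))//.
by rewrite Normc.normcM !ncZ /= expr0n expr1n add0r sqrtr1 mul1r.
Qed.

Lemma nsumE (T : choiceType) (f : T -> C) :
  (nsum f < +oo)%E -> nsum f = (fine (nsum f))%:E.
Proof. by move=> h; rewrite fineK// ge0_fin_numE// nsum_ge0. Qed.

Lemma nsum_le (T : choiceType) (f g : T -> C) :
  (forall x, nc (f x) <= nc (g x)) -> (nsum f <= nsum g)%E.
Proof. by move=> h; apply: le_esum => x _; rewrite lee_fin. Qed.

Lemma nsum_eq (T : choiceType) (f g : T -> C) :
  (forall x, nc (f x) = nc (g x)) -> (nsum f = nsum g)%E.
Proof. by move=> h; apply: eq_esum => x _; rewrite h. Qed.

Lemma nsumD (T : choiceType) (f g : T -> C) :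
  (nsum (fun x => f x + g x)%R <= nsum f + nsum g)%E.
Proof.
rewrite /nsum -esumD; try by move=> x _; rewrite lee_fin nc_ge0.
by apply: le_esum => x _; rewrite -EFinD lee_fin ncD.
Qed.

Lemma nsumZ (T : choiceType) (c : C) (f : T -> C) :
  nsum (fun x => c * f x) = ((nc c)%:E * nsum f)%E.
Proof.
rewrite /nsum -esumZ ?nc_ge0//; last by move=> x; rewrite nc_ge0.
by apply: eq_esum => x _; rewrite Normc.normcM.
Qed.

Lemma rnsum_Re (T : choiceType) (f : T -> C) :
  (nsum f < +oo)%E -> (rnsum (fun x => Re (f x)) < +oo)%E.
Proof. by apply: le_lt_trans; apply: le_esum => x _; rewrite lee_fin Re_nc. Qed.

Lemma rnsum_Im (T : choiceType) (f : T -> C) :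
  (nsum f < +oo)%E -> (rnsum (fun x => Im (f x)) < +oo)%E.
Proof. by apply: le_lt_trans; apply: le_esum => x _; rewrite lee_fin Im_nc. Qed.

Lemma nsum_ReIm (T : choiceType) (f : T -> C) :
  (rnsum (fun x => Re (f x)) < +oo)%E -> (rnsum (fun x => Im (f x)) < +oo)%E ->
  (nsum f < +oo)%E.
Proof.
move=> h1 h2; apply: (le_lt_trans _ (lte_add_pinfty h1 h2)).
rewrite /rnsum -esumD//; apply: le_esum => x _.
by rewrite -EFinD lee_fin nc_ReIm.
Qed.

Lemma isum_csum (T : choiceType) (f : T -> C) :
  (nsum f < +oo)%E -> isum f (csum [set: T] f).
Proof. by []. Qed.

Lemma isum_eq (T : choiceType) (f g : T -> C) c :
  isum f c -> (forall x, f x = g x) -> isum g c.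
Proof. by move=> h /funext <-. Qed.

Lemma isum_uniq (T : choiceType) (f : T -> C) c d : isum f c -> isum f d -> c = d.
Proof. by move=> [_ <-] [_ <-]. Qed.

Lemma isumD (T : choiceType) (f g : T -> C) c d :
  isum f c -> isum g d -> isum (fun x => f x + g x) (c + d).
Proof.
move=> [sf <-] [sg <-]; split.
  by apply: (le_lt_trans (nsumD f g)); rewrite lte_add_pinfty.
rewrite /csum; apply/eqP; rewrite eq_complex /=; apply/andP; split; apply/eqP.
  under [X in rsum _ X = _]eq_fun do rewrite raddfD.
  by rewrite rsumD//; exact: rnsum_Re.
under [X in rsum _ X = _]eq_fun do rewrite raddfD.
by rewrite rsumD//; exact: rnsum_Im.
Qed.

Lemma rnsumZ (T : choiceType) (r : R) (f : T -> R) : (rnsum f < +oo)%E ->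
  (rnsum (fun x => r * f x)%R < +oo)%E.
Proof.
move=> sf; rewrite /rnsum; under eq_esum do rewrite normrM.
by rewrite esumZ// lte_mul_pinfty.
Qed.

Lemma isumZ (T : choiceType) (f : T -> C) c a :
  isum f c -> isum (fun x => a * f x) (a * c).
Proof.
move=> [sf <-]; split.
  by rewrite nsumZ lte_mul_pinfty// lee_fin nc_ge0.
have s1 := rnsum_Re sf; have s2 := rnsum_Im sf.
case: a => a b; rewrite /csum.
apply/eqP; rewrite eq_complex /=; apply/andP; split; apply/eqP.
  rewrite [X in rsum _ X](_ : _ = fun x => a * Re (f x) + (- b) * Im (f x)).
    by rewrite rsumD ?rsumZ ?mulNr//; exact: rnsumZ.
  by apply/funext => x; case: (f x) => u v /=; rewrite mulNr.
rewrite [X in rsum _ X](_ : _ = fun x => a * Im (f x) + b * Re (f x)).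
  by rewrite rsumD ?rsumZ//; exact: rnsumZ.
by apply/funext => x; case: (f x) => u v /=.
Qed.

Lemma isum0 (T : choiceType) : isum (fun _ : T => 0) 0.
Proof.
have s : (nsum (fun _ : T => 0%R : C) < +oo)%E.
  by rewrite /nsum esum1// => x _; rewrite Normc.normc0.
have := isumZ 0 (isum_csum s).
by rewrite !mul0r.
Qed.

Lemma isumN (T : choiceType) (f : T -> C) c : isum f c -> isum (fun x => - f x) (- c).
Proof.
by move=> /(isumZ (-1)); rewrite mulN1r => /isum_eq; apply => x; rewrite mulN1r.
Qed.

Lemma isumB (T : choiceType) (f g : T -> C) c d :
  isum f c -> isum g d -> isum (fun x => f x - g x) (c - d).
Proof. by move=> hf hg; apply: isumD => //; apply: isumN. Qed.

Lemma isumZr (T : choiceType) (f : T -> C) c a :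
  isum f c -> isum (fun x => f x * a) (c * a).
Proof. by move=> /(isumZ a); rewrite mulrC => /isum_eq; apply => x; rewrite mulrC. Qed.

Lemma isum_sum (T : choiceType) (I : Type) (r : seq I) (P : pred I) (f : I -> T -> C) (c : I -> C) :
  (forall i, P i -> isum (f i) (c i)) ->
  isum (fun x => \sum_(i <- r | P i) f i x) (\sum_(i <- r | P i) c i).
Proof.
move=> h; elim: r => [|i r IH].
  by rewrite big_nil; apply: isum_eq (isum0 T) _ => x; rewrite big_nil.
rewrite big_cons; case: ifPn => Pi.
  have /isum_eq := isumD (h _ Pi) IH.
  by apply => x; rewrite big_cons Pi.
by move/isum_eq: IH; apply => x; rewrite big_cons (negbTE Pi).
Qed.

Lemma isum_sumn (T : choiceType) (m n : nat) (f : nat -> T -> C) (c : nat -> C) :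
  (forall i, (m <= i < n)%N -> isum (f i) (c i)) ->
  isum (fun x => \sum_(m <= i < n) f i x) (\sum_(m <= i < n) c i).
Proof.
move=> h; rewrite big_nat; apply: isum_eq (isum_sum _ (f := f) h) _ => x.
by rewrite [RHS]big_nat.
Qed.

Lemma isum_le (T : choiceType) (f : T -> C) c : isum f c -> ((nc c)%:E <= nsum f)%E.
Proof.
move=> h; have [->|c0] := eqVneq c 0; first by rewrite Normc.normc0 nsum_ge0.
have nc0 : nc c != 0 by apply: contra_neq c0 => /Normc.eq0_normc.
pose u : C := (c^*)%C / (nc c)%:C%C.
have uc : u * c = (nc c)%:C%C.
  rewrite /u mulrAC; have -> : (c^*)%C * c = ((nc c)%:C%C)^+2.
    rewrite -rmorphXn /=; case: (c) => a b /=; rewrite sqr_sqrtr ?addr_ge0 ?sqr_ge0//.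
    by apply/eqP; rewrite eq_complex /=; apply/andP; split; apply/eqP; ring.
  by rewrite expr2 mulfK//; apply: contra_neq nc0 => /complexI.
have nu : nc u = 1.
  have : nc (u * c) = nc c by rewrite uc ncR// nc_ge0.
  rewrite Normc.normcM => /(congr1 (fun x => x / nc c)).
  by rewrite mulfK// divff.
have [s E] := isumZ u h.
have {E} : Re (csum [set: T] (fun x => u * f x)) = nc c by rewrite E uc.
rewrite /csum /= => <-.
have [s1 s2 ->] := rsum_posneg (rnsum_Re s).
have sn : (nsum f) = nsum (fun x => u * f x).
  by apply: nsum_eq => x; rewrite Normc.normcM nu mul1r.
apply: (@le_trans _ _ (\esum_(x in [set: T]) (rpos (Re (u * f x)))%:E)%E).
  rewrite -[leRHS]fineK ?lee_fin ?lerBlDr ?lerDl.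
    by apply: fine_ge0; apply: esum_ge0 => x _; rewrite lee_fin rneg_ge0.
  by rewrite ge0_fin_numE//; apply: esum_ge0 => x _; rewrite lee_fin rpos_ge0.
rewrite sn; apply: le_esum => x _; rewrite lee_fin.
by rewrite (le_trans (rpos_le _))// Re_nc.
Qed.

Lemma isum_ler (T : choiceType) (f : T -> C) c (b : R) :
  isum f c -> (nsum f <= b%:E)%E -> nc c <= b.
Proof. by move=> /isum_le h /(le_trans h); rewrite lee_fin. Qed.

Lemma tonelli (T1 T2 : choiceType) (F : T1 -> T2 -> \bar R) :
  (forall x y, 0 <= F x y)%E ->
  (\esum_(p in [set: T1 * T2]) F p.1 p.2 =
   \esum_(x in [set: T1]) \esum_(y in [set: T2]) F x y)%E.
Proof.
move=> F0; rewrite (@esum_esum _ _ _ _ (fun=> setT) F)//.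
by rewrite [X in _ = esum X _](_ : _ = setT)//; apply/seteqP; split.
Qed.

Lemma tonelliC (T1 T2 : choiceType) (F : T1 -> T2 -> \bar R) :
  (forall x y, 0 <= F x y)%E ->
  (\esum_(x in [set: T1]) \esum_(y in [set: T2]) F x y =
   \esum_(y in [set: T2]) \esum_(x in [set: T1]) F x y)%E.
Proof.
move=> F0; rewrite -!tonelli// (reindex_esum [set: T2 * T1] _ (fun p => (p.2, p.1)))//.
split => //=; first by move=> [a b] [c d] _ _ /= [-> ->].
by move=> [a b] _; exists (b, a).
Qed.

Lemma nsum_pair (T1 T2 : choiceType) (F : T1 * T2 -> C) :
  nsum F = (\esum_(x in [set: T1]) nsum (fun y => F (x, y)))%E.
Proof.
rewrite -(@tonelli _ _ (fun x y => (nc (F (x, y)))%:E)).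
  by apply: eq_esum => -[].
by move=> x y; rewrite lee_fin nc_ge0.
Qed.

(** Real and imaginary parts reduce this to exchanging sums of nonnegative
    families. *)
Lemma isum_fubini (T1 T2 : choiceType) (F : T1 * T2 -> C) c :
  isum F c ->
  (forall x, isum (fun y => F (x, y)) (csum [set: T2] (fun y => F (x, y)))) /\
  isum (fun x => csum [set: T2] (fun y => F (x, y))) c.
Proof.
move=> [sF <-].
have [r1 r2 r3] := rsum_fubini (rnsum_Re sF).
have [i1 i2 i3] := rsum_fubini (rnsum_Im sF).
split; first by move=> x; apply: isum_csum; exact: nsum_ReIm.
split; first by apply: nsum_ReIm.
by rewrite /csum /= r3 i3.
Qed.

Lemma isum_pairE (T1 T2 : choiceType) (F : T1 -> T2 -> C) (g : T1 -> C) c :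
  (nsum (fun p : T1 * T2 => F p.1 p.2) < +oo)%E ->
  (forall x, isum (F x) (g x)) -> isum g c ->
  isum (fun p : T1 * T2 => F p.1 p.2) c.
Proof.
move=> sF hF hg; split => //.
have [h1 h2] := isum_fubini (isum_csum sF).
by apply: isum_uniq (h2) _; apply: isum_eq hg _ => x; have [_ <-] := hF x.
Qed.

(** Together with [isum_reindex] this is the main tool for rearranging
    multiple sums: summability is proved once for the whole family, then the
    inner sums may be computed separately. *)
Lemma isum_pairI (T1 T2 : choiceType) (F : T1 -> T2 -> C) (g : T1 -> C) c :
  isum (fun p : T1 * T2 => F p.1 p.2) c ->
  (forall x, isum (F x) (g x)) -> isum g c.
Proof.
move=> hF hg; have [_ /isum_eq] := isum_fubini hF.
by apply => x; have [_ <-] := hg x.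
Qed.

Lemma esum_supp (T T' : choiceType) (h : T -> T') (a : T' -> \bar R) :
  injective h -> (forall y, (forall x, h x <> y) -> a y = 0%E) ->
  (\esum_(y in [set: T']) a y = \esum_(x in [set: T]) a (h x))%E.
Proof.
move=> hi h0; rewrite -(esum_image [set: T] h a); last by move=> x y _ _; exact: hi.
rewrite [RHS]esum_mkcond; apply: eq_esum => y _.
case: ifPn => //; rewrite notin_setE /= => hy; apply: h0 => x xy; apply: hy.
by exists x.
Qed.

Lemma nsum_reindex (T T' : choiceType) (h : T -> T') (f : T' -> C) :
  injective h -> (forall y, (forall x, h x <> y) -> f y = 0) ->
  nsum f = nsum (fun x => f (h x)).
Proof.
move=> hi h0; apply: (esum_supp hi) => y hy.
by rewrite h0// Normc.normc0.
Qed.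

(** The injection need not be onto; the indices outside its image contribute
    zero. *)
Lemma isum_reindex (T T' : choiceType) (h : T -> T') (f : T' -> C) c :
  injective h -> (forall y, (forall x, h x <> y) -> f y = 0) ->
  isum f c <-> isum (fun x => f (h x)) c.
Proof.
move=> hi h0; rewrite /isum (nsum_reindex hi h0).
suff -> : csum [set: T'] f = csum [set: T] (fun x => f (h x)) by [].
rewrite /csum /rsum; congr (fine (_ - _) +i* fine (_ - _))%C;
  (rewrite (esum_supp hi); first by apply: eq_esum => x _; rewrite ?funeposE ?funenegE);
  by move=> y hy; rewrite ?funeposE ?funenegE /= h0//= ?oppr0 maxxx.
Qed.

Lemma isum_pt (T : choiceType) (a : T) (v : C) :
  isum (fun x => if x == a then v else 0) v.
Proof.
have s : (nsum (fun x => if x == a then v else 0%R : C) < +oo)%E.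
  rewrite (@nsum_reindex unit T (fun=> a))//; last 2 first.
  - by case; case.
  - by move=> y /(_ tt); case: eqP => // ->.
  rewrite /nsum (_ : [set: unit] = [set tt]) ?esum_set1 ?ltry ?lee_fin ?nc_ge0//.
  by apply/seteqP; split => -[].
split => //.
have key (f : unit -> R) : rsum [set: unit] f = f tt.
  rewrite /rsum (_ : [set: unit] = [set tt]); last by apply/seteqP; split => -[].
  rewrite !esum_set1//= ?funeposE ?funenegE ?le_max ?lexx ?orbT//=.
  by rewrite -!EFin_max -EFinB /= -/(rpos _) -/(rneg _) -rposB.
pose f x : C := if x == a then v else 0.
have f0 y : (forall x : unit, a <> y) -> f y = 0.
  by move=> /(_ tt); rewrite /f; case: eqP => // ->.
have h : isum (fun x : unit => f a) v.
  split; first by rewrite -(@nsum_reindex _ _ (fun=> a))//; case; case.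
  by rewrite /csum !key /f eqxx; case: (v).
by have [] := (@isum_reindex _ _ (fun _ : unit => a) f v (fun '(tt) '(tt) _ => erefl) f0).2 h.
Qed.

Lemma isum_seq (T : choiceType) (r : seq T) (f : T -> C) :
  uniq r -> (forall x, x \notin r -> f x = 0) -> isum f (\sum_(x <- r) f x).
Proof.
move=> ur f0.
have h : isum (fun x => \sum_(a <- r) (if x == a then f a else 0)) (\sum_(a <- r) f a).
  by apply: isum_sum => a _; exact: isum_pt.
apply: isum_eq h _ => x; case: (boolP (x \in r)) => xr.
  rewrite (bigD1_seq x)//= eqxx big1 ?addr0// => i; rewrite eq_sym => /negbTE ->//.
rewrite f0// big_seq big1// => i ir; case: eqP => // xi; by rewrite xi ir in xr.
Qed.

(** Complex conjugation only changes the sign of the imaginary parts. *)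
Lemma isum_conj (T : choiceType) (f : T -> C) c :
  isum f c -> isum (fun x => (f x)^*)%C (c^*)%C.
Proof.
move=> [sf <-]; split.
  by rewrite (nsum_eq (g := f))// => x; case: (f x) => a b /=; rewrite sqrrN.
rewrite /csum /=; apply/eqP; rewrite eq_complex /=; apply/andP; split; apply/eqP.
  by congr rsum; apply/funext => x; case: (f x).
rewrite -rsumN; last exact: rnsum_Im.
by congr rsum; apply/funext => x; case: (f x).
Qed.

Lemma isum_mul (T1 T2 : choiceType) (f : T1 -> C) (g : T2 -> C) c d :
  isum f c -> isum g d -> isum (fun p : T1 * T2 => f p.1 * g p.2) (c * d).
Proof.
move=> hf hg; apply: (isum_pairE (F := fun x y => f x * g y) (g := fun x => f x * d)).
- rewrite nsum_pair /=; under eq_esum do rewrite nsumZ.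
  case: hf hg => sf _ [sg _]; rewrite (nsumE sg).
  under eq_esum do rewrite -EFinM mulrC.
  rewrite esumZ; [|exact/fine_ge0/nsum_ge0|by move=> x; rewrite nc_ge0].
  by rewrite lte_mul_pinfty// lee_fin fine_ge0// nsum_ge0.
- by move=> x; apply: isumZ.
- exact: isumZr.
Qed.

End isum_theory.

(** * Derivations of functions of words *)

Section kernels.
Variables (nonneg : bool) (d : nat).
Local Notation Z := (mode nonneg d).
Local Notation V := ('rV[int]_d).

Definition mom1 (k : Z) : V := if k.2 then val k.1 else - val k.1.

Lemma mom_nil : momentum ([::] : seq Z) = 0.
Proof. by rewrite /momentum big_nil. Qed.

Lemma mom_cons k (w : seq Z) : momentum (k :: w) = mom1 k + momentum w.
Proof. by rewrite /momentum big_cons. Qed.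

Lemma mom_cat (v w : seq Z) : momentum (v ++ w) = momentum v + momentum w.
Proof. by rewrite /momentum big_cat. Qed.

Lemma mom1_bar k : mom1 (ibar k) = - mom1 k.
Proof. by case: k => a []; rewrite /mom1 /= ?opprK. Qed.

Lemma ibarK : involutive (@ibar nonneg d).
Proof. by case=> a b; rewrite /ibar /= negbK. Qed.

Lemma mom_bar (w : seq Z) : momentum (map (@ibar _ _) w) = - momentum w.
Proof.
elim: w => [|k w IH]; first by rewrite mom_nil oppr0.
by rewrite /= !mom_cons IH mom1_bar opprD.
Qed.

(** The modes of a given momentum: for each sign there is at most one,
    obtained from the vector or its opposite when this lies in the lattice.
    Summing over this finite list keeps the derivation below purely
    algebraic. *)
Definition cand (q : V) : seq Z :=
  oapp (fun a : {a | in_lattice nonneg a} => [:: (a, true)]) [::] (insub q) ++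
  oapp (fun a : {a | in_lattice nonneg a} => [:: (a, false)]) [::] (insub (- q)).

Lemma mem_cand (q : V) (k : Z) : (k \in cand q) = (mom1 k == q).
Proof.
rewrite /cand mem_cat; case: k => a b; rewrite /mom1 /=.
case: insubP => [u _ uq|nq]; case: insubP => [u' _ uq'|nq'] /=.
- rewrite !inE !xpair_eqE; case: b; rewrite ?andbT ?andbF ?orbF /=.
    by rewrite -(inj_eq val_inj) uq.
  by rewrite -(inj_eq val_inj) uq' eqr_oppLR.
- rewrite !inE !xpair_eqE; case: b; rewrite ?andbT ?andbF ?orbF /=.
    by rewrite -(inj_eq val_inj) uq.
  apply/esym/negbTE; apply: contra nq' => /eqP <-; rewrite opprK; exact: valP.
- rewrite !inE !xpair_eqE; case: b; rewrite ?andbT ?andbF ?orbF /=.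
    apply/esym/negbTE; apply: contra nq => /eqP <-; exact: valP.
  by rewrite -(inj_eq val_inj) uq' eqr_oppLR.
- apply/esym/negbTE; case: b.
    apply: contra nq => /eqP <-; exact: valP.
  apply: contra nq' => /eqP <-; rewrite opprK; exact: valP.
Qed.

Lemma size_cand q : (size (cand q) <= 2)%N.
Proof. by rewrite /cand size_cat; case: insub => [?|]; case: insub. Qed.

Lemma uniq_cand q : uniq (cand q).
Proof. by rewrite /cand; case: insub => [?|]; case: insub => [?|] //=; rewrite inE xpair_eqE andbF. Qed.

Section ring.
Variable A : comNzRingType.
Implicit Types (f g : seq Z -> A) (X Y : Z -> seq Z -> A) (F G : seq Z -> seq Z -> A).

(** The sum over all the ways to cut a word in two. *)
Fixpoint conv F (v : seq Z) : A :=
  F [::] v + (if v is c :: v' then conv (fun y z => F (c :: y) z) v' else 0).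

Lemma conv_nil F : conv F [::] = F [::] [::].
Proof. exact: addr0. Qed.

Lemma conv_cons F c v :
  conv F (c :: v) = F [::] (c :: v) + conv (fun y z => F (c :: y) z) v.
Proof. by []. Qed.

Lemma eq_conv_in F G v : (forall y z, y ++ z = v -> F y z = G y z) -> conv F v = conv G v.
Proof.
elim: v F G => [|c v IH] F G h /=; rewrite h//.
congr (_ + _); apply: IH => y z yz; apply: h; by rewrite -yz.
Qed.

Lemma eq_conv F G v : (forall y z, F y z = G y z) -> conv F v = conv G v.
Proof. by move=> h; apply: eq_conv_in. Qed.

Lemma convD F G v : conv (fun y z => F y z + G y z) v = conv F v + conv G v.
Proof.
elim: v F G => [|c v IH] F G /=; first by rewrite !addr0.
rewrite IH; ring.
Qed.

Lemma convZ a F v : conv (fun y z => a * F y z) v = a * conv F v.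
Proof.
elim: v F => [|c v IH] F /=; first by rewrite !addr0.
by rewrite IH mulrDr.
Qed.

Lemma conv0 v : conv (fun _ _ => 0) v = 0.
Proof. by elim: v => [|c v /= ->] /=; rewrite addr0. Qed.

Lemma conv_sum (I : Type) (r : seq I) (F : I -> seq Z -> seq Z -> A) v :
  conv (fun y z => \sum_(i <- r) F i y z) v = \sum_(i <- r) conv (F i) v.
Proof.
elim: r => [|i r IH].
  by rewrite big_nil -[RHS](conv0 v); apply: eq_conv => y z; rewrite big_nil.
by rewrite big_cons -IH -convD; apply: eq_conv => y z; rewrite big_cons.
Qed.

Lemma conv_assoc (G : seq Z -> seq Z -> seq Z -> A) v :
  conv (fun y z => conv (fun a b => G a b z) y) v =
  conv (fun a z => conv (fun b c => G a b c) z) v.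
Proof.
elim: v G => [|c v IH] G //=.
by rewrite convD IH addr0 -!addrA.
Qed.

Lemma conv_sumE F v :
  conv F v = \sum_(0 <= i < (size v).+1) F (take i v) (drop i v).
Proof.
elim: v F => [|c v IH] F /=; first by rewrite big_nat1 addr0.
by rewrite IH [RHS]big_nat_recl.
Qed.

Definition pair_at X f (y z : seq Z) : A :=
  \sum_(k <- cand (momentum y)) X k y * f (k :: z).

Definition T X f v : A := conv (pair_at X f) v.

(** The derivation of the algebra of noncommutative polynomials that sends a
    letter k to the series with coefficients [X k], written on coefficient
    functions: a factor y of the word is contracted to a letter k of the
    same momentum.  The first term contracts a prefix, the second leaves the
    first letter alone. *)
Fixpoint L X f v : A :=
  T X f v + (if v is c :: v' then L X (fun w => f (c :: w)) v' else 0).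

Lemma LE X f v :
  L X f v = T X f v + (if v is c :: v' then L X (fun w => f (c :: w)) v' else 0).
Proof. by case: v. Qed.

Lemma T_local X f g v :
  (forall w, momentum w = momentum v -> f w = g w) -> T X f v = T X g v.
Proof.
move=> h; apply: eq_conv_in => y z yz; rewrite /pair_at big_seq [RHS]big_seq.
apply: eq_bigr => k; rewrite mem_cand => /eqP kq; congr (_ * _); apply: h.
by rewrite mom_cons kq -mom_cat yz.
Qed.

(** The derivation preserves momentum, since a factor is replaced by a
    letter of the same momentum. *)
Lemma L_local X f g v :
  (forall w, momentum w = momentum v -> f w = g w) -> L X f v = L X g v.
Proof.
elim: v f g => [|c v IH] f g h; rewrite LE [RHS]LE (T_local X h)//.
congr (_ + _); apply: IH => w wv; apply: h; by rewrite !mom_cons wv.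
Qed.

Lemma eq_L X f g v : (forall w, f w = g w) -> L X f v = L X g v.
Proof. by move=> h; apply: L_local => w _. Qed.

Lemma TfD X f g v : T X (fun w => f w + g w) v = T X f v + T X g v.
Proof.
rewrite /T -convD; apply: eq_conv => y z; rewrite /pair_at -big_split /=.
by apply: eq_bigr => k _; rewrite mulrDr.
Qed.

Lemma TfZ X a f v : T X (fun w => a * f w) v = a * T X f v.
Proof.
rewrite /T -convZ; apply: eq_conv => y z; rewrite /pair_at big_distrr /=.
by apply: eq_bigr => k _; rewrite mulrCA.
Qed.

Lemma LfD X f g v : L X (fun w => f w + g w) v = L X f v + L X g v.
Proof.
elim: v f g => [|c v IH] f g; rewrite LE [L X f _]LE [L X g _]LE TfD ?IH; ring.
Qed.

Lemma LfZ X a f v : L X (fun w => a * f w) v = a * L X f v.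
Proof.
elim: v f => [|c v IH] f; rewrite LE [L X f _]LE TfZ ?IH; ring.
Qed.

Lemma LfZr X a f v : L X (fun w => f w * a) v = L X f v * a.
Proof. by rewrite mulrC -LfZ; apply: eq_L => w; rewrite mulrC. Qed.

Lemma Lf0 X v : L X (fun _ => 0) v = 0.
Proof. by rewrite -[RHS](mul0r (L X (fun=> 0) v)) -LfZ; apply: eq_L => w; rewrite mul0r. Qed.

Lemma Lf_sum X (I : Type) (r : seq I) (P : pred I) (f : I -> seq Z -> A) v :
  L X (fun w => \sum_(i <- r | P i) f i w) v = \sum_(i <- r | P i) L X (f i) v.
Proof.
elim: r => [|i r IH].
  by rewrite big_nil -[RHS](Lf0 X v); apply: eq_L => w; rewrite big_nil.
rewrite big_cons; case: ifPn => Pi.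
  by rewrite -IH -LfD; apply: eq_L => w; rewrite big_cons Pi.
by rewrite -IH; apply: eq_L => w; rewrite big_cons (negbTE Pi).
Qed.

Lemma eq_LX X Y f v : (forall k w, X k w = Y k w) -> L X f v = L Y f v.
Proof.
move=> h; elim: v f => [|c v IH] f; rewrite LE [RHS]LE ?IH; congr (_ + _);
by apply: eq_conv => y z; apply: eq_bigr => k _; rewrite h.
Qed.

Lemma TXD X Y f v : T (fun k w => X k w + Y k w) f v = T X f v + T Y f v.
Proof.
rewrite /T -convD; apply: eq_conv => y z; rewrite /pair_at -big_split /=.
by apply: eq_bigr => k _; rewrite mulrDl.
Qed.

Lemma TXZ a X f v : T (fun k w => a * X k w) f v = a * T X f v.
Proof.
rewrite /T -convZ; apply: eq_conv => y z; rewrite /pair_at big_distrr /=.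
by apply: eq_bigr => k _; rewrite mulrA.
Qed.

Lemma LXD X Y f v : L (fun k w => X k w + Y k w) f v = L X f v + L Y f v.
Proof.
elim: v f => [|c v IH] f; rewrite LE [L X f _]LE [L Y f _]LE TXD ?IH; ring.
Qed.

Lemma LXZ a X f v : L (fun k w => a * X k w) f v = a * L X f v.
Proof.
elim: v f => [|c v IH] f; rewrite LE [L X f _]LE TXZ ?IH; ring.
Qed.

Lemma LX0 f v : L (fun _ _ => 0) f v = 0.
Proof.
by rewrite -[RHS](mul0r (L (fun _ _ => 0) f v)) -LXZ; apply: eq_LX => k w; rewrite mul0r.
Qed.

(** The Leibniz rule for the product of coefficient functions. *)
Lemma L_conv X F v :
  L X (conv F) v =
  conv (fun y z => L X (fun y' => F y' z) y + L X (F y) z) v.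
Proof.
elim: v F => [|c v IH] F.
all: have TE u : T X (conv F) u = T X (F [::]) u + conv (fun y z => T X (fun y' => F y' z) y) u.
1,3: rewrite /T (conv_assoc (fun a b z => \sum_(k <- cand (momentum a)) X k a * F (k :: b) z)).
1,2: rewrite -convD; apply: eq_conv => y z; rewrite /pair_at conv_sum -big_split /=.
1,2: by apply: eq_bigr => k _; rewrite /= convZ mulrDr.
- by rewrite [LHS]LE TE convD /=; ring.
rewrite [LHS]LE TE.
have -> : L X (fun w => conv F (c :: w)) v =
   L X (fun w => F [::] (c :: w)) v + L X (conv (fun y z => F (c :: y) z)) v.
  by rewrite -LfD.
rewrite IH !convD /= !(convD (fun y z => T X (fun w => F w z) (c :: y))).
ring.
Qed.

Definition brkf X Y : Z -> seq Z -> A := fun k y => L X (Y k) y - L Y (X k) y.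

Lemma LL_half X Y f v :
  L X (L Y f) v = T (fun k => L X (Y k)) f v
   + (conv (fun y z => \sum_(k <- cand (momentum y)) Y k y * L X (fun w => f (k :: w)) z) v
     + conv (fun y z => \sum_(k <- cand (momentum y)) X k y * L Y (fun w => f (k :: w)) z) v)
   + (if v is c :: v' then L X (L Y (fun w => f (c :: w))) v' else 0).
Proof.
have LT : L X (T Y f) v = T (fun k => L X (Y k)) f v +
   conv (fun y z => \sum_(k <- cand (momentum y)) Y k y * L X (fun w => f (k :: w)) z) v.
  rewrite /T L_conv convD; congr (_ + _); apply: eq_conv => y z; rewrite /pair_at.
    rewrite (@L_local X _ (fun y' => \sum_(k <- cand (momentum y)) Y k y' * f (k :: z))).
      by rewrite Lf_sum; apply: eq_bigr => k _; rewrite LfZr.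
    by move=> w ->.
  by rewrite Lf_sum; apply: eq_bigr => k _; rewrite LfZ.
have TL : T X (L Y f) v = T X (T Y f) v +
   conv (fun y z => \sum_(k <- cand (momentum y)) X k y * L Y (fun w => f (k :: w)) z) v.
  rewrite /T -convD; apply: eq_conv => y z; rewrite /pair_at -big_split /=.
  by apply: eq_bigr => k _; rewrite mulrDr.
rewrite [LHS]LE TL addrA -LT [in RHS]LE.
case: v {LT TL} => [|c v]; first by ring.
have -> : L X (fun w => L Y f (c :: w)) v =
   L X (fun w => T Y f (c :: w)) v + L X (L Y (fun w => f (c :: w))) v.
  by rewrite -LfD.
ring.
Qed.

Arguments T : simpl never.
Arguments conv : simpl never.
Arguments L : simpl never.

(** A commutator of derivations is a derivation, hence determined by its
    effect on letters.  The proof is by induction on the word: the terms in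
    which the two contractions are disjoint cancel. *)
Lemma L_comm X Y f v : L X (L Y f) v - L Y (L X f) v = L (brkf X Y) f v.
Proof.
elim: v f => [|c v IH] f; rewrite (LL_half X Y) (LL_half Y X) [RHS]LE /brkf.
  have -> : T (fun k y => L X (Y k) y - L Y (X k) y) f [::] =
    T (fun k => L X (Y k)) f [::] - T (fun k => L Y (X k)) f [::].
    by rewrite -mulN1r -TXZ -TXD; congr T; apply/funext => k; apply/funext => y; rewrite mulN1r.
  by rewrite /=; ring.
have -> : T (fun k y => L X (Y k) y - L Y (X k) y) f (c :: v) =
  T (fun k => L X (Y k)) f (c :: v) - T (fun k => L Y (X k)) f (c :: v).
  by rewrite -mulN1r -TXZ -TXD; congr T; apply/funext => k; apply/funext => y; rewrite mulN1r.
by rewrite /= -/(brkf X Y) -IH; ring.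
Qed.

(** The explicit form of the derivation, as a sum over the position and the
    length of the contracted factor. *)
Lemma L_sumE X f v :
  L X f v = \sum_(0 <= i < (size v).+1) \sum_(0 <= p < (size v - i).+1)
    \sum_(k <- cand (momentum (take p (drop i v))))
     X k (take p (drop i v)) * f (take i v ++ k :: drop (i + p) v).
Proof.
elim: v f => [|c v IH] f; rewrite LE /T conv_sumE.
  by rewrite !big_nat1 addr0 /= ?big_nat1.
rewrite IH [RHS]big_nat_recl//; congr (_ + _).
Qed.

Lemma T_sumE X f v :
  T X f v = \sum_(0 <= p < (size v).+1)
    \sum_(k <- cand (momentum (take p v)))
     X k (take p v) * f (k :: drop p v).
Proof. by rewrite /T conv_sumE. Qed.

Lemma T_letter X b v : T X (fun w => (w == [:: b])%:R) v =
  if momentum v == mom1 b then X b v else 0.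
Proof.
rewrite T_sumE big_nat_recr//= big_nat big1 ?add0r => [|p /andP[_ pv]]; last first.
  rewrite big1// => k _; rewrite eqseq_cons.
  case: (drop p v) (size_drop p v) => [|? ?]; last by rewrite andbF mulr0.
  by move=> /eqP; rewrite eq_sym subn_eq0 leqNgt pv.
rewrite take_size drop_size.
under eq_bigr do rewrite eqseq_cons eqxx andbT.
case: ifPn => [vb|].
  rewrite (bigD1_seq b)/= ?uniq_cand// ?mem_cand 1?eq_sym//.
  by rewrite eqxx mulr1 big1 ?addr0// => k /negbTE ->; rewrite mulr0.
rewrite eq_sym => bv; rewrite big_seq big1// => k; rewrite mem_cand => kv.
case: eqP => [kb|]; last by rewrite mulr0.
by rewrite -kb kv in bv.
Qed.

End ring.
End kernels.
Arguments conv : simpl never.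
Arguments T : simpl never.
Arguments L : simpl never.

(** * Hamiltonian derivations and the Poisson bracket *)

Section kernel_tools.
Variables (nonneg : bool) (d : nat).
Local Notation Z := (mode nonneg d).
Local Notation bar := (@ibar nonneg d).

Lemma conv_closed (A : comNzRingType) (P : A -> Prop) (F : seq Z -> seq Z -> A) v :
  P 0 -> (forall x y, P x -> P y -> P (x + y)) ->
  (forall y z, y ++ z = v -> P (F y z)) -> P (conv F v).
Proof.
move=> P0 PD; elim: v F => [|c v IH] F h; rewrite ?conv_nil ?conv_cons.
  exact: h.
apply: (PD); first exact: h.
by apply: IH => y z yz; apply: h; rewrite -yz.
Qed.

Lemma sum_cand_closed (A : comNzRingType) (P : A -> Prop) (q : 'rV[int]_d) (F : Z -> A) :
  P 0 -> (forall x y, P x -> P y -> P (x + y)) ->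
  (forall k, mom1 k = q -> P (F k)) -> P (\sum_(k <- cand nonneg q) F k).
Proof.
move=> P0 PD h; rewrite big_seq; apply: (big_ind P) => // k.
by rewrite mem_cand => /eqP; exact: h.
Qed.

(** Every predicate stable under sums that holds for the elementary
    contractions holds for the derivation; it transports supports and
    gradings. *)
Lemma L_closed (A : comNzRingType) (P : A -> Prop) (X : Z -> seq Z -> A) f v :
  P 0 -> (forall x y, P x -> P y -> P (x + y)) ->
  (forall x y z k, x ++ y ++ z = v -> mom1 k = momentum y -> P (X k y * f (x ++ k :: z))) ->
  P (L X f v).
Proof.
move=> P0 PD; elim: v f => [|c v IH] f h; rewrite LE.
  rewrite addr0; apply: (conv_closed P0 PD) => y z yz.
  apply: (sum_cand_closed P0 PD) => k kq; exact: (h [::] y z k yz kq).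
apply: (PD).
  apply: (conv_closed P0 PD) => y z yz.
  apply: (sum_cand_closed P0 PD) => k kq; exact: (h [::] y z k yz kq).
apply: IH => x y z k xyz kq; apply: (h (c :: x) y z k) => //=.
by rewrite xyz.
Qed.

Lemma L_map (A B : comNzRingType) (phi : A -> B) (X : Z -> seq Z -> A) f v :
  phi 0 = 0 -> {morph phi : x y / x + y} -> {morph phi : x y / x * y} ->
  phi (L X f v) = L (fun k w => phi (X k w)) (fun w => phi (f w)) v.
Proof.
move=> p0 pD pM.
have psum (I : Type) (r : seq I) (F : I -> A) : phi (\sum_(i <- r) F i) = \sum_(i <- r) phi (F i).
  by elim: r => [|i r IH]; rewrite ?big_nil// !big_cons pD IH.
have Cm (F : seq Z -> seq Z -> A) u : phi (conv F u) = conv (fun y z => phi (F y z)) u.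
  by elim: u F => [|c u IH] F; rewrite ?conv_nil// !conv_cons pD IH.
have Tm g u : phi (T X g u) = T (fun k w => phi (X k w)) (fun w => phi (g w)) u.
  rewrite /T Cm; apply: eq_conv => y z; rewrite /pair_at psum.
  by apply: eq_bigr => k _; rewrite pM.
by elim: v f => [|c v IH] f; rewrite LE [RHS]LE pD Tm ?IH ?p0.
Qed.

Lemma conv_bar (A : comNzRingType) (F : seq Z -> seq Z -> A) v :
  conv F (map bar v) = conv (fun y z => F (map bar y) (map bar z)) v.
Proof.
elim: v F => [|c v IH] F; first by rewrite !conv_nil.
by rewrite /= !conv_cons IH.
Qed.

Lemma sum_cand_bar (A : comNzRingType) (q : 'rV[int]_d) (F : Z -> A) :
  \sum_(k <- cand nonneg (- q)) F k = \sum_(k <- cand nonneg q) F (bar k).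
Proof.
rewrite -(big_map bar xpredT F); apply: perm_big; apply: uniq_perm.
- exact: uniq_cand.
- by rewrite map_inj_uniq ?uniq_cand//; exact: (can_inj (@ibarK _ _)).
move=> k; rewrite mem_cand -[k in RHS](@ibarK _ _) mem_map; last exact: (can_inj (@ibarK _ _)).
by rewrite mem_cand mom1_bar eqr_oppLR.
Qed.

Lemma L_bar (A : comNzRingType) (X : Z -> seq Z -> A) f v :
  L X f (map bar v) =
  L (fun k w => X (bar k) (map bar w)) (fun w => f (map bar w)) v.
Proof.
have Tb g u : T X g (map bar u) =
    T (fun k w => X (bar k) (map bar w)) (fun w => g (map bar w)) u.
  rewrite /T conv_bar; apply: eq_conv => y z.
  by rewrite /pair_at mom_bar sum_cand_bar.
elim: v f => [|c v IH] f; rewrite LE [RHS]LE -Tb //=.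
by rewrite IH.
Qed.

(** A derivation of the coefficient ring passes through the derivation of
    words by the product rule; it is used for the derivative with respect to
    the formal step size. *)
Lemma L_deriv (A : comNzRingType) (dl : A -> A) (X : Z -> seq Z -> A) f v :
  dl 0 = 0 -> (forall x y, dl (x + y) = dl x + dl y) ->
  (forall x y, dl (x * y) = dl x * y + x * dl y) ->
  dl (L X f v) = L (fun k w => dl (X k w)) f v + L X (fun w => dl (f w)) v.
Proof.
move=> d0 dD dM.
have dsum (I : Type) (r : seq I) (F : I -> A) : dl (\sum_(i <- r) F i) = \sum_(i <- r) dl (F i).
  by elim: r => [|i r IH]; rewrite ?big_nil// !big_cons dD IH.
have Cd (F : seq Z -> seq Z -> A) u : dl (conv F u) = conv (fun y z => dl (F y z)) u.
  by elim: u F => [|c u IH] F; rewrite ?conv_nil// !conv_cons dD IH.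
have Td g u : dl (T X g u) = T (fun k w => dl (X k w)) g u + T X (fun w => dl (g w)) u.
  rewrite /T Cd -convD; apply: eq_conv => y z; rewrite /pair_at dsum -big_split /=.
  by apply: eq_bigr => k _; rewrite dM.
elim: v f => [|c v IH] f; rewrite LE dD Td ?IH ?d0 [L _ f _]LE [L X (fun w => dl (f w)) _]LE; ring.
Qed.

Lemma L_nonempty (A : comNzRingType) (X : Z -> seq Z -> A) f g v :
  (forall k w, f (k :: w) = g (k :: w)) -> L X f v = L X g v.
Proof.
move=> h; rewrite !L_sumE; apply: eq_bigr => i _; apply: eq_bigr => p _.
by apply: eq_bigr => k _; case: (take i v) => [|? ?] /=; rewrite h.
Qed.

Lemma L_letter (A : comNzRingType) (X : Z -> seq Z -> A) (b : Z) v :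
  L X (fun w => (w == [:: b])%:R) v = if momentum v == mom1 b then X b v else 0.
Proof.
rewrite LE T_letter; case: v => [|c v]; first by rewrite addr0.
rewrite (@L_nonempty _ X _ (fun _ => 0)) ?Lf0 ?addr0//.
by move=> k w; rewrite eqseq_cons andbF.
Qed.

(** There are at most (n+1)^2 factors of a word of length n and at most two
    letters of a given momentum. *)
Lemma L_bound (R : numDomainType) (A : comNzRingType) (nu : A -> R) (X : Z -> seq Z -> A) f v (B : R) :
  nu 0 = 0 -> (forall x y, nu (x + y) <= nu x + nu y) -> 0 <= B ->
  (forall x y z k, x ++ y ++ z = v -> mom1 k = momentum y ->
     nu (X k y * f (x ++ k :: z)) <= B) ->
  nu (L X f v) <= (2 * (size v).+1 ^ 2)%:R * B.
Proof.
move=> n0 nD B0 h.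
have nusum (I : Type) (r : seq I) (P : pred I) (F : I -> A) (b : R) : 0 <= b ->
    (forall i, P i -> nu (F i) <= b) -> nu (\sum_(i <- r | P i) F i) <= (size r)%:R * b.
  move=> b0 hr; elim: r => [|i r IH]; first by rewrite big_nil n0 mul0r.
  rewrite big_cons -natr1 mulrDl mul1r; case: ifPn => Pi.
    by rewrite (le_trans (nD _ _))// addrC lerD// hr.
  by rewrite (le_trans IH)// lerDl.
have -> : (2 * (size v).+1 ^ 2)%:R * B = (size v).+1%:R * ((size v).+1%:R * (2%:R * B)).
  by rewrite !natrM; ring.
rewrite L_sumE.
have B20 : 0 <= 2%:R * B by rewrite mulr_ge0.
have B30 : 0 <= (size v).+1%:R * (2%:R * B) by rewrite mulr_ge0.
have S3 : (size (index_iota 0 (size v).+1))%:R * ((size v).+1%:R * (2%:R * B)) <=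
   (size v).+1%:R * ((size v).+1%:R * (2%:R * B)) by rewrite size_iota subn0.
apply: le_trans S3; rewrite big_seq; apply: (nusum) => // i; rewrite mem_index_iota => /andP[_ iv].
have S2 : (size (index_iota 0 (size v - i).+1))%:R * (2%:R * B) <= (size v).+1%:R * (2%:R * B).
  by rewrite size_iota subn0 ler_wpM2r// ler_nat ltnS leq_subr.
apply: le_trans S2; rewrite big_seq; apply: (nusum) => // p; rewrite mem_index_iota => /andP[_ piv].
have S1 : (size (cand nonneg (momentum (take p (drop i v)))))%:R * B <= 2%:R * B.
  by rewrite ler_wpM2r// ler_nat size_cand.
apply: le_trans S1; rewrite big_seq; apply: (nusum) => // k; rewrite mem_cand => /eqP kq; apply: h => //.
by rewrite addnC -drop_drop cat_take_drop cat_take_drop.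
Qed.

End kernel_tools.

Section hamiltonian_kernels.
Variables (nonneg : bool) (d : nat).
Local Notation Z := (mode nonneg d).
Local Notation bar := (@ibar nonneg d).
Variables (A : comNzRingType) (io : A).
Implicit Types (a b : seq Z -> A).

(** The factors -i and i of the Hamiltonian vector field, with i an
    arbitrary element so that the same text serves for numbers and for
    polynomials in the step size. *)
Definition sg (k : Z) : A := if k.2 then - io else io.

Lemma sg_bar k : sg (bar k) = - sg k.
Proof. by rewrite /sg /=; case: k.2; rewrite ?opprK. Qed.

(** The Hamiltonian field of a cyclically invariant coefficient function:
    differentiating along a letter amounts to rotating that letter to the
    front and removing it. *)
Definition hf a : Z -> seq Z -> A := fun k y => sg k * a (bar k :: y).

(** The Poisson bracket on coefficient functions.  It is defined so that the
    bracket of Hamiltonian fields is visibly the field of the bracket; its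
    cyclic invariance is not visible and is proved in [cyc_brk]. *)
Definition brk a b : seq Z -> A := fun W =>
  if W is c :: v then
    L (hf a) (fun w => b (c :: w)) v - L (hf b) (fun w => a (c :: w)) v
  else 0.

Lemma hf_brk a b k y : hf (brk a b) k y = brkf (hf a) (hf b) k y.
Proof. by rewrite /brkf /hf /brk !LfZ mulrBr. Qed.

(** The derivations of Hamiltonian fields represent the Poisson bracket. *)
Lemma L_hf_comm a b f v :
  L (hf a) (L (hf b) f) v = L (hf b) (L (hf a) f) v + L (hf (brk a b)) f v.
Proof.
by rewrite (eq_LX _ _ (hf_brk a b)) -L_comm addrC subrK.
Qed.

Lemma hfD a b k y : hf (fun w => a w + b w) k y = hf a k y + hf b k y.
Proof. by rewrite /hf mulrDr. Qed.

Lemma hfZ x a k y : hf (fun w => x * a w) k y = x * hf a k y.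
Proof. by rewrite /hf mulrCA. Qed.

Lemma brkDl a1 a2 b w : brk (fun w => a1 w + a2 w) b w = brk a1 b w + brk a2 b w.
Proof.
case: w => [|c v] /=; first by rewrite addr0.
by rewrite (eq_LX _ _ (hfD a1 a2)) LXD LfD opprD addrACA.
Qed.

Lemma brkZl x a b w : brk (fun w => x * a w) b w = x * brk a b w.
Proof.
case: w => [|c v] /=; first by rewrite mulr0.
by rewrite (eq_LX _ _ (hfZ x a)) LXZ LfZ mulrBr.
Qed.

Lemma brkDr a b1 b2 w : brk a (fun w => b1 w + b2 w) w = brk a b1 w + brk a b2 w.
Proof.
case: w => [|c v] /=; first by rewrite addr0.
by rewrite (eq_LX _ _ (hfD b1 b2)) LXD LfD opprD addrACA.
Qed.

Lemma brkZr x a b w : brk a (fun w => x * b w) w = x * brk a b w.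
Proof.
case: w => [|c v] /=; first by rewrite mulr0.
by rewrite (eq_LX _ _ (hfZ x b)) LXZ LfZ mulrBr.
Qed.

Lemma brk_closed (P : A -> Prop) a b W :
  P 0 -> (forall x y, P x -> P y -> P (x + y)) -> (forall x y, P x -> P (x * y)) ->
  (forall x y z k, x ++ y ++ z = W -> mom1 k = momentum y -> x != [::] ->
    P (a (bar k :: y) * b (x ++ k :: z)) /\ P (b (bar k :: y) * a (x ++ k :: z))) ->
  P (brk a b W).
Proof.
move=> P0 PD PM; case: W => [|c v] h //=.
have PN x : P x -> P (- x) by move=> Px; rewrite -mulrN1; apply: (PM).
apply: (PD); last (apply: PN); apply: L_closed => // x y z k xyz kq.
all: have [] := h (c :: x) y z k => //=; rewrite ?xyz//.
all: by move=> h1 h2; rewrite /hf -mulrA mulrC; apply: (PM).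
Qed.

Definition cyc a := forall c v, a (rcons v c) = a (c :: v).

Lemma cyc_cat a x y : cyc a -> a (x ++ y) = a (y ++ x).
Proof.
move=> ca; elim: x y => [|c x IH] y /=; first by rewrite cats0.
by rewrite -ca -cats1 -catA IH cats1 cat_rcons.
Qed.

Definition msupp a := forall w, momentum w != 0 -> a w = 0.

Lemma msupp_brk a b : msupp a -> msupp b -> msupp (brk a b).
Proof.
move=> sa sb W nW; apply: (@brk_closed (fun x => x = 0)) => //.
- by move=> x y -> ->; rewrite addr0.
- by move=> x y ->; rewrite mul0r.
move=> x y z k xyz kq _.
have key : (momentum (bar k :: y) != 0) || (momentum (x ++ k :: z) != 0).
  rewrite -negb_and; apply: contra nW => /andP[_ /eqP h].
  by rewrite -xyz !mom_cat -h mom_cat mom_cons kq.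
by case/orP: key => h; rewrite ?(sa _ h) ?(sb _ h) ?mulr0 ?mul0r.
Qed.

Definition glue a b (y z : seq Z) : A :=
  \sum_(k <- cand nonneg (momentum y)) sg k * a (bar k :: y) * b (k :: z).

Lemma sum_triangle n (F : nat -> nat -> A) :
  \sum_(0 <= j < n) \sum_(0 <= p < n - j) F (j + p)%N p =
  \sum_(0 <= j < n) \sum_(0 <= p < j.+1) F j p.
Proof.
elim: n => [|n IH]; first by rewrite !big_nil.
rewrite [RHS]big_nat_recr//= -IH big_nat_recr//= subSnn big_nat1 addn0.
rewrite [X in _ = _ + X]big_nat_recl//= [X in _ = _ + X]addrC addrA; congr (_ + _).
have -> : \sum_(0 <= p < n) F n p.+1 = \sum_(0 <= j < n) F n (n - j)%N.
  rewrite [RHS]big_nat_rev /= big_nat [RHS]big_nat; apply: eq_bigr => p /andP[_ pn].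
  by congr F; lia.
rewrite -big_split /= big_nat [RHS]big_nat.
apply: eq_bigr => j /andP[_ jn].
have -> : (n.+1 - j = (n - j).+1)%N by lia.
rewrite big_nat_recr//=; congr (_ + F _ _); lia.
Qed.

(** A form of the bracket that is invariant under rotation: glue the two
    Hamiltonians along a letter, in all the ways that produce a rotation of
    the word. *)
Lemma brk_cycE a b W : cyc a -> cyc b -> momentum W = 0 ->
  brk a b W = \sum_(0 <= j < size W) \sum_(0 <= p < (size W).+1)
     glue a b (take p (rot j.+1 W)) (drop p (rot j.+1 W)).
Proof.
move=> ca cb; case: W => [|c v] W0; first by rewrite big_nil.
pose H j p := glue a b (take p (rot j.+1 (c :: v))) (drop p (rot j.+1 (c :: v))).
have rotE j : (j <= size v)%N -> rot j.+1 (c :: v) = drop j v ++ c :: take j v.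
  by move=> jv; rewrite /rot /=.
rewrite [brk _ _ _]/=.
have -> : L (hf a) (fun w => b (c :: w)) v =
   \sum_(0 <= j < (size v).+1) \sum_(0 <= p < (size v - j).+1) H j p.
  rewrite L_sumE big_nat [RHS]big_nat; apply: eq_bigr => j /andP[_ jv].
  rewrite big_nat [RHS]big_nat; apply: eq_bigr => p /andP[_ pv].
  rewrite /H rotE// take_cat drop_cat size_drop.
  have E : (if (p < size v - j)%N then take p (drop j v)
    else drop j v ++ take (p - (size v - j)) (c :: take j v)) = take p (drop j v).
    case: ifPn => //; rewrite -leqNgt => pj.
    have -> : p = (size v - j)%N by apply/eqP; rewrite eqn_leq pj -ltnS pv.
    by rewrite subnn take0 cats0 take_oversize// size_drop.
  have E2 : (if (p < size v - j)%N then drop p (drop j v) ++ c :: take j v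
    else drop (p - (size v - j)) (c :: take j v)) = drop p (drop j v) ++ c :: take j v.
    case: ifPn => //; rewrite -leqNgt => pj.
    have -> : p = (size v - j)%N by apply/eqP; rewrite eqn_leq pj -ltnS pv.
    by rewrite subnn drop0 (@drop_oversize _ _ (drop j v))// size_drop.
  rewrite E E2 /glue; apply: eq_bigr => k _; rewrite /hf; congr (_ * _).
  by rewrite -!cat_cons drop_drop (addnC p j) [LHS](cyc_cat _ _ cb).
have -> : L (hf b) (fun w => a (c :: w)) v =
   - \sum_(0 <= j < (size v).+1) \sum_(0 <= p < (size v - j).+1) H (j + p)%N ((size v).+1 - p)%N.
  rewrite L_sumE big_nat [in RHS]big_nat -sumrN; apply: eq_bigr => j /andP[_ jv].
  rewrite big_nat [in RHS]big_nat -sumrN; apply: eq_bigr => p /andP[_ pv].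
  rewrite /H rotE; last by lia.
  set y := take p (drop j v); set z := drop (j + p) v; set x := take j v.
  have -> : take (j + p) v = x ++ y by rewrite takeD.
  have sz : ((size v).+1 - p)%N = size (z ++ c :: x).
    rewrite size_cat size_drop /= size_take; case: ifP; lia.
  have -> : z ++ c :: x ++ y = (z ++ c :: x) ++ y by rewrite -catA.
  rewrite sz take_size_cat// drop_size_cat// /glue.
  have -> : momentum (z ++ c :: x) = - momentum y.
    have vE : v = x ++ y ++ z.
      by rewrite /x /y /z [in drop (j + p) v]addnC -drop_drop !cat_take_drop.
    apply/eqP; rewrite -addr_eq0; apply/eqP; rewrite -[RHS]W0 [in RHS]vE.
    by rewrite !(mom_cat, mom_cons) -addrA [LHS]addrC !addrA.
  rewrite sum_cand_bar -sumrN; apply: eq_bigr => k _.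
  rewrite /hf sg_bar ibarK !mulNr opprK mulrAC; congr (_ * _ * _).
  by rewrite -!cat_cons [LHS](cyc_cat _ _ ca).
rewrite opprK.
have -> : \sum_(0 <= j < (size v).+1) \sum_(0 <= p < (size v - j).+1) H (j + p)%N ((size v).+1 - p)%N =
   \sum_(0 <= j < (size v).+1) \sum_(0 <= p < j.+1) H j ((size v).+1 - p)%N.
  rewrite -(@sum_triangle _ (fun j p => H j ((size v).+1 - p)%N)).
  by rewrite big_nat [RHS]big_nat; apply: eq_bigr => j /andP[_ jv]; rewrite subSn.
rewrite -big_split /= big_nat [RHS]big_nat; apply: eq_bigr => j /andP[_ jv].
rewrite [RHS](@big_cat_nat _ _ _ (size v - j).+1)//=; last by lia.
congr (_ + _); rewrite -[X in _ = \sum_(X <= _ < _) _]add0n [RHS]big_addn.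
have -> : ((size v).+2 - (size v - j).+1 = j.+1)%N by lia.
rewrite [RHS]big_nat_rev big_nat [RHS]big_nat; apply: eq_bigr => p /andP[_ pj].
by congr (H _ _); lia.
Qed.

(** The sum in [brk_cycE] runs over all rotations of the word, so it only
    changes the order of its terms when the word is rotated. *)
Lemma cyc_brk a b : cyc a -> cyc b -> msupp a -> msupp b -> cyc (brk a b).
Proof.
move=> ca cb sa sb c v.
have [W0|W0] := eqVneq (momentum (c :: v)) 0; last first.
  by rewrite !(msupp_brk sa sb)// -cats1 mom_cat addrC -mom_cat.
rewrite !brk_cycE//; last by rewrite -cats1 mom_cat addrC -mom_cat.
rewrite size_rcons [size (c :: v)]/= [RHS]big_nat_recl// [LHS]big_nat_recr//= addrC; congr (_ + _).
  by have -> : rot (size v).+1 (rcons v c) = rot 1 (c :: v) by rewrite -(size_rcons v c) rot_size rot1_cons.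
rewrite big_nat [RHS]big_nat; apply: eq_bigr => j /andP[_ jv].
by rewrite -rot1_cons -rotD ?addn1.
Qed.

Definition real_for (phi : A -> A) a := forall w, a (map bar w) = phi (a w).

(** The sign of i changes under conjugation, and so does the sign of the
    Poisson structure under exchange of the modes with their conjugates. *)
Lemma real_brk (phi : A -> A) a b :
  phi 0 = 0 -> {morph phi : x y / x + y} -> {morph phi : x y / x * y} -> 
  {morph phi : x / - x} -> phi io = - io ->
  real_for phi a -> real_for phi b -> real_for phi (brk a b).
Proof.
move=> p0 pD pM pN pio ra rb [|c v] /=; first by rewrite p0.
have sgp k : phi (sg k) = sg (bar k) by rewrite /sg /=; case: k.2; rewrite ?pN pio ?opprK.
have hfp e k w : real_for phi e -> hf e (bar k) (map bar w) = phi (hf e k w).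
  by move=> re; rewrite /hf pM sgp -re /= ibarK.
rewrite pD pN !(@L_map _ _ A A phi)// !L_bar; congr (_ - _).
  rewrite (eq_LX _ _ (fun k w => hfp a k w ra)); apply: eq_L => w.
  by rewrite -rb.
rewrite (eq_LX _ _ (fun k w => hfp b k w rb)); apply: eq_L => w.
by rewrite -ra.
Qed.

(** The number of terms of the bracket on a word is at most quadratic in its
    length, whatever the size of the lattice; this is where momentum
    conservation matters. *)
Lemma brk_bound (R : numDomainType) (nu : A -> R) a b W (Ba Bb : R) :
  nu 0 = 0 -> (forall x y, nu (x + y) <= nu x + nu y) ->
  (forall x, nu (- x) = nu x) ->
  (forall x y, nu (x * y) <= nu x * nu y) -> nu io <= 1 -> 0 <= Ba -> 0 <= Bb ->
  (forall x, 0 <= nu x) ->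
  (forall w, nu (a w) <= Ba) -> (forall w, nu (b w) <= Bb) ->
  nu (brk a b W) <= (4 * (size W) ^ 2)%:R * (Ba * Bb).
Proof.
move=> n0 nD nN nM nio Ba0 Bb0 nge ha hb; case: W => [|c v] /=.
  by rewrite n0 mulr_ge0// mulr_ge0.
have nsg k : nu (sg k) <= 1 by rewrite /sg; case: k.2; rewrite ?nN.
have term e f Be Bf k y w : 0 <= Be -> 0 <= Bf ->
   (forall w, nu (e w) <= Be) -> (forall w, nu (f w) <= Bf) ->
   nu (hf e k y * f w) <= Be * Bf.
  move=> e0 f0 he hf'; rewrite (le_trans (nM _ _))// ler_pM//.
  by rewrite (le_trans (nM _ _))// -[leRHS]mul1r ler_pM.
rewrite (le_trans (nD _ _))// nN.
have -> : (4 * (size v).+1 ^ 2)%:R * (Ba * Bb) =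
  (2 * (size v).+1 ^ 2)%:R * (Ba * Bb) + (2 * (size v).+1 ^ 2)%:R * (Bb * Ba).
  by rewrite (_ : 4 = 2 + 2)%N// mulnDl natrD mulrDl (mulrC Ba).
apply: lerD; (apply: L_bound => //; do ?exact: mulr_ge0).
- by move=> x y z k _ _; exact: (term _ a (fun w => b (c :: w)) Ba Bb k y (x ++ k :: z)).
- by move=> x y z k _ _; exact: (term _ b (fun w => a (c :: w)) Bb Ba k y (x ++ k :: z)).
Qed.

End hamiltonian_kernels.

(** * The quadratic Hamiltonian and iterated derivations *)

Section linear_part.
Variables (nonneg : bool) (d : nat).
Local Notation Z := (mode nonneg d).
Local Notation bar := (@ibar nonneg d).
Variables (A : comNzRingType) (io : A) (lam : lattice nonneg d -> A).
Local Notation hf := (hf io).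
Local Notation brk := (brk io).
Implicit Types (a b f : seq Z -> A).

(** The coefficient function of the quadratic Hamiltonian A_0, in its
    cyclically invariant form. *)
Definition quad (w : seq Z) : A :=
  if w is [:: j; k] then if k == bar j then lam j.1 else 0 else 0.

Definition phase1 (k : Z) : A := if k.2 then lam k.1 else - lam k.1.

Definition Om (w : seq Z) : A := \sum_(k <- w) phase1 k.

Lemma Om_cons k w : Om (k :: w) = phase1 k + Om w.
Proof. by rewrite /Om big_cons. Qed.

Lemma hf_quad k y : hf quad k y = if y == [:: k] then - io * phase1 k else 0.
Proof.
rewrite /hf /quad; case: y => [|c [|c' y]] /=; rewrite ?mulr0//; last first.
  by rewrite eqseq_cons andbF.
rewrite eqseq_cons andbT ibarK; case: eqP => [_|]; last by rewrite mulr0.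
by rewrite /sg /phase1; case: ifP => _; ring.
Qed.

Lemma T_quad f c v : T (hf quad) f (c :: v) = - io * phase1 c * f (c :: v).
Proof.
rewrite T_sumE big_nat_recl// take0 drop0 big1 => [|k _]; last by rewrite hf_quad mul0r.
rewrite add0r big_nat_recl//= take0 drop0.
have -> : \sum_(k <- cand nonneg (momentum [:: c])) hf quad k [:: c] * f (k :: v) =
    - io * phase1 c * f (c :: v).
  rewrite (bigD1_seq c)/= ?uniq_cand//; last by rewrite mem_cand mom_cons mom_nil addr0.
  rewrite hf_quad eqxx big1 ?addr0// => k /negbTE kc.
  by rewrite hf_quad eqseq_cons andbT eq_sym kc mul0r.
rewrite big_nat big1 ?addr0// => p /andP[_ pv]; rewrite big1// => k _.
rewrite hf_quad eqseq_cons; case: (v) pv => [|c' v']; first by rewrite ltn0.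
by rewrite /= andbF mul0r.
Qed.

Lemma L_quad f v : L (hf quad) f v = - io * Om v * f v.
Proof.
elim: v f => [|c v IH] f; rewrite LE.
  rewrite T_sumE big_nat1 /= big1 => [|k _]; last by rewrite hf_quad mul0r.
  by rewrite /Om big_nil; ring.
by rewrite T_quad IH Om_cons; ring.
Qed.

(** The bracket with A_0 is diagonal in the words: this is why the
    homological equation can be solved coefficientwise. *)
Lemma brk_quad a c v : msupp a -> brk a quad (c :: v) = io * Om (c :: v) * a (c :: v).
Proof.
move=> sa; rewrite /= L_quad.
rewrite (@eq_L _ _ _ _ _ (fun w => lam c.1 * (w == [:: bar c])%:R)); last first.
  case=> [|k [|k' w]]; rewrite ?eqseq_cons ?andbF ?andbT ?mulr0//.
  by case: eqP => _; rewrite ?mulr1 ?mulr0.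
rewrite LfZ L_letter mom1_bar /hf ibarK.
have -> : (if momentum v == - mom1 c then sg io (bar c) * a (c :: v) else 0) =
  sg io (bar c) * a (c :: v).
  case: ifPn => // nv; rewrite sa ?mulr0// mom_cons addrC.
  by apply: contra nv; rewrite addr_eq0.
by rewrite Om_cons sg_bar /sg /phase1; case: c.2; ring.
Qed.

End linear_part.

Section generating_operator.
Variables (nonneg : bool) (d : nat).
Local Notation Z := (mode nonneg d).
Variables (A : comNzRingType) (io : A).
Local Notation hf := (hf io).
Local Notation brk := (brk io).
Local Notation LH a := (L (hf a)).
Implicit Types (a b f : seq Z -> A).

Definition iterL (K : seq Z -> A) (m : nat) f : seq Z -> A := iter m (LH K) f.

(** The iterated brackets with K of a Hamiltonian Q. *)
Fixpoint adK (K Q : seq Z -> A) (p : nat) : seq Z -> A :=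
  if p is p'.+1 then brk (adK K Q p') K else Q.

Lemma adKS K Q p : adK K (brk Q K) p = adK K Q p.+1.
Proof. by elim: p => [|p IH] //=; rewrite IH. Qed.

(** Moving a derivation across the m-th power of another one produces
    iterated commutators with binomial coefficients. *)
Lemma LH_iterL K Q m f v :
  LH Q (iterL K m f) v =
  \sum_(0 <= p < m.+1) 'C(m, p)%:R * iterL K (m - p) (LH (adK K Q p) f) v.
Proof.
elim: m Q v => [|m IH] Q v.
  by rewrite big_nat1 bin0 mul1r.
rewrite [iterL K m.+1 f]/= L_hf_comm.
rewrite (@eq_L _ _ _ _ _ _ _ (IH Q)) Lf_sum IH.
rewrite [RHS]big_nat_recl// bin0 mul1r subn0.
under [in RHS]eq_bigr do rewrite binS natrD mulrDl subSS.
rewrite big_split /= addrA; congr (_ + _); last by apply: eq_bigr => p _; rewrite adKS.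
rewrite big_nat_recl// LfZ bin0 mul1r subn0; congr (_ + _).
rewrite [RHS]big_nat_recr//= bin_small// mul0r addr0.
rewrite big_nat [RHS]big_nat; apply: eq_bigr => p /andP[_ pm].
by rewrite LfZ -(subnSK pm).
Qed.

(** The derivative of the m-th power of L_K with respect to a parameter,
    with all the factors L_K collected on the left.  After division by m!
    and summation over m it is the formula for the derivative of an
    exponential. *)
Lemma deriv_iterL (dl : A -> A) K m f v :
  dl 0 = 0 -> (forall x y, dl (x + y) = dl x + dl y) ->
  (forall x y, dl (x * y) = dl x * y + x * dl y) -> dl io = 0 -> dl (- io) = 0 ->
  (forall w, dl (f w) = 0) ->
  dl (iterL K m f v) =
  \sum_(0 <= p < m) 'C(m, p.+1)%:R *
     iterL K (m - p.+1) (LH (adK K (fun w => dl (K w)) p) f) v.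
Proof.
move=> d0 dD dM dio dNio df; elim: m v => [|m IH] v; first by rewrite big_nil /= df.
rewrite [iterL K m.+1 f]/= (L_deriv _ _ _ d0 dD dM).
rewrite (@eq_LX _ _ _ _ (hf (fun w => dl (K w)))); last first.
  by move=> k w; rewrite /hf dM /sg; case: k.2; rewrite ?dio ?dNio mul0r add0r.
rewrite LH_iterL (@eq_L _ _ _ _ _ _ _ IH) Lf_sum.
under [RHS]eq_bigr do rewrite binS natrD mulrDl subSS.
rewrite big_split /= addrC; congr (_ + _).
rewrite [RHS]big_nat_recr//= bin_small// mul0r addr0.
rewrite big_nat [RHS]big_nat; apply: eq_bigr => p /andP[_ pm].
by rewrite LfZ -(subnSK pm).
Qed.

End generating_operator.

(** * Series over the natural numbers and the function phi1 *)

Section nat_series.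
Variable R : realType.
Local Notation C := R[i].
Local Notation nc := (@Normc.normc R).

Lemma esum_nat_le (a : nat -> R) (B : R) : (forall n, 0 <= a n) ->
  (forall n, \sum_(0 <= i < n) a i <= B) ->
  (\esum_(i in [set: nat]) (a i)%:E <= B%:E)%E.
Proof.
move=> a0 aB; rewrite -nneseries_esumT; last by move=> n; rewrite lee_fin.
apply: lime_le; first by apply: is_cvg_nneseries => n _ _; rewrite lee_fin.
by near=> n; rewrite sumEFin lee_fin.
Unshelve. all: by end_near.
Qed.

Lemma cvg_esum_nat (a : nat -> R) : (forall n, 0 <= a n) ->
  (\esum_(i in [set: nat]) (a i)%:E < +oo)%E ->
  series a @ \oo --> fine (\esum_(i in [set: nat]) (a i)%:E).
Proof.
move=> a0 sa; have fa : (\esum_(i in [set: nat]) (a i)%:E)%E \is a fin_num.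
  by rewrite ge0_fin_numE// esum_ge0// => x _; rewrite lee_fin.
have h : (fun n => \sum_(0 <= i < n) (a i)%:E)%E @ \oo -->
    (\esum_(i in [set: nat]) (a i)%:E)%E.
  rewrite -nneseries_esumT; last by move=> k; rewrite lee_fin.
  by apply: is_cvg_nneseries => n _ _; rewrite lee_fin.
rewrite -(fineK fa) in h; apply: cvg_trans (fine_cvg h).
by apply: near_eq_cvg; near=> n; rewrite /= sumEFin.
Unshelve. all: by end_near.
Qed.

(** For absolutely convergent series the unordered sum is the usual one,
    which gives access to the series of sine and cosine. *)
Lemma rsum_nat (f : nat -> R) l : (rnsum f < +oo)%E -> series f @ \oo --> l ->
  rsum [set: nat] f = l.
Proof.
move=> sf hl; have [p n ->] := rsum_posneg sf.
have h := cvgB (cvg_esum_nat (fun k => rpos_ge0 (f k)) p)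
               (cvg_esum_nat (fun k => rneg_ge0 (f k)) n).
have E : series f = series (fun k => rpos (f k)) - series (fun k => rneg (f k)).
  apply/funext => k; rewrite /series /= fctE -sumrB.
  by apply: eq_bigr => i _; rewrite -rposB.
by rewrite -(cvg_lim _ (h _))// -(cvg_lim _ hl)// E.
Qed.

Lemma esum_exp (c : R) : 0 <= c ->
  (\esum_(p in [set: nat]) (c ^+ p / p`!%:R)%:E <= (expR c)%:E)%E.
Proof.
move=> c0; have e0 n : 0 <= c ^+ n / n`!%:R by rewrite divr_ge0// exprn_ge0.
apply: esum_nat_le => // n.
apply: (@nondecreasing_cvgn_le _ (series (exp_coeff c))); last exact: is_cvg_series_exp_coeff.
by apply: nondecreasing_series => k _ _; exact: e0.
Qed.

Lemma exp_summable (f : nat -> C) (B c : R) : 0 <= c ->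
  (forall p, nc (f p) <= B * (c ^+ p / p`!%:R)) -> (nsum f < +oo)%E.
Proof.
move=> c0 h.
have B0 : 0 <= B by have := le_trans (nc_ge0 _) (h 0%N); rewrite expr0 fact0 divr1 mulr1.
apply: (@le_lt_trans _ _ (\esum_(p in [set: nat]) (B * (c ^+ p / p`!%:R))%:E)%E).
  by apply: le_esum => p _; rewrite lee_fin.
rewrite esumZ//; last by move=> p; rewrite divr_ge0// exprn_ge0.
by rewrite lte_mul_pinfty//; apply: (le_lt_trans (esum_exp c0)); rewrite ltry.
Qed.

Lemma nc_nat n : nc (n%:R : C) = n%:R.
Proof. by rewrite -[X in nc X](rmorph_nat (real_complex R)) ncR. Qed.

Lemma nc_exp (x : C) n : nc (x ^+ n) = nc x ^+ n.
Proof. by elim: n => [|n IH]; rewrite ?expr0 ?Normc.normc1// !exprS Normc.normcM IH. Qed.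

Lemma nc_div (x : C) n : nc (x / n%:R) = nc x / n%:R.
Proof. by rewrite Normc.normcM Normc.normcV nc_nat. Qed.

Lemma nc_ii : nc 'i%C = 1.
Proof. by rewrite /= expr0n expr1n add0r sqrtr1. Qed.

Definition ith (t : R) : C := 'i%C * (t%:C)%C.

Lemma nc_ith t : nc (ith t) = `|t|.
Proof. by rewrite /ith Normc.normcM nc_ii mul1r ncZ. Qed.

Definition expi (t : R) : C := (cos t +i* sin t)%C.

Lemma expi_term (t : R) n : (ith t) ^+ n / n`!%:R = (cos_coeff t n +i* sin_coeff t n)%C.
Proof.
have i2 : 'i%C ^+ 2 = -1 :> C by rewrite sqr_i.
have E k : 'i%C ^+ k.*2 = ((-1) ^+ k)%:C%C :> C.
  by rewrite -mul2n exprM i2 rmorphXn /= rmorphN1.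
have nE (x : R) : (x / n`!%:R)%:C%C = (x%:C)%C / n`!%:R :> C.
  by rewrite rmorphM fmorphV rmorph_nat.
rewrite /ith exprMn -mulrA -rmorphXn -nE /cos_coeff /sin_coeff /=.
rewrite -[n in 'i%C ^+ n]odd_double_half exprD E.
case: (boolP (odd n)) => on; rewrite !(mul0r, mul1r, expr0, expr1).
  have -> : n.-1./2 = n./2.
    by rewrite -[in LHS](odd_double_half n) on /= add0n doubleK.
  by apply/eqP; rewrite eq_complex /=; apply/andP; split; apply/eqP; rewrite -?exprnP; ring.
by apply/eqP; rewrite eq_complex /=; apply/andP; split; apply/eqP; rewrite -?exprnP; ring.
Qed.

Lemma isum_expi (t : R) : isum (fun n => (ith t) ^+ n / n`!%:R) (expi t).
Proof.
have s : (nsum (fun n => (ith t) ^+ n / n`!%:R)%R < +oo)%E.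
  apply: (@exp_summable _ 1 `|t|) => // p.
  by rewrite nc_div nc_exp nc_ith mul1r.
split => //; rewrite /csum /expi; congr (_ +i* _)%C; apply: rsum_nat.
- exact: rnsum_Re.
- rewrite (_ : (fun n => _) = cos_coeff t); last by apply/funext => n; rewrite expi_term.
  by have := @is_cvg_series_cos_coeff R t; rewrite (_ : cos t = limn (series (cos_coeff t)))//; rewrite cos.unlock.
- exact: rnsum_Im.
- rewrite (_ : (fun n => _) = sin_coeff t); last by apply/funext => n; rewrite expi_term.
  by have := @is_cvg_series_sin_coeff R t; rewrite (_ : sin t = limn (series (sin_coeff t)))//; rewrite sin.unlock.
Qed.

(** The function (exp(x) - 1)/x at x = i t, defined by its power series. *)
Definition phi1 (t : R) : C := csum [set: nat] (fun p => (ith t) ^+ p / p.+1`!%:R).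

Lemma isum_phi1 (t : R) : isum (fun p => (ith t) ^+ p / p.+1`!%:R) (phi1 t).
Proof.
apply: isum_csum; apply: (@exp_summable _ 1 `|t|) => // p.
rewrite nc_div nc_exp nc_ith mul1r ler_wpM2l ?exprn_ge0//.
by rewrite lef_pV2 ?posrE ?ltr0n ?fact_gt0// ler_nat factS leq_pmull.
Qed.

Lemma isum_shift (f : nat -> C) c : isum (fun n => f n.+1) c -> isum f (f 0%N + c).
Proof.
move=> h; have h0 := isum_pt 0%N (f 0%N).
have h1 : isum (fun n => if n is n'.+1 then f n else 0) c.
  apply/(@isum_reindex _ _ _ S) => //; first exact: succn_inj.
  by case=> // n /(_ n).
by apply: isum_eq (isumD h0 h1) _ => -[|n] /=; rewrite ?addr0 ?add0r.
Qed.

(** The defining identity, obtained by shifting the exponential series. *)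
Lemma phi1E (t : R) : ith t * phi1 t = expi t - 1.
Proof.
have h := isumZ (ith t) (isum_phi1 t).
have h2 : isum (fun n => (ith t) ^+ n / n`!%:R) (1 + ith t * phi1 t).
  have := @isum_shift (fun n => (ith t) ^+ n / n`!%:R) (ith t * phi1 t).
  rewrite expr0 fact0 divr1; apply; apply: isum_eq h _ => n.
  by rewrite exprS mulrA.
by rewrite (isum_uniq (isum_expi t) h2) addrAC subrr add0r.
Qed.

(** Near zero the first term of the series dominates. *)
Lemma phi1_small (t : R) : `|t| <= 1/2 -> 1/2 <= nc (phi1 t).
Proof.
move=> ht.
pose g (p : nat) := (ith t) ^+ p.+1 / p.+2`!%:R : C.
have sg : isum g (csum [set: nat] g).
  apply: isum_csum; apply: (@exp_summable _ 1 `|t|) => // p.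
  rewrite nc_div nc_exp nc_ith mul1r.
  apply: ler_pM; rewrite ?exprn_ge0 ?invr_ge0 ?ler0n//.
    by rewrite exprS ler_piMl ?exprn_ge0//; lra.
  by rewrite lef_pV2 ?posrE ?ltr0n ?fact_gt0// ler_nat !factS mulnA leq_pmull.
have E : phi1 t = 1 + csum [set: nat] g.
  have := @isum_shift (fun p => (ith t) ^+ p / p.+1`!%:R) _ sg.
  by rewrite expr0 divr1 => /(isum_uniq (isum_phi1 t)).
have b : nc (csum [set: nat] g) <= 1/2.
  apply: (isum_ler sg); apply: esum_nat_le => [n|n]; first exact: nc_ge0.
  have gb p : nc (g p) <= geometric (1/4) (1/2) p :> R.
    rewrite /g nc_div nc_exp nc_ith /geometric /=.
    have -> : 1 / 4 * (1 / 2) ^+ p = (1/2 : R) ^+ p.+1 * (1/2) by rewrite exprS; field.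
    apply: ler_pM; rewrite ?exprn_ge0 ?invr_ge0 ?ler0n//.
      by apply: lerXn2r; rewrite ?nnegrE//; lra.
    rewrite div1r lef_pV2 ?posrE ?ltr0n ?fact_gt0// ler_nat !factS.
    by rewrite mulnA (@leq_trans (p.+2 * p.+1))// ?leq_pmulr ?fact_gt0//; nia.
  apply: (@le_trans _ _ (series (geometric (1/4) (1/2)) n)).
    by rewrite /series /=; apply: ler_sum => p _; exact: gb.
  have gl : series (geometric (1/4) (1/2)) n <= 1/4 * (1 - 1/2)^-1 :> R.
    by apply: geometric_le_lim; rewrite ?ger0_norm; lra.
  by apply: le_trans gl _; rewrite (_ : 1 - 1/2 = 1/2)//; [rewrite (_ : (1/2)^-1 = 2)//; [lra|field]|field].
rewrite E; have := ncD (1 + csum [set: nat] g) (- csum [set: nat] g).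
rewrite addrK ncN Normc.normc1; lra.
Qed.

Lemma nc_expi (t : R) : nc (expi t) = 1.
Proof. by rewrite /= cos2Dsin2 sqrtr1. Qed.

(** Away from zero the modulus is |exp(i t) - 1| / |t|, and exp(i t) is
    equal to 1 only at the multiples of 2 pi; near zero [phi1_small]
    applies. *)
Lemma phi1_lower (t0 : R) : t0 < 2 * pi -> exists2 k : R, 0 < k &
  forall t, `|t| <= t0 -> k <= nc (phi1 t).
Proof.
move=> t0pi.
pose th := Num.max (1/2 : R) t0.
pose e := Num.min (1/2 : R) (2 * pi - t0).
have pi2 : 2 <= pi :> R := pi_ge2 R.
have e0 : 0 < e by rewrite /e lt_min; apply/andP; split; lra.
have ele : e <= 1/2 by rewrite /e ge_min lexx.
have ele2 : e <= 2 * pi - t0 by rewrite /e ge_min lexx orbT.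
have th0 : 0 < th by rewrite /th lt_max; apply/orP; left; lra.
have ce : cos e < 1.
  rewrite -[X in _ < X](@cos0 R) ltr_cos ?in_itv /=; [lra|apply/andP; split; lra|apply/andP; split; lra].
pose k := Num.min (1/2 : R) ((1 - cos e) / th).
exists k; first by rewrite /k lt_min; apply/andP; split; [lra|rewrite divr_gt0 ?subr_gt0].
move=> t tt0.
have [small|big] := leP `|t| (1/2).
  by apply: le_trans (phi1_small small); rewrite /k ge_min lexx.
apply: (@le_trans _ _ ((1 - cos e) / th)); first by rewrite /k ge_min lexx orbT.
have tth : `|t| <= th by rewrite /th le_max tt0 orbT.
have ct : cos t <= cos e.
  rewrite -(cos_norm t); have [tp|tp] := leP `|t| pi.
    rewrite le_eqVlt ltr_cos ?in_itv /=; try (apply/andP; split; lra).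
    by apply/orP; right; lra.
  have -> : cos `|t| = cos (2 * pi - `|t|).
    by rewrite -(cosN `|t|) mulr_natl addrC cosD2pi.
  have [->//|ne] := eqVneq (2 * pi - `|t|) e.
  apply: ltW; rewrite ltr_cos ?in_itv /=; try (apply/andP; split; lra).
  by rewrite lt_neqAle eq_sym ne /=; lra.
have h : 1 - cos e <= nc (expi t - 1).
  apply: le_trans (Re_nc _); rewrite /expi /= distrC ger0_norm; lra.
rewrite ler_pdivrMr//; apply: le_trans h _.
rewrite -phi1E Normc.normcM nc_ith mulrC.
by rewrite ler_wpM2l ?nc_ge0.
Qed.

Lemma cjM (x y : C) : conjc (x * y) = conjc x * conjc y.
Proof. exact: (rmorphM (@conjc R)). Qed.

Lemma cjD (x y : C) : conjc (x + y) = conjc x + conjc y.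
Proof. exact: (rmorphD (@conjc R)). Qed.

Lemma cjN (x : C) : conjc (- x) = - conjc x.
Proof. exact: (rmorphN (@conjc R)). Qed.

Lemma cjz : conjc (0 : C) = 0.
Proof. exact: (rmorph0 (@conjc R)). Qed.

Lemma cjV (x : C) : conjc (x^-1) = (conjc x)^-1.
Proof. exact: conjc_inv. Qed.

Lemma cjX (x : C) n : conjc (x ^+ n) = (conjc x) ^+ n.
Proof. exact: (rmorphXn (@conjc R)). Qed.

Lemma cj_nat n : conjc (n%:R : C) = n%:R.
Proof. exact: conjc_nat. Qed.

Lemma phi1_conj t : phi1 (- t) = conjc (phi1 t).
Proof.
have h := isum_conj (isum_phi1 t); apply: isum_uniq (isum_phi1 (- t)) _.
apply: isum_eq h _ => p; rewrite cjM cjX cjV cj_nat.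
congr (_ ^+ _ / _); rewrite /ith cjM conjc_real.
by apply/eqP; rewrite eq_complex /=; apply/andP; split; apply/eqP; ring.
Qed.

End nat_series.

(** * Admissible words and graded Hamiltonians *)

Section admissible_words.
Variables (nonneg : bool) (d : nat) (sp : bool).
Local Notation Z := (mode nonneg d).
Local Notation bar := (@ibar nonneg d).

Definition balanced (w : seq Z) : bool :=
  count (fun j : Z => j.2) w == count (fun j : Z => ~~ j.2) w.

(** The words that may occur: zero momentum, and in the gauge-invariant case
    as many letters of each sign. *)
Definition adm (w : seq Z) : bool := (momentum w == 0) && (sp ==> balanced w).

Lemma admE w : adm w = (momentum w == 0) && (sp ==> balanced w). Proof. by []. Qed.

(** Contracting a factor to a letter keeps both constraints, which makes
    them stable under the bracket. *)
Lemma adm_glue x y z (k : Z) : adm (bar k :: y) -> adm (x ++ k :: z) -> adm (x ++ y ++ z).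
Proof.
move=> /andP[/eqP m1 b1] /andP[/eqP m2 b2]; apply/andP; split.
  rewrite !(mom_cons, mom_cat, mom1_bar) in m1 m2 *.
  have -> : momentum y = mom1 k by apply/eqP; rewrite -subr_eq0 addrC m1.
  by rewrite m2.
case: (sp) b1 b2 => //=; rewrite /balanced !count_cat /=.
by case: (k.2) => /=; lia.
Qed.

Lemma adm_rcons v (c : Z) : adm (rcons v c) = adm (c :: v).
Proof.
rewrite /adm /balanced -cats1 !count_cat /= !addn0 ![(_ + count _ v)%N]addnC.
by rewrite mom_cat !mom_cons mom_nil addr0 addrC.
Qed.

Lemma adm_bar (w : seq Z) : adm (map bar w) = adm w.
Proof.
rewrite /adm mom_bar oppr_eq0 /balanced !count_map; congr (_ && (_ ==> _)).
rewrite eq_sym; congr (_ == _); apply: eq_count => k //=.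
by rewrite negbK.
Qed.

End admissible_words.

Section formal.
Variables (R : realType) (nonneg : bool) (d : nat) (sp : bool).
Local Notation Z := (mode nonneg d).
Local Notation bar := (@ibar nonneg d).
Local Notation C := R[i].
Local Notation nc := (@Normc.normc R).
Local Notation A := {poly C}.
Local Notation io := (('i%C : C)%:P : A).
Variables (lam : lattice nonneg d -> R) (rho r n : nat).
Local Notation adm := (@adm nonneg d sp).
Implicit Types (a b K : seq Z -> A) (w : seq Z).

Definition lamA (x : lattice nonneg d) : A := ((lam x)%:C)%C%:P.
Local Notation q0 := (quad lamA).

(** The phase picked up by a monomial along the flow of A_0. *)
Definition theta w : R := \sum_(k <- w) (if k.2 then lam k.1 else - lam k.1).

Lemma Om_theta w : Om lamA w = ((theta w)%:C)%C%:P.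
Proof.
elim: w => [|k w IH]; first by rewrite /Om /theta !big_nil.
rewrite Om_cons IH /theta big_cons rmorphD polyCD; congr (_ + _).
by rewrite /phase1 /lamA; case: k.2; rewrite ?rmorphN ?polyCN.
Qed.

Lemma theta_rcons v c : theta (rcons v c) = theta (c :: v).
Proof. by rewrite /theta -cats1 big_cat big_seq1 big_cons addrC. Qed.

Lemma theta_bar w : theta (map bar w) = - theta w.
Proof.
rewrite /theta big_map -sumrN; apply: eq_bigr => k _ /=.
by case: k.2; rewrite ?opprK.
Qed.

Definition cj (x : A) : A := map_poly (@conjc R) x.

Lemma cj0 : cj 0 = 0. Proof. exact: rmorph0. Qed.
Lemma cjpD : {morph cj : x y / x + y}. Proof. exact: rmorphD. Qed.
Lemma cjpM : {morph cj : x y / x * y}. Proof. exact: rmorphM. Qed.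
Lemma cjpN : {morph cj : x / - x}. Proof. exact: rmorphN. Qed.
Lemma cj_io : cj io = - io.
Proof.
rewrite /cj map_polyC -polyCN; congr polyC.
by apply/eqP; rewrite eq_complex /= oppr0 !eqxx.
Qed.
Lemma coef_cj x k : (cj x)`_k = conjc x`_k.
Proof. exact: coef_map. Qed.

(** The support condition for the term of order k: a Hamiltonian of order k
    + e in the step size has degree at most (k + e) rho + 2. *)
Definition cond e w k := [&& adm w, (2 <= size w)%N & (size w <= (k + e) * rho + 2)%N].

Lemma condE e w k : cond e w k = [&& adm w, (2 <= size w)%N & (size w <= (k + e) * rho + 2)%N]. Proof. by []. Qed.

Definition graded e a := forall w k, ~~ cond e w k -> (a w)`_k = 0.

Lemma cond_le e w i k : (i <= k)%N -> cond e w i -> cond e w k.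
Proof.
move=> ik /and3P[h1 h2 h3]; apply/and3P; split=> //.
by rewrite (leq_trans h3)// leq_add2r leq_mul2r leq_add2r ik orbT.
Qed.

Lemma graded_msupp e a : graded e a -> msupp a.
Proof.
move=> ga w mw; apply/polyP => k; rewrite coef0 ga// /cond admE.
by rewrite (negbTE mw).
Qed.

Lemma graded_small e a w : graded e a -> (size w < 2)%N -> a w = 0.
Proof.
move=> ga sw; apply/polyP => k; rewrite coef0 ga//; apply/negP => /and3P[_ h _].
by rewrite leqNgt sw in h.
Qed.

(** Degrees minus two add up under the bracket. *)
Lemma graded_brk e1 e2 a b : graded e1 a -> graded e2 b -> graded (e1 + e2) (brk io a b).
Proof.
move=> ga gb w k; apply: contraNeq => nz.
pose P (x : A) := forall k, ~~ cond (e1 + e2) w k -> x`_k = 0.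
have : P (brk io a b w).
  apply: (@brk_closed _ _ _ _ P).
  - by move=> i _; rewrite coef0.
  - by move=> x y Px Py i ci; rewrite coefD Px// Py// addr0.
  - move=> x y Px i ci; rewrite coefM big1// => j _; rewrite Px ?mul0r//.
    by apply: contra ci; apply: cond_le; rewrite -ltnS ltn_ord.
  move=> x y z c xyz cy xn.
  have key e f i j : cond e (bar c :: y) i -> cond f (x ++ c :: z) j ->
     cond (e + f) w (i + j).
    move=> /and3P[a1 s1 t1] /and3P[a2 s2 t2]; apply/and3P; rewrite -xyz.
    split; first exact: adm_glue a1 a2.
      by move: s1; rewrite /= !size_cat; case: (x) xn => [|? ?] //= _; lia.
    move: t1 t2; rewrite /= !size_cat /=; nia.
  split=> i ci; rewrite coefM big1// => j _.
  - have [h1|h1] := boolP (cond e1 (bar c :: y) j); last by rewrite ga ?mul0r.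
    rewrite gb ?mulr0//; apply: contra ci => h2.
    by have := key _ _ _ _ h1 h2; rewrite subnKC// -ltnS ltn_ord.
  - have [h1|h1] := boolP (cond e2 (bar c :: y) j); last by rewrite gb ?mul0r.
    rewrite ga ?mulr0//; apply: contra ci => h2.
    by have := key _ _ _ _ h1 h2; rewrite subnKC 1?addnC// -ltnS ltn_ord.
by move=> /(_ k) h; apply: contra_neqT nz => /h.
Qed.

Lemma graded_deriv e a : graded e a -> graded e.+1 (fun w => (a w)^`()).
Proof.
move=> ga w k ck; rewrite coef_deriv ga ?mul0rn//.
by rewrite /cond addSnnS.
Qed.

(** The l^1 norm of the first N coefficients, which is submultiplicative. *)
Definition nu (N : nat) (x : A) : R := \sum_(0 <= k < N) nc x`_k.

Lemma nuE N (x : A) : nu N x = \sum_(0 <= k < N) nc x`_k. Proof. by []. Qed.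

Lemma nu_ge0 N x : 0 <= nu N x.
Proof. by apply: sumr_ge0 => k _; exact: nc_ge0. Qed.

Lemma nu0 N : nu N 0 = 0.
Proof. by rewrite /nu big1// => k _; rewrite coef0 Normc.normc0. Qed.

Lemma nuD N x y : nu N (x + y) <= nu N x + nu N y.
Proof. by rewrite /nu -big_split /=; apply: ler_sum => k _; rewrite coefD ncD. Qed.

Lemma nuN N x : nu N (- x) = nu N x.
Proof. by apply: eq_bigr => k _; rewrite coefN ncN. Qed.

Lemma nc_sum (I : Type) (s : seq I) (P : pred I) (F : I -> C) :
  nc (\sum_(i <- s | P i) F i) <= \sum_(i <- s | P i) nc (F i).
Proof.
elim: s => [|i s IH]; first by rewrite !big_nil Normc.normc0.
rewrite !big_cons; case: ifP => // _.
by rewrite (le_trans (ncD _ _))// lerD2l.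
Qed.

Lemma nuM N x y : nu N (x * y) <= nu N x * nu N y.
Proof.
pose u i := nc x`_i; pose v i := nc y`_i.
have u0 i : 0 <= u i by exact: nc_ge0.
have v0 i : 0 <= v i by exact: nc_ge0.
have -> : nu N x * nu N y = \sum_(0 <= i < N) \sum_(0 <= j < N) u i * v j.
  by rewrite /nu big_distrl /=; apply: eq_bigr => i _; rewrite big_distrr.
apply: (@le_trans _ _ (\sum_(0 <= k < N) \sum_(0 <= i < k.+1) u i * v (k - i)%N)).
  apply: ler_sum => k _; rewrite coefM big_mkord (le_trans (nc_sum _ _ _))//.
  by apply: ler_sum => i _; rewrite Normc.normcM.
have -> : \sum_(0 <= k < N) \sum_(0 <= i < k.+1) u i * v (k - i)%N =
   \sum_(0 <= i < N) \sum_(0 <= j < N - i) u i * v j.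
  elim: N => [|m IH]; first by rewrite !big_nil.
  rewrite big_nat_recr//= IH [RHS]big_nat_recr//= subSnn big_nat1.
  rewrite big_nat_recr//= subnn addrA; congr (_ + _).
  rewrite -big_split /= big_nat [RHS]big_nat; apply: eq_bigr => i /andP[_ im].
  have -> : (m.+1 - i = (m - i).+1)%N by lia.
  by rewrite big_nat_recr.
rewrite big_nat [leRHS]big_nat; apply: ler_sum => i /andP[_ iN].
rewrite [leRHS](@big_cat_nat _ _ _ (N - i)%N)//= ?leq_subr// lerDl.
by apply: sumr_ge0 => j _; rewrite mulr_ge0.
Qed.

Lemma nu_io N : nu N io <= 1.
Proof.
rewrite /nu; case: N => [|N]; first by rewrite big_nil ler01.
rewrite big_nat_recl// coefC eqxx nc_ii big1 ?addr0// => k _.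
by rewrite coefC; exact: Normc.normc0.
Qed.

Lemma nc_nu N (x : A) k : (k < N)%N -> nc x`_k <= nu N x.
Proof.
move=> kN; rewrite /nu (bigD1_seq k)/= ?mem_index_iota ?iota_uniq// lerDl.
by apply: sumr_ge0 => j _; exact: nc_ge0.
Qed.

Lemma nu_le N (x : A) B : (forall k, nc x`_k <= B) -> nu N x <= N%:R * B.
Proof.
move=> h; rewrite /nu (le_trans (ler_sum _ (fun k _ => h k)))//.
by rewrite big_const_nat subn0 iter_addr_0 mulr_natl.
Qed.

Lemma nu_big N e a w : graded e a -> ((N.-1 + e) * rho + 2 <= r)%N -> ~~ (size w <= r)%N ->
  nu N (a w) = 0.
Proof.
move=> ga hN sw; rewrite /nu big_nat big1// => k /andP[_ kN].
rewrite ga ?Normc.normc0//; apply: contra sw => /and3P[_ _ h].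
apply: leq_trans h _; apply: leq_trans hN; rewrite leq_add2r leq_mul2r leq_add2r.
by apply/orP; right; lia.
Qed.

(** The grading limits the length of words to r, so that the quadratic
    factor of [brk_bound] is a constant. *)
Lemma brk_nu_bound N e1 e2 a b Ba Bb w :
  graded e1 a -> graded e2 b -> ((N.-1 + (e1 + e2)) * rho + 2 <= r)%N ->
  0 <= Ba -> 0 <= Bb ->
  (forall w, nu N (a w) <= Ba) -> (forall w, nu N (b w) <= Bb) ->
  nu N (brk io a b w) <= (4 * r ^ 2)%:R * (Ba * Bb).
Proof.
move=> ga gb hN Ba0 Bb0 ha hb.
have [sw|sw] := boolP (size w <= r)%N; last first.
  by rewrite (nu_big (graded_brk ga gb) hN sw) mulr_ge0// mulr_ge0.
have := @brk_bound _ _ _ io _ (nu N) a b w Ba Bb (nu0 N) (@nuD N) (@nuN N) (@nuM N)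
  (nu_io N) Ba0 Bb0 (nu_ge0 N) ha hb.
move=> /le_trans; apply; rewrite ler_wpM2r ?mulr_ge0// ler_nat leq_mul2l /=.
by rewrite leq_exp2r.
Qed.

End formal.

(** * Solving for the modified Hamiltonian order by order *)

Section solving.
Variables (R : realType) (nonneg : bool) (d : nat) (sp : bool).
Local Notation Z := (mode nonneg d).
Local Notation bar := (@ibar nonneg d).
Local Notation C := R[i].
Local Notation nc := (@Normc.normc R).
Local Notation A := {poly C}.
Local Notation io := (('i%C : C)%:P : A).
Variables (lam : lattice nonneg d -> R) (rho r : nat).
Local Notation adm := (@adm nonneg d sp).
Local Notation graded := (@graded R nonneg d sp rho).
Local Notation cond := (@cond nonneg d sp rho).
Local Notation nu := (@nu R).
Local Notation q0 := (quad (lamA lam)).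
Local Notation th := (theta lam).
Implicit Types (a b K Q : seq Z -> A) (w : seq Z).

Definition dK K : seq Z -> A := fun w => (K w)^`().

Lemma adK_graded K Q p : graded 0 K -> graded 1 Q -> graded 1 (adK io K Q p).
Proof. by move=> gK gQ; elim: p => [|p IH] //=; have := graded_brk IH gK. Qed.

Lemma adK_nu N K Q (BK BQ : R) p w : graded 0 K -> graded 1 Q ->
  ((N.-1 + 1) * rho + 2 <= r)%N -> 0 <= BK -> 0 <= BQ ->
  (forall w, nu N (K w) <= BK) -> (forall w, nu N (Q w) <= BQ) ->
  nu N (adK io K Q p w) <= BQ * ((4 * r ^ 2)%:R * BK) ^+ p.
Proof.
move=> gK gQ hN BK0 BQ0 hK hQ; elim: p w => [|p IH] w /=; first by rewrite expr0 mulr1.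
have B0 : 0 <= BQ * ((4 * r ^ 2)%:R * BK) ^+ p by rewrite mulr_ge0// exprn_ge0// mulr_ge0.
have hN' : ((N.-1 + (1 + 0)) * rho + 2 <= r)%N by rewrite addn0.
apply: le_trans (brk_nu_bound w (adK_graded p gK gQ) gK hN' B0 BK0 IH hK) _.
rewrite exprS; set x := _%:R; set y := (_ ^+ p).
by rewrite (_ : x * (BQ * y * BK) = BQ * (x * BK * y))//; ring.
Qed.

Definition Qterm K (w : seq Z) k (p : nat) : C := (adK io K (dK K) p w)`_k / p.+1`!%:R.
(** The coefficient of order k of the sum over p of ad_K^p(dK) / (p+1)!, the
    Hamiltonian that generates the derivative of exp(L_K). *)
Definition Qsum K w k : C := csum [set: nat] (Qterm K w k).

Definition bounded_by (B : R) K : Prop := 0 <= B /\ forall w k, nc (K w)`_k <= B.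

Lemma dK_bounded_by N B K : bounded_by B K -> (forall w, (size (K w) <= N)%N) ->
  bounded_by (N%:R * B) (dK K).
Proof.
move=> [B0 hB] sK; split; first by rewrite mulr_ge0.
move=> w k; rewrite /dK coef_deriv -[X in nc X]mulr_natl Normc.normcM nc_nat.
have [kN|kN] := ltnP k.+1 N; first by rewrite ler_pM ?nc_ge0// ler_nat ltnW.
by rewrite nth_default ?Normc.normc0 ?mulr0 ?mulr_ge0// (leq_trans (sK w)).
Qed.

Lemma Qterm_bound N B K w k p : (0 < rho)%N -> bounded_by B K ->
  (forall w, (size (K w) <= N)%N) -> graded 0 K -> (k.+1 * rho + 2 <= r)%N ->
  nc (adK io K (dK K) p w)`_k <= r%:R * (N%:R * B) * ((4 * r ^ 2)%:R * (r%:R * B)) ^+ p.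
Proof.
move=> rho0 bK sK gK; have [B20 hB2] := dK_bounded_by bK sK; case: bK => B10 hB1.
move=> hk; have kr : (k < r)%N by nia.
apply: le_trans (nc_nu _ (ltnSn k)) _.
have gd : graded 1 (dK K) by exact: graded_deriv.
have nub a B' w' : 0 <= B' -> (forall w k, nc (a w)`_k <= B') -> nu k.+1 (a w') <= r%:R * B'.
  by move=> B0 h; apply: le_trans (nu_le _ (h w')) _; rewrite ler_wpM2r// ler_nat.
by apply: (adK_nu p w gK gd) => //; rewrite ?mulr_ge0 ?addn1// => w'; apply: nub.
Qed.

Lemma Qsum_isum N B K w k : (0 < rho)%N -> bounded_by B K -> (forall w, (size (K w) <= N)%N) ->
  graded 0 K -> (k.+1 * rho + 2 <= r)%N -> isum (Qterm K w k) (Qsum K w k).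
Proof.
move=> rho0 bK sK gK hk; have h p := Qterm_bound w p rho0 bK sK gK hk.
have B0 := bK.1.
apply: isum_csum.
apply: (@exp_summable _ _ (r%:R * (N%:R * B)) ((4 * r ^ 2)%:R * (r%:R * B))); rewrite ?mulr_ge0// => p.
rewrite /Qterm nc_div mulrA ler_pM ?nc_ge0 ?invr_ge0 ?ler0n//.
by rewrite lef_pV2 ?posrE ?ltr0n ?fact_gt0// ler_nat factS leq_pmull.
Qed.

Definition Qbound (N : nat) (B : R) : R :=
  r%:R * (N%:R * B) * expR ((4 * r ^ 2)%:R * (r%:R * B)).

Lemma Qbound_ge0 N B : 0 <= B -> 0 <= Qbound N B.
Proof. by move=> B0; rewrite /Qbound !mulr_ge0// expR_ge0. Qed.

Lemma Qsum_bounded N B K w k : (0 < rho)%N -> bounded_by B K -> (forall w, (size (K w) <= N)%N) ->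
  graded 0 K -> (k.+1 * rho + 2 <= r)%N -> nc (Qsum K w k) <= Qbound N B.
Proof.
move=> rho0 bK sK gK hk; have h p := Qterm_bound w p rho0 bK sK gK hk.
have B0 := bK.1; rewrite /Qbound.
set B' := r%:R * (N%:R * B); set c := (4 * r ^ 2)%:R * (r%:R * B).
have B'0 : 0 <= B' by rewrite !mulr_ge0.
have c0 : 0 <= c by rewrite !mulr_ge0.
apply: (isum_ler (Qsum_isum w rho0 bK sK gK hk)).
apply: (@le_trans _ _ (\esum_(p in [set: nat]) (B' * (c ^+ p / p`!%:R))%:E)%E).
  apply: le_esum => p _; rewrite lee_fin /Qterm nc_div mulrA.
  rewrite ler_pM ?nc_ge0 ?invr_ge0 ?ler0n//.
  by rewrite lef_pV2 ?posrE ?ltr0n ?fact_gt0// ler_nat factS leq_pmull.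
rewrite esumZ//; last by move=> p; rewrite divr_ge0// exprn_ge0.
by rewrite [leRHS]EFinM lee_wpmul2l ?lee_fin// esum_exp.
Qed.

Lemma eq_brk a a' b b' w : (forall w, a w = a' w) -> (forall w, b w = b' w) ->
  brk io a b w = brk io a' b' w.
Proof. by move=> /funext -> /funext ->. Qed.

Lemma brk_quadC (U : seq Z -> C) w : msupp (fun w => (U w)%:P) ->
  brk io (fun w => (U w)%:P) q0 w = (ith (th w) * U w)%:P.
Proof.
move=> sU; case: w => [|c v].
  by rewrite /theta big_nil /ith /= (_ : 0%:C%C = 0)// mulr0 mul0r.
by rewrite brk_quad// Om_theta -!polyCM.
Qed.

Definition pert l K (z : seq Z -> C) : seq Z -> A := fun w => K w + 'X^(l.+1) * (z w)%:P.

(** The effect on the iterated brackets of adding a term of order l+1 to K.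
    To leading order the new term only meets the quadratic part of K, on
    which the bracket is multiplication by the phase. *)
Lemma adK_perturb l K (z : seq Z -> C) (p : nat) :
  (forall w, (K w)`_0 = (q0 w)`_0) -> msupp (fun w => (z w)%:P : A) ->
  exists Rm : seq Z -> A, forall w,
   adK io (pert l K z) (dK (pert l K z)) p w =
   adK io K (dK K) p w + ('X^l * (l.+1%:R * (ith (th w) ^+ p * z w))%:P + 'X^(l.+1) * Rm w).
Proof.
move=> K0 sz; set K2 := pert l K z.
have q0C w : q0 w = ((q0 w)`_0)%:P.
  rewrite /quad; case: w => [|j [|k [|? ?]]]; rewrite ?coef0//.
  by case: ifP => _; rewrite ?coef0// /lamA coefC.
have [K3 K3E] : exists K3 : seq Z -> A, K2 = fun w => q0 w + 'X * K3 w.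
  exists (fun w => drop_poly 1 (K2 w)); apply/funext => w.
  rewrite -[LHS](poly_take_drop 1) expr1 mulrC; congr (_ + _).
  rewrite q0C -K0; apply/polyP => i; rewrite coef_take_poly coefC.
  case: i => [|i] //=; rewrite /K2 /pert coefD coefXnM /=.
  by rewrite addr0.
elim: p => [|p [Rm IH]].
  exists (fun _ => 0) => w /=; rewrite /dK /K2 /pert derivD derivM derivC derivXn !mulr0 !addr0.
  by rewrite expr0 mul1r polyCM (rmorph_nat (@polyC C)) -mulr_natr mulrA.
have sU : msupp (fun w => (l.+1%:R * (ith (th w) ^+ p * z w))%:P : A).
  move=> w mw; have /eqP := sz w mw; rewrite polyC_eq0 => /eqP ->.
  by rewrite !mulr0.
exists (fun w => brk io (adK io K (dK K) p) (fun w => (z w)%:P) w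
   + brk io (fun w => (l.+1%:R * (ith (th w) ^+ p * z w))%:P) K3 w + brk io Rm K2 w) => w.
rewrite [adK _ _ _ p.+1]/= (@eq_brk _ _ K2 K2 w IH (fun=> erefl)).
rewrite brkDl brkDl !brkZl {1}/K2 /pert brkDr brkZr {1}K3E brkDr brkZr brk_quadC//.
have -> : adK io K (dK K) p.+1 w = brk io (adK io K (dK K) p) K w by [].
have -> : ith (th w) * (l.+1%:R * (ith (th w) ^+ p * z w)) =
   l.+1%:R * (ith (th w) ^+ p.+1 * z w) by rewrite exprS; ring.
rewrite ['X^(l.+1)]exprS; set x := (_ * (_ ^+ p.+1 * _))%:P.
ring.
Qed.

(** The conditions carried along the construction of K up to order l.  The
    bound is explicit so that it depends on the phases only through Lam and
    kap, hence is uniform in the step size. *)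
Definition Kinv l B K := [/\ cyc K, graded 0 K, real_for (@cj R) K, bounded_by B K &
  (forall w, (K w)`_0 = (q0 w)`_0) /\ (forall w, (size (K w) <= l.+1)%N)].

Lemma quad_Kinv (Lam : R) : 0 <= Lam -> (forall x, `|lam x| <= Lam) -> Kinv 0 Lam q0.
Proof.
move=> Lam0 hl; split.
- move=> c v; case: v => [|c' [|c'' v]] //=; last by case: v.
  rewrite -(inj_eq (can_inj (@ibarK _ _))) ibarK eq_sym.
  by case: eqP => [->|].
- move=> w k ck; case: w ck => [|j [|j' [|? ?]]]; rewrite ?coef0//= => ck.
  case: eqP ck => [->|_]; rewrite ?coef0// /lamA coefC; case: ifP => // /eqP ->.
  case/negP; apply/and3P; split=> //; apply/andP; split.
    by rewrite !mom_cons mom_nil mom1_bar addr0 subrr.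
  by apply/implyP => _; rewrite /balanced /=; case: (j.2).
- move=> w; case: w => [|j [|j' [|? ?]]] /=; rewrite ?cj0//.
  rewrite (inj_eq (can_inj (@ibarK _ _))) -[j' == bar j](inj_eq (can_inj (@ibarK _ _))) ibarK.
  by case: ifP => _; rewrite ?cj0// /cj /lamA map_polyC /= oppr0.
- split=> // w k; case: w => [|j [|j' [|? ?]]] /=; rewrite ?coef0 ?Normc.normc0//.
  case: ifP => _; rewrite ?coef0 ?Normc.normc0// /lamA coefC; case: ifP => _.
    by rewrite ncZ.
  by rewrite Normc.normc0.
- split=> // w; case: w => [|j [|j' [|? ?]]] /=; rewrite ?size_poly0//.
  by case: ifP => _; rewrite ?size_poly0// /lamA size_polyC leq_b1.
Qed.

Lemma adK_cyc K Q p : cyc K -> msupp K -> cyc Q -> msupp Q -> cyc (adK io K Q p) /\ msupp (adK io K Q p).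
Proof.
move=> cK sK cQ sQ; elim: p => [|p [IH1 IH2]] //=; split.
  exact: cyc_brk.
exact: msupp_brk.
Qed.

Lemma adK_real K Q p : real_for (@cj R) K -> real_for (@cj R) Q -> real_for (@cj R) (adK io K Q p).
Proof.
move=> rK rQ; elim: p => [|p IH] //=.
apply: real_brk => //; [exact: cj0|exact: cjpD|exact: cjpM|exact: cjpN|exact: cj_io].
Qed.

Lemma dK_real K : real_for (@cj R) K -> real_for (@cj R) (dK K).
Proof. by move=> rK w; rewrite /dK rK /cj deriv_map. Qed.

Variables (n : nat) (P : seq Z -> C) (kap BP : R).
Definition target w k : C := if k == 0%N then P w else 0.
Definition resonance_free : Prop :=
  0 < kap /\ forall w, adm w -> (size w <= r)%N -> kap <= nc (phi1 (th w)).
Definition Pinv : Prop := [/\ forall c v, P (rcons v c) = P (c :: v),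
  forall w, P (map bar w) = conjc (P w), 0 <= BP, forall w, nc (P w) <= BP &
  forall w, ~~ cond 1 w 0 -> P w = 0].

(** The new term of order l+1 is the defect of the equation at order l
    divided by (l+1) phi1(i theta_w).  The defect inherits the symmetries of
    K and P, and the divisor is invariant under rotation and conjugated by
    the exchange of signs, so the symmetries persist. *)
Lemma Kstep l B K : (0 < rho)%N -> resonance_free -> Pinv -> (l.+1 * rho + 2 <= r)%N ->
  Kinv l B K -> (forall w k, (k < l)%N -> Qsum K w k = target w k) ->
  exists K', Kinv l.+1 (B + (BP + Qbound l.+1 B) / kap) K' /\ (forall w k, (k < l.+1)%N -> Qsum K' w k = target w k).
Proof.
move=> rho0 [kap0 hkap] [cP rP BP0 hP sP] hl [cK gK rK bK [K0 sK]] hQ.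
have sumK w k : (k <= l)%N -> isum (Qterm K w k) (Qsum K w k).
  by move=> kl; apply: (Qsum_isum w rho0 bK sK gK); nia.
have mK : msupp K by exact: graded_msupp gK.
have gdK : graded 1 (dK K) by exact: graded_deriv.
have mdK : msupp (dK K) by exact: graded_msupp gdK.
have cdK : cyc (dK K) by move=> c v; rewrite /dK cK.
have adc p := adK_cyc p cK mK cdK mdK.
(* the divisor, and the new term of order l + 1 *)
pose D w : C := l.+1%:R * phi1 (th w).
pose z w : C := if cond 0 w l.+1 then (target w l - Qsum K w l) / D w else 0.
have condc c v : cond 0 (rcons v c) l.+1 = cond 0 (c :: v) l.+1.
  by rewrite !condE adm_rcons size_rcons.
have condb w : cond 0 (map bar w) l.+1 = cond 0 w l.+1.
  by rewrite !condE adm_bar size_map.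
have zc c v : z (rcons v c) = z (c :: v).
  rewrite /z condc /D /target cP theta_rcons; congr (if _ then (_ - _) / _ else _).
  by rewrite /Qsum; congr csum; apply/funext => p; rewrite /Qterm (adc p).1.
have zr w : z (map bar w) = conjc (z w).
  rewrite /z condb; have [cw|cw] := boolP (cond 0 w l.+1); last by rewrite cjz.
  rewrite cjM cjV /D cjM cj_nat theta_bar phi1_conj cjD; congr ((_ + _) / _).
    by rewrite /target rP; case: ifP; rewrite ?cjz.
  rewrite cjN; congr (- _).
  apply: isum_uniq (isum_csum _) _; last first.
    apply: isum_eq (isum_conj (sumK w l (leqnn l))) _ => p.
    rewrite /Qterm cjM cjV cj_nat; congr (_ / _).
    by rewrite -coef_cj -(adK_real p rK (dK_real rK)).
  have [] := sumK (map bar w) l (leqnn l); done.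
have mz : msupp (fun w => (z w)%:P : A).
  move=> w mw; rewrite /z ifF//; apply/negP => /and3P[/andP[m0 _] _ _].
  by rewrite m0 in mw.
have hD w : cond 0 w l.+1 -> kap <= nc (D w).
  move=> /and3P[aw _ sw]; have := hkap _ aw; rewrite /D Normc.normcM nc_nat.
  rewrite addn0 in sw; move=> /(_ (leq_trans sw hl)) h.
  by rewrite -[kap]mul1r ler_pM ?ler1n// ltW.
have D0 w : cond 0 w l.+1 -> D w != 0.
  move=> /hD h; apply: contraTneq kap0 => D0; move: h.
  by rewrite D0 Normc.normc0 -leNgt.
exists (pert l K z); split.
  split.
  - by move=> c v; rewrite /pert cK zc.
  - move=> w k ck; rewrite /pert coefD gK// add0r coefXnM; case: ifP => // /negbT; rewrite -leqNgt => lk.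
    rewrite coefC; case: ifP => // /eqP kl; rewrite /z ifF//; apply/negbTE.
    by apply: contra ck; apply: cond_le; lia.
  - move=> w; rewrite /pert rK zr /cj rmorphD rmorphM; congr (_ + _ * _).
      exact/esym/map_polyXn.
    exact/esym/map_polyC.
  - have hBQ w' := Qsum_bounded w' rho0 bK sK gK hl.
    case: bK => B0 hB; set BQ := Qbound _ _; have BQ0 : 0 <= BQ by exact: Qbound_ge0.
    split.
      by rewrite addr_ge0// divr_ge0 ?addr_ge0// ltW.
    move=> w k; rewrite /pert coefD (le_trans (ncD _ _))// lerD//.
    have z0 : 0 <= (BP + BQ) / kap by rewrite divr_ge0 ?addr_ge0// ltW.
    rewrite coefXnM; case: ifP => _; first by rewrite Normc.normc0.
    rewrite coefC; case: ifP => _; last by rewrite Normc.normc0.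
    rewrite /z; case: ifPn => cw; last by rewrite Normc.normc0.
    rewrite Normc.normcM Normc.normcV ler_pM ?nc_ge0 ?invr_ge0 ?nc_ge0//.
      rewrite (le_trans (ncD _ _))// ncN lerD ?hBQ//.
      by rewrite /target; case: ifP => _; rewrite ?Normc.normc0.
    by rewrite lef_pV2 ?hD// posrE// (lt_le_trans kap0)// hD.
  - split=> w; first by rewrite /pert coefD coefXnM /= addr0.
    rewrite /pert (leq_trans (size_polyD _ _))// geq_max (leq_trans (sK w))//=.
    rewrite mulrC (leq_trans (size_polyMleq _ _))// size_polyXn addnS /=.
    by rewrite size_polyC; case: (z w != 0).
move=> w k kl.
have tE p j : Qterm (pert l K z) w j p = Qterm K w j p +
   (if j == l then (l.+1%:R * z w) * (ith (th w) ^+ p / p.+1`!%:R) else 0) \/ (l < j)%N.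
  have [jl|lj] := leqP j l; last by right.
  left; rewrite /Qterm; have [Rm ->] := @adK_perturb l K z p K0 mz.
  rewrite coefD mulrDl coefD ![in X in _ + X]coefXnM.
  have -> : (j < l.+1)%N by [].
  rewrite addr0; case: ltngtP jl => // jl _; first by rewrite mul0r.
  by rewrite jl subnn coefC eqxx; ring.
have [_ E] : isum (Qterm (pert l K z) w k) (Qsum K w k + (if k == l then l.+1%:R * z w * phi1 (th w) else 0)).
  have h2 : isum (fun p => if k == l then (l.+1%:R * z w) * (ith (th w) ^+ p / p.+1`!%:R) else 0)
     (if k == l then l.+1%:R * z w * phi1 (th w) else 0).
    by case: ifP => _; [apply: isumZ; exact: isum_phi1|exact: isum0].
  have h1 := sumK w k; rewrite -ltnS in h1.
  apply: isum_eq (isumD (h1 kl) h2) _ => p.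
  by have [->//|] := tE p k; rewrite ltnNge -ltnS kl.
rewrite /Qsum E; case: eqP => [kl'|kl'].
  rewrite {k kl E}kl'; have [cw|cw] := boolP (cond 0 w l.+1); last first.
    rewrite {1}/z (negbTE cw) mulr0 mul0r addr0.
    have c1 : ~~ cond 1 w l by rewrite condE addn1 -[l.+1]addn0.
    have -> : Qsum K w l = 0.
      apply: isum_uniq (sumK w l (leqnn l)) _; apply: isum_eq (isum0 _ _) _ => p.
      by rewrite /Qterm (adK_graded p gK gdK) ?mul0r.
    rewrite /target; case: eqP => // l0; rewrite sP//.
    by rewrite l0 in c1.
  rewrite /z cw; set t := target w l - _.
  have -> : l.+1%:R * (t / D w) * phi1 (th w) = t / D w * D w by rewrite {3}/D; ring.
  by rewrite divfK ?D0// /t addrC subrK.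
rewrite addr0; apply: hQ; move: kl; rewrite ltnS leq_eqVlt => /orP[/eqP|//].
by move/kl'.
Qed.

Fixpoint Kbound (Lam : R) l : R :=
  if l is l'.+1 then Kbound Lam l' + (BP + Qbound l (Kbound Lam l')) / kap else Lam.

Lemma solution_exists (Lam : R) : (0 < rho)%N -> resonance_free -> Pinv -> (n * rho + 2 <= r)%N ->
  0 <= Lam -> (forall x, `|lam x| <= Lam) ->
  exists K, Kinv n (Kbound Lam n) K /\ (forall w k, (k < n)%N -> Qsum K w k = target w k).
Proof.
move=> rho0 hres hP hn L0 hL; elim: n hn => [|l IH] hl.
  by exists q0; split=> //; exact: quad_Kinv L0 hL.
have [K [iK hK]] := IH (leq_trans (leq_add (leq_mul (leqnSn l) (leqnn rho)) (leqnn 2)) hl).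
exact: Kstep iK hK.
Qed.

End solving.

(** * Equality of the expansions up to order n *)

Section L_families.
Variables (nonneg : bool) (d : nat).
Local Notation Z := (mode nonneg d).

Lemma L_rel (A : comNzRingType) (Rel : (nat -> A) -> A -> Prop)
  (X : nat -> Z -> seq Z -> A) (g : nat -> seq Z -> A) (Xi : Z -> seq Z -> A) (G : seq Z -> A) v :
  Rel (fun _ => 0) 0 ->
  (forall x y a b, Rel x a -> Rel y b -> Rel (fun p => x p + y p) (a + b)) ->
  (forall y k w, Rel (fun p => X p k y * g p w) (Xi k y * G w)) ->
  Rel (fun p => L (X p) (g p) v) (L Xi G v).
Proof.
move=> R0 RD.
have Rsum (I : Type) (s : seq I) (F : nat -> I -> A) (Fi : I -> A) :
   (forall i, Rel (F ^~ i) (Fi i)) -> Rel (fun p => \sum_(i <- s) F p i) (\sum_(i <- s) Fi i).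
  move=> h; elim: s => [|i s IH].
    by rewrite big_nil (_ : (fun p => _) = fun=> 0)//; apply/funext => p; rewrite big_nil.
  rewrite big_cons (_ : (fun p => _) = fun p => F p i + \sum_(i <- s) F p i).
    exact: RD.
  by apply/funext => p; rewrite big_cons.
have Rconv (F : nat -> seq Z -> seq Z -> A) (Fi : seq Z -> seq Z -> A) u :
   (forall y z, Rel (fun p => F p y z) (Fi y z)) -> Rel (fun p => conv (F p) u) (conv Fi u).
  elim: u F Fi => [|c u IH] F Fi h.
    rewrite conv_nil (_ : (fun p => _) = fun p => F p [::] [::]); first exact: h.
    by apply/funext => p; rewrite conv_nil.
  rewrite conv_cons; apply: (RD) => //.
  by apply: (IH (fun p y z => F p (c :: y) z)) => y z; exact: h.
elim: v g G => [|c v IH] g G h; rewrite LE.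
  rewrite (_ : (fun p => _) = fun p => T (X p) (g p) [::] + 0); last first.
    by apply/funext => p; rewrite LE.
  by apply: (RD) => //; apply: Rconv => y z; apply: Rsum => k; exact: h.
rewrite (_ : (fun p => _) = fun p => T (X p) (g p) (c :: v) + L (X p) (fun w => g p (c :: w)) v); last first.
  by apply/funext => p; rewrite LE.
apply: (RD).
  by apply: Rconv => y z; apply: Rsum => k; exact: h.
by apply: (IH (fun p w => g p (c :: w)) (fun w => G (c :: w))) => y k w; exact: h.
Qed.

Lemma L_map2 (A B : comNzRingType) (phi : A -> B) (X : Z -> seq Z -> A) (X' : Z -> seq Z -> B) f f' v :
  phi 0 = 0 -> {morph phi : x y / x + y} ->
  (forall k y w, phi (X k y * f w) = X' k y * f' w) -> phi (L X f v) = L X' f' v.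
Proof.
move=> p0 pD.
have psum (I : Type) (s : seq I) (F : I -> A) : phi (\sum_(i <- s) F i) = \sum_(i <- s) phi (F i).
  by elim: s => [|i s IH]; rewrite ?big_nil// !big_cons pD IH.
have Cm (F : seq Z -> seq Z -> A) u : phi (conv F u) = conv (fun y z => phi (F y z)) u.
  by elim: u F => [|c u IH] F; rewrite ?conv_nil// !conv_cons pD IH.
elim: v f f' => [|c v IH] f f' h; rewrite LE [RHS]LE pD ?p0; congr (_ + _).
- by rewrite /T Cm; apply: eq_conv => y z; rewrite /pair_at psum; apply: eq_bigr => k _.
- by rewrite /T Cm; apply: eq_conv => y z; rewrite /pair_at psum; apply: eq_bigr => k _.
- exact: IH.
Qed.

End L_families.

Section matching.
Variables (R : realType) (nonneg : bool) (d : nat) (sp : bool).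
Local Notation Z := (mode nonneg d).
Local Notation bar := (@ibar nonneg d).
Local Notation C := R[i].
Local Notation nc := (@Normc.normc R).
Local Notation A := {poly C}.
Local Notation io := (('i%C : C)%:P : A).
Variables (lam : lattice nonneg d -> R) (rho r : nat).
Local Notation graded := (@graded R nonneg d sp rho).
Local Notation cond := (@cond nonneg d sp rho).
Local Notation nu := (@nu R).
Local Notation q0 := (quad (lamA lam)).
Local Notation th := (theta lam).
Implicit Types (K Q : seq Z -> A) (w v : seq Z) (f : seq Z -> C).

Definition lbnd f := forall N0 : nat, exists F : R, 0 <= F /\
  forall w, (size w <= N0)%N -> nc (f w) <= F.

Definition poly_of f : seq Z -> A := fun w => (f w)%:P.

Lemma nu_poly_of N f w : nu N (poly_of f w) <= nc (f w).
Proof.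
rewrite !nuE; case: N => [|N]; first by rewrite big_nil nc_ge0.
rewrite big_nat_recl// coefC eqxx big1 ?addr0// => k _.
by rewrite coefC; exact: Normc.normc0.
Qed.

Lemma LH_nu N e a g (N0 : nat) (Ba F : R) w : graded e a -> 0 <= Ba -> 0 <= F ->
  (forall w, nu N (a w) <= Ba) -> (forall w, (size w <= N0)%N -> nu N (g w) <= F) ->
  (size w <= N0)%N ->
  nu N (L (hf io a) g w) <= (2 * N0.+1 ^ 2)%:R * (Ba * F).
Proof.
move=> ga Ba0 F0 ha hg sw.
apply: (@le_trans _ _ ((2 * (size w).+1 ^ 2)%:R * (Ba * F))); last first.
  by rewrite ler_wpM2r ?mulr_ge0// ler_nat leq_mul2l /= leq_exp2r.
apply: L_bound; [exact: nu0|exact: nuD|exact: mulr_ge0|].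
move=> x y z k xyz ky; rewrite (le_trans (nuM _ _ _))//.
case: y xyz ky => [|y0 y] xyz ky.
  rewrite /hf (graded_small ga)// mulr0 nu0 mul0r mulr_ge0//.
rewrite ler_pM ?nu_ge0//; last by apply: hg; rewrite -xyz in sw; move: sw; rewrite !size_cat /=; lia.
rewrite /hf (le_trans (nuM _ _ _))// -[leRHS]mul1r ler_pM ?nu_ge0//.
by rewrite /sg; case: ifP => _; rewrite ?nuN nu_io.
Qed.

Lemma iter_nu N K g (N0 : nat) (BK F : R) m w : graded 0 K -> 0 <= BK -> 0 <= F ->
  (forall w, nu N (K w) <= BK) -> (forall w, (size w <= N0)%N -> nu N (g w) <= F) ->
  (size w <= N0)%N ->
  nu N (iterL io K m g w) <= ((2 * N0.+1 ^ 2)%:R * BK) ^+ m * F.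
Proof.
move=> gK BK0 F0 hK hg; elim: m w => [|m IH] w sw; first by rewrite expr0 mul1r; exact: hg.
have F1 : 0 <= ((2 * N0.+1 ^ 2)%:R * BK) ^+ m * F by rewrite mulr_ge0// exprn_ge0// mulr_ge0.
apply: le_trans (LH_nu gK BK0 F1 hK IH sw) _.
by rewrite exprS !mulrA.
Qed.

(** A derivation applied to a fixed word is a finite sum, so it commutes
    with infinite sums of coefficient functions. *)
Lemma L_isum_coef n (X : Z -> seq Z -> A) (g : nat -> seq Z -> A) (G : seq Z -> A) :
  (forall v k, (k < n)%N -> isum (fun p => (g p v)`_k) (G v)`_k) ->
  forall v k, (k < n)%N -> isum (fun p => (L X (g p) v)`_k) (L X G v)`_k.
Proof.
move=> h v.
pose Rel (x : nat -> A) (a : A) := forall k, (k < n)%N -> isum (fun p => (x p)`_k) a`_k.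
rewrite -/(Rel (fun p => L X (g p) v) (L X G v)).
apply: (@L_rel _ _ _ Rel (fun=> X) g X G).
- by move=> k _; rewrite coef0; exact: isum0.
- move=> x y a b hx hy k kn; rewrite coefD; apply: isum_eq (isumD (hx k kn) (hy k kn)) _ => p.
  by rewrite coefD.
- move=> y c w k kn; rewrite coefM.
  apply: isum_eq (isum_sum _ (f := fun (j : 'I_k.+1) p => (X c y)`_j * (g p w)`_(k - j)) _) _.
    by move=> j _; apply: isumZ; apply: h; rewrite (leq_ltn_trans (leq_subr _ _)).
  by move=> p; rewrite coefM.
Qed.

Lemma L_isumX (X : nat -> Z -> seq Z -> C) (Xi : Z -> seq Z -> C) f v :
  (forall k y, isum (fun p => X p k y) (Xi k y)) ->
  isum (fun p => L (X p) f v) (L Xi f v).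
Proof.
move=> h; apply: (@L_rel _ _ _ (@isum R nat) X (fun=> f) Xi f); first exact: isum0.
  by move=> x y a b; exact: isumD.
by move=> y k w; exact: isumZr.
Qed.

Lemma L_poly_of (X : Z -> seq Z -> A) f v k :
  (L X (poly_of f) v)`_k = L (fun c y => (X c y)`_k) f v.
Proof.
apply: (@L_map2 _ _ _ _ (fun x : A => x`_k)); first exact: coef0.
  by move=> x y; exact: coefD.
by move=> c y w; rewrite coefMC.
Qed.

(** The term of order k in the step size and m in L_K of exp(L_K) f, on the
    word w. *)
Definition Eterm K f w k (m : nat) : C := (iterL io K m (poly_of f) w)`_k / m`!%:R.

Variables (n : nat) (P : seq Z -> C) (kap BP : R).
Local Notation LP := (L (hf ('i%C : C) P)).

(** At order zero only the diagonal part of K is present. *)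
Lemma Eterm0 K f w : (forall w, (K w)`_0 = (q0 w)`_0) ->
  isum (Eterm K f w 0) (expi (- th w) * f w).
Proof.
move=> K0.
have it m u : (iterL io K m (poly_of f) u)`_0 = ith (- th u) ^+ m * f u.
  elim: m u => [|m IH] u; first by rewrite /= coefC eqxx expr0 mul1r.
  rewrite [iterL _ _ _ _]/= (@L_map2 _ _ _ _ (fun x : A => x`_0)
     _ (hf ('i%C : C) (quad (fun x => ((lam x)%:C)%C))) _ (fun w => ith (- th w) ^+ m * f w)).
  - rewrite L_quad mulrA exprS; congr (_ * _ * _).
    have -> : Om (fun x => ((lam x)%:C)%C) u = ((th u)%:C)%C.
      elim: u => [|k u IHu]; first by rewrite /Om /theta !big_nil.
      rewrite Om_cons IHu /theta big_cons rmorphD; congr (_ + _).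
      by rewrite /phase1; case: k.2; rewrite ?rmorphN.
    by rewrite /ith rmorphN mulrN mulNr.
  - exact: coef0.
  - by move=> x y; exact: coefD.
  - move=> k y w'; rewrite coef0M IH; congr (_ * _).
    rewrite /hf coef0M K0; congr (_ * _).
      by rewrite /sg; case: ifP => _; rewrite ?coefN coefC eqxx.
    rewrite /quad; case: y => [|a [|b y]]; rewrite ?coef0//.
    by case: ifP => _; rewrite ?coef0// coefC eqxx.
apply: isum_eq (isumZr (f w) (isum_expi (- th w))) _ => m.
by rewrite /Eterm it mulrAC.
Qed.

Lemma P_lbnd f : Pinv sp rho P BP -> lbnd f -> lbnd (LP f).
Proof.
move=> [_ _ BP0 hP sP] hf0 N0; have [F [F0 hF]] := hf0 N0.
exists ((2 * N0.+1 ^ 2)%:R * (BP * F)); split; first by rewrite !mulr_ge0.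
move=> w sw; apply: (@le_trans _ _ ((2 * (size w).+1 ^ 2)%:R * (BP * F))); last first.
  by rewrite ler_wpM2r ?mulr_ge0// ler_nat leq_mul2l /= leq_exp2r.
apply: L_bound; [exact: Normc.normc0|exact: ncD|exact: mulr_ge0|].
move=> x y z k xyz ky.
case: y xyz ky => [|y0 y] xyz ky.
  rewrite /hf sP ?mulr0 ?mul0r ?Normc.normc0 ?mulr_ge0//.
  by apply/negP => /and3P[].
rewrite Normc.normcM ler_pM ?nc_ge0//.
  rewrite /hf Normc.normcM -[leRHS]mul1r ler_pM ?nc_ge0//.
  by rewrite /sg; case: ifP => _; rewrite ?ncN nc_ii.
by apply: hF; rewrite -xyz in sw; move: sw; rewrite !size_cat /=; lia.
Qed.

(** The coefficient of order k of d/dt exp(L_K) f = exp(L_K) L_P f; the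
    equation Q = P is used up to that order. *)
Lemma Eterm_step K N BK f w k : (0 < rho)%N -> Pinv sp rho P BP -> lbnd f ->
  graded 0 K -> bounded_by BK K -> (forall w, (size (K w) <= N)%N) ->
  (forall w j, (j <= k)%N -> Qsum K w j = target P w j) -> (k.+1 * rho + 2 <= r)%N ->
  isum (Eterm K (LP f) w k) (csum [set: nat] (Eterm K (LP f) w k)) /\
  isum (fun m => k.+1%:R * Eterm K f w k.+1 m) (csum [set: nat] (Eterm K (LP f) w k)).
Proof.
move=> rho0 hP hf0 gK bK sK hQ hk.
have gd : graded 1 (dK K) by exact: graded_deriv.
have [BK0 hBK] := bK.
have hBQ u j p := @Qterm_bound _ _ _ sp rho r N BK K u j p rho0 bK sK gK.
set BQ := r%:R * (N%:R * BK) in hBQ; set cQ := (4 * r ^ 2)%:R * (r%:R * BK) in hBQ.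
have BQ0 : 0 <= BQ by rewrite !mulr_ge0.
have cQ0 : 0 <= cQ by rewrite !mulr_ge0.
clearbody BQ cQ.
have nuK u : nu k.+1 (K u) <= k.+1%:R * BK by exact: nu_le.
have nuKn : 0 <= k.+1%:R * BK by rewrite mulr_ge0.
pose Qp := adK io K (dK K).
have gQ p : graded 1 (Qp p) by exact: adK_graded.
have nuQ p u : nu k.+1 (Qp p u) <= k.+1%:R * (BQ * cQ ^+ p).
  rewrite nuE; apply: (@le_trans _ _ (\sum_(0 <= j < k.+1) (BQ * cQ ^+ p))); last first.
    by rewrite big_const_nat subn0 iter_addr_0 mulr_natl.
  rewrite big_nat [leRHS]big_nat; apply: ler_sum => j /andP[_ jk]; apply: hBQ.
  by apply: leq_trans hk; rewrite leq_add2r leq_mul2r; apply/orP; right.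
pose N0 := size w; have [F [F0 hF]] := hf0 N0.
pose cL := (2 * N0.+1 ^ 2)%:R : R.
(* the double family indexed by the powers of L_K and of ad_K is dominated by a
   product of two exponential series *)
pose B1 := cL * (k.+1%:R * BQ * F).
pose c1 := cL * (k.+1%:R * BK).
have cL0 : 0 <= cL by rewrite /cL.
have B10 : 0 <= B1 by rewrite /B1 !mulr_ge0.
have c10 : 0 <= c1 by rewrite /c1 !mulr_ge0.
have LQ p u : (size u <= N0)%N -> nu k.+1 (L (hf io (Qp p)) (poly_of f) u) <= B1 * cQ ^+ p.
  move=> su; apply: le_trans (LH_nu (N0 := N0) (F := F) (gQ p) _ F0 (nuQ p) _ su) _.
  - by rewrite !mulr_ge0// exprn_ge0.
  - by move=> u' su'; apply: le_trans (nu_poly_of _ _ _) _; exact: hF.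
  - by rewrite /B1 /cL; set x := _%:R; set y := cQ ^+ p;
       rewrite (_ : x * (k.+1%:R * (BQ * y) * F) = x * (k.+1%:R * BQ * F) * y)//; ring.
pose G q p : C := (iterL io K q (L (hf io (Qp p)) (poly_of f)) w)`_k / (q`!%:R * p.+1`!%:R).
have Gb q p : nc (G q p) <= c1 ^+ q / q`!%:R * (B1 * (cQ ^+ p / p`!%:R)).
  rewrite /G -natrM nc_div.
  have h : nc (iterL io K q (L (hf io (Qp p)) (poly_of f)) w)`_k <= c1 ^+ q * (B1 * cQ ^+ p).
    apply: le_trans (nc_nu _ (ltnSn k)) _.
    have BF : 0 <= B1 * cQ ^+ p by rewrite mulr_ge0// exprn_ge0.
    exact: (iter_nu q gK nuKn BF nuK (LQ p) (leqnn N0)).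
  apply: (@le_trans _ _ (c1 ^+ q * (B1 * cQ ^+ p) / (q`! * p`!)%:R)).
    rewrite ler_pM ?nc_ge0 ?invr_ge0//.
    rewrite lef_pV2 ?posrE ?ltr0n ?muln_gt0 ?fact_gt0// ler_nat leq_mul2l.
    by rewrite factS leq_pmull// orbT.
  rewrite natrM invfM; set a := q`!%:R^-1; set b := p`!%:R^-1; set x := c1 ^+ q; set y := cQ ^+ p.
  by rewrite (_ : x * (B1 * y) * (a * b) = x * a * (B1 * (y * b)))//; ring.
have Gs : (nsum (fun x : nat * nat => G x.1 x.2) < +oo)%E.
  pose u q : C := (c1 ^+ q / q`!%:R)%:C%C; pose v p : C := (B1 * (cQ ^+ p / p`!%:R))%:C%C.
  have u0 q : 0 <= c1 ^+ q / q`!%:R by rewrite divr_ge0// exprn_ge0.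
  have v0 p : 0 <= B1 * (cQ ^+ p / p`!%:R) by rewrite mulr_ge0// divr_ge0// exprn_ge0.
  have hu : isum u (csum [set: nat] u).
    by apply: isum_csum; apply: (@exp_summable _ _ 1 c1) => // q; rewrite ncR// mul1r.
  have hv : isum v (csum [set: nat] v).
    by apply: isum_csum; apply: (@exp_summable _ _ B1 cQ) => // q; rewrite ncR.
  have [s _] := isum_mul hu hv; apply: le_lt_trans s; apply: nsum_le => x.
  by rewrite [leRHS]Normc.normcM /u /v !ncR//; exact: Gb.
have inner q : isum (G q) (Eterm K (LP f) w k q).
  have base v j : (j < k.+1)%N -> isum (fun p => (L (hf io (Qp p)) (poly_of f) v)`_j / p.+1`!%:R)
      (poly_of (LP f) v)`_j.
    move=> jk.
    have hh : isum (fun p => L (fun c y => (p.+1`!%:R)^-1 * (hf io (Qp p) c y)`_j) f v)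
        (L (fun c y => if j == 0%N then hf ('i%C : C) P c y else 0) f v).
      apply: L_isumX => c y.
      have hj := @Qsum_isum _ _ _ _ _ r _ _ _ (bar c :: y) j rho0 bK sK gK.
      have {}hj := hj (leq_trans (leq_add (leq_mul jk (leqnn rho)) (leqnn 2)) hk).
      rewrite hQ -1?ltnS// in hj; rewrite /target in hj.
      have := isumZ (sg ('i%C : C) c) hj.
      rewrite (_ : sg _ c * _ = if j == 0%N then hf 'i%C P c y else 0); last first.
        by rewrite /hf; case: ifP => _; rewrite ?mulr0.
      move=> /isum_eq; apply => p; rewrite /Qterm /hf.
      have -> : sg io c = (sg ('i%C : C) c)%:P by rewrite /sg; case: ifP; rewrite ?polyCN.
      by rewrite coefCM; ring.
    rewrite /poly_of coefC.
    have -> : (if j == 0%N then LP f v else 0) = L (fun c y => if j == 0%N then hf ('i%C : C) P c y else 0) f v.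
      by case: ifP => _ //; rewrite LX0.
    by apply: isum_eq hh _ => p; rewrite LXZ L_poly_of mulrC.
  have main v j : (j < k.+1)%N -> isum (fun p => (iterL io K q (L (hf io (Qp p)) (poly_of f)) v)`_j / p.+1`!%:R)
      (iterL io K q (poly_of (LP f)) v)`_j.
    elim: q v j => [|q IH] v j jk; first exact: base.
    pose g p u := iterL io K q (L (hf io (Qp p)) (poly_of f)) u * ((p.+1`!%:R)^-1)%:P.
    have hyp u i : (i < k.+1)%N -> isum (fun p => (g p u)`_i) (iterL io K q (poly_of (LP f)) u)`_i.
      move=> ik; have /isum_eq := IH u i ik; apply => p.
      by rewrite /g coefMC.
    have /isum_eq := L_isum_coef (hf io K) hyp v jk; apply => p.
    by rewrite /g LfZr coefMC.
  have /isum_eq := isumZr (q`!%:R^-1) (main w k (ltnSn k)); apply => p.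
  by rewrite /G invfM; ring.
have tot := isum_csum Gs; set c0 := csum _ _ in tot.
have outer : isum (Eterm K (LP f) w k) c0 := isum_pairI tot inner.
have -> : csum [set: nat] (Eterm K (LP f) w k) = c0 by case: outer.
split; first exact: outer.
pose H (m p : nat) : C := if (p < m)%N then G (m.-1 - p)%N p else 0.
have totH : isum (fun x : nat * nat => H x.1 x.2) c0.
  apply/(@isum_reindex _ _ _ (fun x : nat * nat => ((x.1 + x.2).+1, x.2)%N)).
  - by move=> [a b] [a' b'] /= [e1 e2]; subst b'; congr pair; lia.
  - move=> [m p] hmp; rewrite /H /=; case: ifP => // pm; exfalso.
    apply: (hmp ((m.-1 - p)%N, p)) => /=; congr pair; lia.
  apply: isum_eq tot _ => -[q p]; rewrite /H /= ltnS leq_addl.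
  by rewrite addnK.
have innerH m : isum (H m) (\sum_(0 <= p < m) H m p).
  apply: isum_seq; first exact: iota_uniq.
  by move=> p; rewrite mem_index_iota /= => pm; rewrite /H (negbTE pm).
have /isum_eq := isum_pairI totH innerH; apply => m.
have dpoly u : (poly_of f u)^`() = 0 by rewrite /poly_of derivC.
have := @deriv_iterL _ _ A io (fun x => x^`()) K m (poly_of f) w (raddf0 _) (raddfD _) (@derivM _)
   (derivC _) _ dpoly.
rewrite derivN derivC oppr0 => /(_ erefl) /(congr1 (fun x : A => x`_k)).
rewrite coef_deriv coef_sum => E.
rewrite /Eterm mulrA mulr_natl E mulr_suml big_nat [RHS]big_nat.
apply: eq_bigr => p /andP[_ pm]; rewrite /H pm mulr_natl coefMn /G -/(Qp p).
have -> : (m.-1 - p = m - p.+1)%N by lia.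
have fE : (m`!%:R : C) = 'C(m, p.+1)%:R * (p.+1`!%:R * (m - p.+1)`!%:R).
  by rewrite -!natrM bin_fact.
have Fn0 q : (q`!%:R : C) != 0 by rewrite pnatr_eq0 -lt0n fact_gt0.
have B0 : ('C(m, p.+1)%:R : C) != 0 by rewrite pnatr_eq0 -lt0n bin_gt0.
rewrite fE -mulr_natl; set x := _`_k; have := Fn0 p.+1; have := Fn0 (m - p.+1)%N.
by move=> h1 h2; field; rewrite h1 h2 B0.
Qed.

(** The recursion of [Eterm_step] determines all the coefficients from the
    one of order zero. *)
Lemma Eterm_matching K N BK f w k : (0 < rho)%N -> Pinv sp rho P BP -> lbnd f ->
  graded 0 K -> bounded_by BK K -> (forall w, (size (K w) <= N)%N) ->
  (forall w, (K w)`_0 = (q0 w)`_0) ->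
  (forall w j, (j < n)%N -> Qsum K w j = target P w j) -> (n * rho + 2 <= r)%N -> (k <= n)%N ->
  isum (Eterm K f w k) (expi (- th w) * (iter k LP f w / k`!%:R)).
Proof.
move=> rho0 hP hf0 gK bK sK K0 hQ hn.
elim: k f hf0 => [|k IH] f hf0 kn.
  by rewrite fact0 divr1; exact: Eterm0.
have hk : (k.+1 * rho + 2 <= r)%N by apply: leq_trans hn; rewrite leq_add2r leq_mul2r kn orbT.
have hQk u j : (j <= k)%N -> Qsum K u j = target P u j by move=> jk; apply: hQ; lia.
have [h1 h2] := Eterm_step w rho0 hP hf0 gK bK sK hQk hk.
have E := isum_uniq h1 (IH (LP f) (P_lbnd hP hf0) (ltnW kn)).
rewrite {}E in h2.
have k0 : (k.+1%:R : C) != 0 by rewrite pnatr_eq0.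
have F0 : (k`!%:R : C) != 0 by rewrite pnatr_eq0 -lt0n fact_gt0.
have := isumZ (k.+1%:R^-1) h2.
have -> : k.+1%:R^-1 * (expi (- th w) * (iter k LP (LP f) w / k`!%:R)) =
    expi (- th w) * (iter k.+1 LP f w / k.+1`!%:R).
  by rewrite iterSr factS natrM invfM; set x := iter _ _ _ _; set a := k.+1%:R^-1; ring.
by move=> /isum_eq; apply => m; rewrite mulKf.
Qed.

End matching.

(** * Weights and the scalar majorant *)

Section weights.
Variables (R : realType) (nonneg : bool) (d : nat).
Local Notation Z := (mode nonneg d).

Definition vnorm (v : 'rV[int]_d) : R := Num.sqrt (Num.max 1 (\sum_i (v 0 i)%:~R ^+ 2)).

Lemma vnorm_ge1 v : 1 <= vnorm v.
Proof. by rewrite /vnorm -{1}(sqrtr1 R) ler_wsqrtr// le_max lexx. Qed.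

Lemma vnorm0 : vnorm 0 = 1.
Proof.
rewrite /vnorm big1 => [|i _]; last by rewrite mxE expr0n.
by rewrite max_l ?sqrtr1// ler01.
Qed.

Lemma vnormN v : vnorm (- v) = vnorm v.
Proof. by rewrite /vnorm; congr (Num.sqrt (Num.max 1 _)); apply: eq_bigr => i _; rewrite mxE rmorphN sqrrN. Qed.

(** Both norms are at least one, so their sum is at most twice their
    product. *)
Lemma vnorm_add v w : vnorm (v + w) <= 2 * (vnorm v * vnorm w).
Proof.
have E : 2 = Num.sqrt 4 :> R.
  by rewrite (_ : 4 = 2 ^+ 2); [rewrite sqrtr_sqr ger0_norm|ring].
pose a := Num.max 1 (\sum_i (v 0 i)%:~R ^+ 2) : R.
pose b := Num.max 1 (\sum_i (w 0 i)%:~R ^+ 2) : R.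
have a1 : 1 <= a by rewrite le_max lexx.
have b1 : 1 <= b by rewrite le_max lexx.
have av : \sum_i (v 0 i)%:~R ^+ 2 <= a by rewrite le_max lexx orbT.
have bw : \sum_i (w 0 i)%:~R ^+ 2 <= b by rewrite le_max lexx orbT.
rewrite /vnorm -/a -/b E -!sqrtrM ?ler0n ?(le_trans ler01)//.
apply: ler_wsqrtr; rewrite ge_max; apply/andP; split; first by nra.
apply: (@le_trans _ _ (2 * \sum_i (v 0 i)%:~R ^+ 2 + 2 * \sum_i (w 0 i)%:~R ^+ 2)).
  rewrite !big_distrr -big_split /=; apply: ler_sum => i _.
  by rewrite mxE rmorphD; set x := _%:~R; set y := _%:~R; have := sqr_ge0 (x - y); lra.
by nra.
Qed.

Lemma vnorm_word (y : seq Z) : vnorm (momentum y) <= 2 ^+ size y * \prod_(c <- y) anorm R c.1.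
Proof.
elim: y => [|c y IH]; first by rewrite mom_nil vnorm0 big_nil mulr1.
rewrite mom_cons big_cons (le_trans (vnorm_add _ _))//= exprS.
have -> : vnorm (mom1 c) = anorm R c.1 by rewrite /mom1 /anorm; case: c.2; rewrite ?vnormN.
have c1 : 1 <= anorm R c.1 by exact: vnorm_ge1.
rewrite -!mulrA ler_wpM2l// mulrCA ler_wpM2l// ?(le_trans ler01)//.
Qed.

Variables (s : R) (hs : 0 <= s).
Definition wt (k : Z) : R := anorm R k.1 `^ s.
Definition wtw (y : seq Z) : R := \prod_(c <- y) wt c.
Lemma wtw_nil : wtw [::] = 1. Proof. by rewrite /wtw big_nil. Qed.
Lemma wtw_cons k y : wtw (k :: y) = wt k * wtw y.
Proof. by rewrite /wtw big_cons. Qed.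

Definition W1 : R := 2 `^ s.

Lemma wt_ge1 k : 1 <= wt k.
Proof. by rewrite /wt -{1}(powRr0 (anorm R k.1)) ler_powR//; exact: vnorm_ge1. Qed.

Lemma wt_ge0 k : 0 <= wt k. Proof. exact: le_trans ler01 (wt_ge1 k). Qed.

Lemma wtw_ge1 y : 1 <= wtw y.
Proof.
rewrite /wtw; elim: y => [|c y IH]; first by rewrite big_nil.
by rewrite big_cons; apply: mulr_ege1 => //; exact: wt_ge1.
Qed.

Lemma wtw_ge0 y : 0 <= wtw y. Proof. exact: le_trans ler01 (wtw_ge1 y). Qed.

Lemma W1_ge1 : 1 <= W1.
Proof. by rewrite /W1 -{1}(powRr0 2) ler_powR// ler1n. Qed.

(** A field preserves momentum, so the weight of the letter it produces is
    controlled by the weights of the letters it consumes.  This makes the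
    polynomial fields bounded on l^1_s. *)
Lemma wt_word k y : mom1 k = momentum y -> wt k <= W1 ^+ size y * wtw y.
Proof.
move=> ky.
have -> : W1 ^+ size y * wtw y = (2 ^+ size y * \prod_(c <- y) anorm R c.1) `^ s.
  elim: y {ky} => [|c y IH]; first by rewrite /wtw !big_nil !expr0 !mulr1 powR1.
  have anp (b : Z) : 0 <= anorm R b.1 by exact: le_trans ler01 (vnorm_ge1 _).
  rewrite /wtw !big_cons /= !exprS -/(wtw y).
  rewrite [in RHS]mulrACA.
  have pr0 : 0 <= 2 ^+ size y * \prod_(j <- y) anorm R j.1.
    by rewrite mulr_ge0// ?exprn_ge0// prodr_ge0.
  by rewrite (powRM _ (mulr_ge0 _ (anp c)) pr0)// -IH (powRM _ _ (anp c))// -/W1 -/(wt c) [LHS]mulrACA.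
rewrite /wt ge0_ler_powR// ?nnegrE.
- exact: le_trans ler01 (vnorm_ge1 _).
- by rewrite mulr_ge0// ?exprn_ge0// prodr_ge0// => c _; exact: le_trans ler01 (vnorm_ge1 _).
have -> : anorm R k.1 = vnorm (momentum y) by rewrite -ky /mom1 /anorm; case: k.2; rewrite ?vnormN.
exact: vnorm_word.
Qed.

End weights.

Section scalar_majorant.
Variables (R : realType).

(** The m-th coefficient of the l-th power of the series with coefficients
    Y. *)
Fixpoint cpow (Y : nat -> R) (l m : nat) : R :=
  if l is l'.+1 then \sum_(0 <= i < m.+1) Y i * cpow Y l' (m - i) else (m == 0%N)%:R.

Lemma cpow_ge0 Y l m : (forall i, 0 <= Y i) -> 0 <= cpow Y l m.
Proof. by move=> Y0; elim: l m => [|l IH] m //=; apply: sumr_ge0 => i _; rewrite mulr_ge0. Qed.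

Lemma cpow1 Y m : cpow Y 1 m = Y m.
Proof.
rewrite /= big_nat_recr//= subnn eqxx mulr1 big_nat big1 ?add0r// => i /andP[_ im].
by rewrite subn_eq0 leqNgt im mulr0.
Qed.

Variable (Lam : R).
Hypothesis Lam0 : 0 < Lam.

(** The coefficients of a flow grow at most like (Lam)^m / m! as long as
    only the linear part acts; these factors compensate that growth while
    remaining bounded below. *)
Definition damping (m : nat) : R := \prod_(0 <= i < m) Num.min 1 (i.+1%:R / (4 * Lam)).
Definition dweight (m : nat) : R := 2 ^+ m * damping m.

Lemma fac_gt0 i : 0 < Num.min 1 (i.+1%:R / (4 * Lam)).
Proof. by rewrite lt_min ltr01 divr_gt0// ?ltr0n// mulr_gt0. Qed.

Lemma damping_gt0 m : 0 < damping m.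
Proof. by rewrite /damping; apply: prodr_gt0 => i _; exact: fac_gt0. Qed.

Lemma dampingS m : damping m.+1 = damping m * Num.min 1 (m.+1%:R / (4 * Lam)).
Proof. by rewrite /damping big_nat_recr. Qed.

Lemma damping_decr m n : (m <= n)%N -> damping n <= damping m.
Proof.
elim: n m => [|n IH] m; first by rewrite leqn0 => /eqP->.
rewrite leq_eqVlt ltnS => /orP[/eqP->//|/IH h]; apply: le_trans h.
by rewrite dampingS; apply: ler_piMr; [rewrite ltW ?damping_gt0|rewrite ge_min lexx].
Qed.

(** The factors of the product are equal to one from some index on. *)
Lemma damping_lower : exists kap, [/\ 0 < kap, kap <= 1 & forall m, kap <= damping m].
Proof.
have [q hq] : exists q : nat, 4 * Lam <= q%:R.
  by exists (Num.bound (4 * Lam)); apply: ltW; apply: archi_boundP; rewrite mulr_ge0// ltW.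
exists (damping q); split; first exact: damping_gt0.
  by apply: le_trans (damping_decr (leq0n q)) _; rewrite /damping big_nil.
move=> m; have [mq|qm] := leqP m q; first exact: damping_decr.
have -> // : damping m = damping q.
elim: m qm => // m IH; rewrite ltnS leq_eqVlt => qm.
have -> : damping m.+1 = damping m.
  rewrite dampingS min_l ?mulr1// ler_pdivlMr ?mulr_gt0// mul1r (le_trans hq)// ler_nat.
  by case/orP: qm => [/eqP->|/ltnW]//; lia.
by case/orP: qm => [/eqP->|/IH].
Qed.

Lemma dweight_gt0 m : 0 < dweight m. Proof. by rewrite mulr_gt0// ?exprn_gt0// damping_gt0. Qed.

Lemma dweight_ge0 m : 0 <= dweight m. Proof. exact: ltW (dweight_gt0 m). Qed.

(** The choice of the factors makes the linear part of the recursion a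
    contraction with constant one half. *)
Lemma dweightS m : dweight m.+1 / m.+1%:R <= dweight m / (2 * Lam).
Proof.
rewrite /dweight dampingS exprS.
have k0 := damping_gt0 m; have e0 : 0 < 2 ^+ m :> R by rewrite exprn_gt0.
have mn : 0 < m.+1%:R :> R by rewrite ltr0n.
apply: (@le_trans _ _ (2 * 2 ^+ m * (damping m * (m.+1%:R / (4 * Lam))) / m.+1%:R)).
  rewrite ler_wpM2r ?invr_ge0//; apply: ler_wpM2l; first by rewrite mulr_ge0// ltW.
  by apply: ler_wpM2l; [exact: ltW|rewrite ge_min lexx orbT].
rewrite le_eqVlt; apply/orP; left; apply/eqP.
move: (m.+1%:R) mn (2 ^+ m) (damping m) {k0 e0} => x x0 y z.
by field; rewrite (gt_eqF x0) (gt_eqF Lam0).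
Qed.

(** Up to a constant the weights are submultiplicative, as the damping
    factors are at most one and bounded below. *)
Lemma dweight_submul kap a b : 0 < kap -> (forall m, kap <= damping m) -> dweight (a + b) <= dweight a * dweight b / kap.
Proof.
move=> k0 hk; rewrite /dweight exprD -!mulrA ler_wpM2l ?exprn_ge0// mulrCA ler_wpM2l ?exprn_ge0//.
apply: le_trans (damping_decr (leq_addr b a)) _.
by rewrite -[leLHS]mulr1; apply: ler_wpM2l; [exact/ltW/damping_gt0|rewrite ler_pdivlMr// mul1r].
Qed.

Lemma cpow_dweight Y kap l N : 0 < kap -> kap <= 1 -> (forall m, kap <= damping m) -> (forall i, 0 <= Y i) ->
  \sum_(0 <= m < N) dweight m * cpow Y l m <= ((\sum_(0 <= m < N) dweight m * Y m) / kap) ^+ l.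
Proof.
move=> k0 k1 hk Y0; elim: l => [|l IH].
  rewrite expr0; case: N => [|N]; first by rewrite big_nil ler01.
  rewrite big_nat_recl//= big1 ?addr0; last by move=> i _; rewrite mulr0.
  by rewrite /dweight expr0 /damping big_nil !mulr1.
set S := \sum_(0 <= m < N) dweight m * Y m.
rewrite exprS.
apply: (@le_trans _ _ (\sum_(0 <= i < N) \sum_(0 <= j < N) (dweight i * Y i / kap) * (dweight j * cpow Y l j))); last first.
  have -> : \sum_(0 <= i < N) \sum_(0 <= j < N) (dweight i * Y i / kap) * (dweight j * cpow Y l j) =
     (S / kap) * \sum_(0 <= j < N) (dweight j * cpow Y l j).
    rewrite /S mulr_suml mulr_suml; apply: eq_bigr => i _; by rewrite big_distrr.
  apply: ler_wpM2l => //; apply: divr_ge0; last exact: ltW.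
  by apply: sumr_ge0 => i _; rewrite mulr_ge0// ?dweight_ge0.
apply: (@le_trans _ _ (\sum_(0 <= m < N) \sum_(0 <= i < m.+1) (dweight i * Y i / kap) * (dweight (m - i)%N * cpow Y l (m - i)))).
  apply: ler_sum => m _ /=; rewrite big_distrr /= big_nat [leRHS]big_nat.
  apply: ler_sum => i /andP[_ im]; have := dweight_submul i (m - i) k0 hk; rewrite subnKC// => h.
  have c0 := cpow_ge0 l (m - i) Y0.
  apply: le_trans (ler_wpM2r _ h) _; first by rewrite mulr_ge0.
  by rewrite le_eqVlt; apply/orP; left; apply/eqP; ring.
pose F i j := (dweight i * Y i / kap) * (dweight j * cpow Y l j).
have F0 i j : 0 <= F i j.
  apply: mulr_ge0; last exact: mulr_ge0 (dweight_ge0 j) (cpow_ge0 l j Y0).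
  exact: divr_ge0 (mulr_ge0 (dweight_ge0 i) (Y0 i)) (ltW k0).
have -> : \sum_(0 <= m < N) \sum_(0 <= i < m.+1) F i (m - i)%N =
   \sum_(0 <= i < N) \sum_(0 <= j < N - i) F i j.
  elim: (N) => [|m IHm]; first by rewrite !big_nil.
  rewrite big_nat_recr//= IHm [RHS]big_nat_recr//= subSnn big_nat1.
  rewrite big_nat_recr//= subnn addrA; congr (_ + _).
  rewrite -big_split /= big_nat [RHS]big_nat; apply: eq_bigr => i /andP[_ im].
  have -> : (m.+1 - i = (m - i).+1)%N by lia.
  by rewrite big_nat_recr.
rewrite big_nat [leRHS]big_nat; apply: ler_sum => i /andP[_ iN].
rewrite [leRHS](@big_cat_nat _ _ _ (N - i)%N)//= ?leq_subr// lerDl.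
by apply: sumr_ge0 => j _; exact: F0.
Qed.

(** By induction on the number of terms: with the weights [dweight] the
    linear part contributes at most half of the sum, and the nonlinear part,
    of size e, at most the remaining margin.  The bound must be on the sum
    of 2^m Y_m, so that the series and its second derivative converge up to
    time one. *)
Lemma scalar_bound (D : nat) (M : R) : 0 < M ->
  exists e0 B Bp, [/\ 0 < e0, 0 <= B, 0 <= Bp & forall (e : R) (Y : nat -> R), 0 <= e -> e <= e0 -> (forall i, 0 <= Y i) ->
    Y 0%N <= M ->
    (forall m, m.+1%:R * Y m.+1 <= Lam * Y m + e * \sum_(1 <= l < D.+1) cpow Y l m) ->
    (forall N, \sum_(0 <= m < N) 2 ^+ m * Y m <= B) /\
    forall l N, (l <= D)%N -> \sum_(0 <= m < N) 2 ^+ m * cpow Y l m <= Bp].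
Proof.
move=> M0; have [kap [k0 k1 hk]] := damping_lower.
pose g := \sum_(1 <= l < D.+1) (4 * M / kap) ^+ l.
have q0 : 0 <= 4 * M / kap by rewrite divr_ge0 ?mulr_ge0// ltW.
have g0 : 0 <= g by apply: sumr_ge0 => l _; rewrite exprn_ge0.
have L2 : 0 < 2 * Lam by rewrite mulr_gt0.
pose Bp := (\sum_(0 <= l < D.+1) (4 * M / kap) ^+ l) / kap.
have Bp0 : 0 <= Bp.
  by apply: divr_ge0; [apply: sumr_ge0 => l _; rewrite exprn_ge0|exact: ltW].
exists (2 * Lam * M / (g + 1)), (4 * M / kap), Bp; split=> //.
  by rewrite divr_gt0 ?mulr_gt0// ltr_wpDl.
move=> e Y e0 ee0 Y0 YM h.
pose S N := \sum_(0 <= m < N) dweight m * Y m.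
have S0 N : 0 <= S N by apply: sumr_ge0 => i _; rewrite mulr_ge0// ?dweight_ge0.
have eg : e / (2 * Lam) * g <= M.
  have h1 : e * (g + 1) <= 2 * Lam * M by rewrite -ler_pdivlMr// ltr_wpDl.
  rewrite mulrAC ler_pdivrMr//; nra.
have SM N : S N <= 4 * M.
  elim: N => [|N IH]; first by rewrite /S big_nil; lra.
  rewrite /S big_nat_recl// /dweight expr0 /damping big_nil !mul1r.
  have hS : \sum_(0 <= i < N) dweight i.+1 * Y i.+1 <= S N / 2 + e / (2 * Lam) * g.
    apply: (@le_trans _ _ (\sum_(0 <= i < N) (dweight i / (2 * Lam)) * (Lam * Y i + e * \sum_(1 <= l < D.+1) cpow Y l i))).
      apply: ler_sum => i _.
      have -> : dweight i.+1 * Y i.+1 = (dweight i.+1 / i.+1%:R) * (i.+1%:R * Y i.+1).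
        by rewrite mulrA divfK// pnatr_eq0.
      apply: ler_pM => //; [by rewrite divr_ge0 ?dweight_ge0// ltW|by rewrite mulr_ge0|exact: dweightS].
    have -> : \sum_(0 <= i < N) (dweight i / (2 * Lam)) * (Lam * Y i + e * \sum_(1 <= l < D.+1) cpow Y l i) =
       S N / 2 + e / (2 * Lam) * \sum_(1 <= l < D.+1) \sum_(0 <= i < N) dweight i * cpow Y l i.
      rewrite exchange_big /= /S mulr_suml big_distrr -big_split /=; apply: eq_bigr => i _.
      rewrite -big_distrr /=; set x := \sum_(1 <= _ < _) _; field; by rewrite gt_eqF.
    rewrite lerD2l; apply: ler_wpM2l; first by rewrite divr_ge0// ltW.
    apply: ler_sum => l _.
    apply: le_trans (cpow_dweight l N k0 k1 hk Y0) _; apply: lerXn2r; rewrite ?nnegrE//.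
      exact: divr_ge0 (S0 N) (ltW k0).
    by rewrite ler_pM2r ?invr_gt0.
  by move: hS IH YM eg; rewrite /dweight; lra.
have tom m : 2 ^+ m <= dweight m / kap.
  by rewrite /dweight ler_pdivlMr// ler_wpM2l ?exprn_ge0.
split=> [N|l N lD].
  apply: (@le_trans _ _ (S N / kap)); last by rewrite ler_pM2r ?invr_gt0.
  rewrite /S mulr_suml; apply: ler_sum => m _; rewrite mulrAC ler_wpM2r//.
apply: (@le_trans _ _ ((\sum_(0 <= m < N) dweight m * cpow Y l m) / kap)).
  by rewrite mulr_suml; apply: ler_sum => m _; rewrite mulrAC ler_wpM2r// cpow_ge0.
rewrite ler_pM2r ?invr_gt0//; apply: le_trans (cpow_dweight l N k0 k1 hk Y0) _.
apply: (@le_trans _ _ ((4 * M / kap) ^+ l)).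
  apply: lerXn2r; rewrite ?nnegrE//; first exact: divr_ge0 (S0 N) (ltW k0).
  by rewrite ler_pM2r ?invr_gt0//; exact: SM.
have lm : l \in index_iota 0 D.+1 by rewrite mem_index_iota /= ltnS.
rewrite (bigD1_seq l lm (iota_uniq _ _)) /= lerDl.
by apply: sumr_ge0 => j _; rewrite exprn_ge0.
Qed.

End scalar_majorant.

(** * Norms over words of a fixed length *)

Section esum_tools.
Variable R : realType.
Implicit Types (T : choiceType).

Lemma esum_pt T (a : T) (v : R) : 0 <= v ->
  (\esum_(x in [set: T]) (if x == a then v else 0)%:E = v%:E)%E.
Proof.
move=> v0; rewrite (@esum_supp _ unit T (fun=> a)).
- rewrite (_ : [set: unit] = [set tt]); last by apply/seteqP; split => -[].
  by rewrite esum_set1 eqxx// lee_fin.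
- by case; case.
- by move=> y /(_ tt); case: eqP => // ->.
Qed.

Lemma esum_sumr T (I : Type) (r : seq I) (f : I -> T -> R) :
  (forall i x, 0 <= f i x) ->
  (\esum_(x in [set: T]) (\sum_(i <- r) f i x)%:E =
   \sum_(i <- r) \esum_(x in [set: T]) (f i x)%:E)%E.
Proof.
move=> f0; elim: r => [|i r IH].
  by rewrite big_nil esum1// => x _; rewrite big_nil.
rewrite big_cons -IH -esumD; try (move=> x _; rewrite lee_fin//).
  by apply: eq_esum => x _; rewrite big_cons EFinD.
by apply: sumr_ge0 => j _.
Qed.

Lemma esum_seq T (r : seq T) (f : T -> R) : uniq r -> (forall x, 0 <= f x) ->
  (forall x, x \notin r -> f x = 0) ->
  (\esum_(x in [set: T]) (f x)%:E = (\sum_(x <- r) f x)%:E)%E.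
Proof.
move=> ur f0 fr.
have -> : (\esum_(x in [set: T]) (f x)%:E =
   \esum_(x in [set: T]) (\sum_(a <- r) (if x == a then f a else 0))%:E)%E.
  apply: eq_esum => x _; congr EFin; case: (boolP (x \in r)) => xr.
    rewrite (bigD1_seq x)//= eqxx big1 ?addr0// => i; rewrite eq_sym => /negbTE ->//.
  rewrite fr// big_seq big1// => i ir; case: eqP => // xi; by rewrite xi ir in xr.
rewrite esum_sumr; last by move=> i x; case: ifP.
by rewrite -sumEFin; apply: eq_bigr => i _; rewrite esum_pt.
Qed.

Lemma esum_leZ T (c : R) (f g : T -> R) (b : R) : 0 <= c -> (forall x, 0 <= g x) ->
  (forall x, f x <= c * g x) -> (\esum_(x in [set: T]) (g x)%:E <= b%:E)%E ->
  (\esum_(x in [set: T]) (f x)%:E <= (c * b)%:E)%E.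
Proof.
move=> c0 g0 fg gb; apply: (@le_trans _ _ (\esum_(x in [set: T]) (c * g x)%:E)%E).
  by apply: le_esum => x _; rewrite lee_fin.
by rewrite esumZ// EFinM lee_wpmul2l// lee_fin.
Qed.

End esum_tools.

Section words.
Variables (R : realType) (nonneg : bool) (d : nat).
Local Notation Z := (mode nonneg d).
Local Notation C := R[i].
Local Notation nc := (@Normc.normc R).

Lemma cons_inj2 : injective (fun p : Z * seq Z => p.1 :: p.2).
Proof. by move=> [a b] [c e] /= [-> ->]. Qed.

(** Words of length l+1 are pairs of a letter and a word of length l. *)
Lemma esum_words_cons (l : nat) (g : seq Z -> R) : (forall y, 0 <= g y) ->
  (\esum_(y in [set: seq Z]) (if size y == l.+1 then g y else 0)%:E =
   \esum_(c in [set: Z]) \esum_(y in [set: seq Z]) (if size y == l then g (c :: y) else 0)%:E)%E.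
Proof.
move=> g0; rewrite (@esum_supp _ _ _ (fun p : Z * seq Z => p.1 :: p.2)).
- rewrite -(@tonelli R Z (seq Z) (fun c y => (if size y == l then g (c :: y) else 0)%:E)) => [|c y].
    by apply: eq_esum => -[c y] _.
  by rewrite lee_fin; case: ifP.
- exact: cons_inj2.
- case=> // c y h; by have := h (c, y).
Qed.

Variables (s : R) (hs : 0 <= s).
Local Notation wt := (@wt R nonneg d s).
Local Notation wtw := (@wtw R nonneg d s).

Definition words_norm (l : nat) (ze : seq Z -> C) : \bar R :=
  \esum_(y in [set: seq Z]) (if size y == l then wtw y * nc (ze y) else 0)%:E.

(** The coefficient of order m of the product, over the letters of y, of the
    series with coefficients u. *)
Fixpoint prod_coef (u : nat -> Z -> C) (y : seq Z) (m : nat) : C :=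
  if y is c :: y' then \sum_(0 <= i < m.+1) u i c * prod_coef u y' (m - i) else (m == 0%N)%:R.

Lemma prod_coef_ext u v y m : (forall i, (i <= m)%N -> u i = v i) -> prod_coef u y m = prod_coef v y m.
Proof.
elim: y m => [|c y IH] m h //=; rewrite big_nat [RHS]big_nat; apply: eq_bigr => i /andP[_ im].
rewrite h//; congr (_ * _); apply: IH => j jm; apply: h.
by rewrite (leq_trans jm)// leq_subr.
Qed.

(** The l^1_s norm is multiplicative on products over words, so the
    coefficients are dominated by those of a power of the scalar series. *)
Lemma prod_coef_norm u (Y : nat -> R) l m : (forall i, 0 <= Y i) ->
  (forall i, (i <= m)%N -> (l1norm s (u i) <= (Y i)%:E)%E) ->
  forall j, (j <= m)%N -> (words_norm l (fun y => prod_coef u y j) <= (cpow Y l j)%:E)%E.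
Proof.
move=> Y0; elim: l => [|l IH] hu j jm.
  rewrite /words_norm (_ : (fun y : seq Z => _) = fun y => (if y == [::] then (j == 0%N)%:R else 0 : R)%:E).
    by rewrite esum_pt.
  apply/funext => y; rewrite size_eq0; case: eqP => // ->.
  by rewrite wtw_nil mul1r nc_nat.
have wy0 y : 0 <= wtw y by exact: wtw_ge0.
have w0 c : 0 <= wt c by exact: wt_ge0.
rewrite /words_norm esum_words_cons; last by move=> y; rewrite mulr_ge0// nc_ge0.
pose F i c y : R := (wt c * nc (u i c)) * (if size y == l then wtw y * nc (prod_coef u y (j - i)) else 0).
have F0 i c y : 0 <= F i c y.
  by rewrite /F; case: ifP => _; rewrite ?mulr0// !mulr_ge0// nc_ge0.
apply: (@le_trans _ _ (\esum_(c in [set: Z]) \esum_(y in [set: seq Z])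
     (\sum_(0 <= i < j.+1) F i c y)%:E)%E).
  apply: le_esum => c _; apply: le_esum => y _; rewrite lee_fin; case: ifPn => sy; last first.
    by apply: sumr_ge0 => i _.
  rewrite /= wtw_cons.
  apply: (@le_trans _ _ (wt c * wtw y * \sum_(0 <= i < j.+1) nc (u i c * prod_coef u y (j - i)))).
    by rewrite ler_wpM2l ?mulr_ge0//; exact: nc_sum.
  rewrite big_distrr /=; apply: ler_sum => i _; rewrite /F sy Normc.normcM.
  by rewrite le_eqVlt; apply/orP; left; apply/eqP; ring.
have -> : (\esum_(c in [set: Z]) \esum_(y in [set: seq Z]) (\sum_(0 <= i < j.+1) F i c y)%:E =
   \sum_(0 <= i < j.+1) \esum_(c in [set: Z]) \esum_(y in [set: seq Z]) (F i c y)%:E)%E.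
  rewrite -(@tonelli R Z (seq Z) (fun c y => (\sum_(0 <= i < j.+1) F i c y)%:E)); last first.
    by move=> c y; rewrite lee_fin sumr_ge0.
  rewrite (esum_sumr _ (f := fun i (p : Z * seq Z) => F i p.1 p.2))//.
  apply: eq_bigr => i _; rewrite (@tonelli R Z (seq Z) (fun c y => (F i c y)%:E))//.
  by move=> c y; rewrite lee_fin.
rewrite [cpow _ _ _]/= -sumEFin big_nat [leRHS]big_nat; apply: lee_sum => i /andP[_ ij].
have ijm : (j - i <= m)%N by rewrite (leq_trans (leq_subr _ _)).
apply: (@le_trans _ _ (\esum_(c in [set: Z]) ((cpow Y l (j - i)) * (wt c * nc (u i c)))%:E)%E).
  apply: le_esum => c _; rewrite /F esumZ//; last 2 first.
  - by rewrite mulr_ge0// nc_ge0.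
  - by move=> y; case: ifP => _ //; rewrite mulr_ge0// nc_ge0.
  rewrite [X in (_ <= X%:E)%E]mulrC [in leRHS]EFinM; apply: lee_wpmul2l; first by rewrite lee_fin mulr_ge0// nc_ge0.
  exact: IH.
rewrite esumZ ?cpow_ge0//; last by move=> c; rewrite mulr_ge0// nc_ge0.
rewrite [Y i * _]mulrC EFinM; apply: lee_wpmul2l; first by rewrite lee_fin cpow_ge0.
by apply: hu; rewrite (leq_trans _ jm).
Qed.

End words.

(** * The Taylor coefficients of a flow *)

Section power_series.
Variables (R : realType) (nonneg : bool) (d : nat).
Local Notation Z := (mode nonneg d).
Local Notation C := R[i].
Local Notation nc := (@Normc.normc R).
Variables (s : R) (hs : 0 <= s).
Local Notation wt := (@wt R nonneg d s).
Local Notation wtw := (@wtw R nonneg d s).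
Local Notation words_norm := (@words_norm R nonneg d s).
Variables (X : Z -> seq Z -> C) (D : nat) (Lam e : R).

(** The diagonal linear part is only bounded by Lam, while everything else
    is small.  The two are separated because Lam does not tend to zero with
    the step size. *)
Definition field_ok : Prop :=
  (forall k y, X k y != 0 -> mom1 k = momentum y /\ (1 <= size y <= D)%N) /\
  forall k y, nc (X k y) <= (if y == [:: k] then Lam else 0) + e.

(** Exchange the sums over k and y: for each word y there are at most two
    letters k, and [wt_word] bounds their weights. *)
Lemma field_words_norm (ze : seq Z -> C) (b : nat -> R) :
  field_ok -> (0 < D)%N -> 0 <= Lam -> 0 <= e ->
  (forall l, (l <= D)%N -> (words_norm l ze <= (b l)%:E)%E) ->
  (\esum_(k in [set: Z]) \esum_(y in [set: seq Z]) (wt k * (nc (X k y) * nc (ze y)))%:E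
   <= (Lam * b 1%N + 2 * e * W1 s ^+ D * \sum_(1 <= l < D.+1) b l)%:E)%E.
Proof.
move=> [Xs Xb] D0 Lam0 e0 hb.
have w0 k : 0 <= wt k by exact: wt_ge0.
have ww0 y : 0 <= wtw y by exact: wtw_ge0.
have W11 : 1 <= W1 s := W1_ge1 hs.
have W10 : 0 <= W1 s by apply: le_trans W11.
set e2 := 2 * e * W1 s ^+ D.
have e20 : 0 <= e2 by rewrite /e2 !mulr_ge0// exprn_ge0.
rewrite tonelliC; last by move=> k y; rewrite lee_fin mulr_ge0// mulr_ge0// nc_ge0.
pose g l y := if size y == l then wtw y * nc (ze y) else 0.
have g0 l y : 0 <= g l y by rewrite /g; case: ifP => _ //; rewrite mulr_ge0// nc_ge0.
apply: (@le_trans _ _ (\esum_(y in [set: seq Z]) ((Lam * g 1%N y)%:E + (\sum_(1 <= l < D.+1) e2 * g l y)%:E))%E).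
  apply: le_esum => y _.
  rewrite (@esum_seq _ _ (cand nonneg (momentum y))); last 3 first.
  - exact: uniq_cand.
  - by move=> k; rewrite mulr_ge0// mulr_ge0// nc_ge0.
  - move=> k; rewrite mem_cand => ky; have [->|/Xs[ky' _]] := eqVneq (X k y) 0.
      by rewrite Normc.normc0 mul0r mulr0.
    by rewrite ky' eqxx in ky.
  rewrite -EFinD lee_fin.
  have [yD|yD] := boolP (1 <= size y <= D)%N; last first.
    rewrite big1 => [|k _].
      by rewrite addr_ge0 ?mulr_ge0//; apply: sumr_ge0 => l _; rewrite mulr_ge0.
    have [->|/Xs[_ h]] := eqVneq (X k y) 0; first by rewrite Normc.normc0 mul0r mulr0.
    by rewrite h in yD.
  case/andP: yD => y1 yD.
  have gy : g (size y) y = wtw y * nc (ze y) by rewrite /g eqxx.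
  have -> : \sum_(1 <= l < D.+1) e2 * g l y = e2 * (wtw y * nc (ze y)).
    have my : size y \in index_iota 1 D.+1 by rewrite mem_index_iota y1.
    rewrite (bigD1_seq (size y) my (iota_uniq _ _)) /= gy big1 ?addr0// => l ly.
    by rewrite /g eq_sym (negbTE ly) mulr0.
  have key k : k \in cand nonneg (momentum y) ->
     wt k * (nc (X k y) * nc (ze y)) <=
     (if y == [:: k] then Lam * wt k * nc (ze y) else 0) + e * W1 s ^+ D * (wtw y * nc (ze y)).
    rewrite mem_cand => /eqP ky; have wk := wt_word hs ky.
    have hW : W1 s ^+ size y <= W1 s ^+ D by rewrite ler_weXn2l.
    have wk2 : wt k <= W1 s ^+ D * wtw y by apply: le_trans wk _; rewrite ler_wpM2r.
    have n0 := nc_ge0 (ze y); have := Xb k y; case: ifP => _ hX.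
      apply: (@le_trans _ _ (wt k * ((Lam + e) * nc (ze y)))).
        by rewrite ler_wpM2l// ler_wpM2r.
      rewrite mulrDl mulrDr; apply: lerD; first by rewrite mulrCA mulrA.
      rewrite mulrCA -mulrA ler_wpM2l// mulrA ler_wpM2r//.
    rewrite add0r in hX; rewrite add0r.
    apply: (@le_trans _ _ (wt k * (e * nc (ze y)))); first by rewrite ler_wpM2l// ler_wpM2r.
    by rewrite mulrCA -mulrA ler_wpM2l// mulrA ler_wpM2r.
  rewrite big_seq; apply: le_trans (ler_sum _ key) _.
  rewrite -big_seq big_split /=; apply: lerD.
    rewrite /g; case: (y) y1 => [//|c [|c' y']] _; last first.
      by rewrite big1 ?mulr0// => k _; rewrite eqseq_cons andbF.
    rewrite /= wtw_cons wtw_nil mulr1 mulrA.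
    have [cc|cc] := boolP (c \in cand nonneg (momentum [:: c])); last first.
      rewrite mem_cand mom_cons mom_nil addr0 eqxx in cc; by [].
    rewrite (bigD1_seq c cc (uniq_cand _ _)) /= eqxx big1 ?addr0// => k /negbTE kc.
    by rewrite eqseq_cons andbT eq_sym kc.
  have x0 : 0 <= e * W1 s ^+ D * (wtw y * nc (ze y)).
    by rewrite !mulr_ge0// ?exprn_ge0// nc_ge0.
  rewrite big_const_seq count_predT iter_addr_0.
  have -> : e2 * (wtw y * nc (ze y)) = 2%:R * (e * W1 s ^+ D * (wtw y * nc (ze y))).
    by rewrite /e2 -!mulrA.
  by rewrite -[_ *+ size _]mulr_natl ler_wpM2r// ler_nat size_cand.
rewrite esumD; last 2 first.
- by move=> y _; rewrite lee_fin mulr_ge0.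
- by move=> y _; rewrite lee_fin sumr_ge0// => l _; rewrite mulr_ge0.
rewrite EFinD; apply: leeD.
  by rewrite esumZ// [leRHS]EFinM; apply: lee_wpmul2l; rewrite ?lee_fin//; exact: hb.
rewrite (esum_sumr _ (f := fun l y => e2 * g l y)); last by move=> l y; rewrite mulr_ge0.
rewrite big_distrr /= -sumEFin big_nat [leRHS]big_nat; apply: lee_sum => l /andP[l1 lD].
rewrite esumZ// [leRHS]EFinM; apply: lee_wpmul2l; first by rewrite lee_fin.
by apply: hb; rewrite -ltnS.
Qed.

Variable (z : Z -> C).

(** The coefficients of the solution of z-dot = X(z), defined by recursion
    on the order.  The extra argument N makes the recursion structural; the
    values do not depend on it once N >= m. *)
Fixpoint picard (N : nat) : nat -> Z -> C :=
  if N is N'.+1 then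
    fun m k => if m is m'.+1 then
       csum [set: seq Z] (fun y => X k y * prod_coef (picard N') y m') / m%:R else z k
  else fun m k => if m is 0%N then z k else 0.

Definition taylor (m : nat) : Z -> C := picard m m.

Lemma picard_stable N m : (m <= N)%N -> picard N m = taylor m.
Proof.
move=> mN; rewrite /taylor -(subnK mN); elim: (N - m)%N => [|j IH]; first by [].
rewrite -IH addSn; move: (j + m)%N (leq_addl j m) => {IH mN}; clear j N => N.
elim: N m => [|N IH] m; first by rewrite leqn0 => /eqP ->.
case: m => [|m] mN; first by [].
apply/funext => k /=; congr (csum _ _ / _); apply/funext => y; congr (_ * _).
by apply: prod_coef_ext => i im; apply: IH; rewrite (leq_trans im).
Qed.

Lemma taylor0 : taylor 0 = z. Proof. by []. Qed.

Lemma taylorS m k : taylor m.+1 k = csum [set: seq Z] (fun y => X k y * prod_coef taylor y m) / m.+1%:R.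
Proof.
rewrite /taylor /=; congr (csum _ _ / _); apply/funext => y; congr (_ * _).
by apply: prod_coef_ext => i im; apply: picard_stable.
Qed.

Definition taylor_norm m : R := fine (l1norm s (taylor m)).

Lemma taylor_norm_ge0 m : 0 <= taylor_norm m.
Proof. by apply: fine_ge0; apply: esum_ge0 => k _; rewrite lee_fin mulr_ge0// ?nc_ge0//; exact: wt_ge0. Qed.

Hypotheses (okX : field_ok) (D0 : (0 < D)%N) (Lam0 : 0 <= Lam) (e0 : 0 <= e).
Hypothesis zfin : (l1norm s z < +oo)%E.

Lemma l1norm_ge0 (f : Z -> C) : (0 <= l1norm s f)%E.
Proof. by apply: esum_ge0 => k _; rewrite lee_fin mulr_ge0// ?nc_ge0//; exact: wt_ge0. Qed.

Lemma l1norm_nsum (f : Z -> C) : (nsum f <= l1norm s f)%E.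
Proof.
apply: le_esum => k _; rewrite lee_fin -[leLHS]mul1r ler_wpM2r ?nc_ge0//.
exact: wt_ge1.
Qed.

Lemma X_row_isum (ze : seq Z -> C) (b : nat -> R) k :
  (forall l, (l <= D)%N -> (words_norm l ze <= (b l)%:E)%E) ->
  isum (fun y => X k y * ze y) (csum [set: seq Z] (fun y => X k y * ze y)).
Proof.
move=> hb; apply: isum_csum; have := field_words_norm okX D0 Lam0 e0 hb.
have w0 c : 0 <= wt c by exact: wt_ge0.
move=> h; have {h} := le_lt_trans h (ltry _).
apply: le_lt_trans.
rewrite (esumID [set k])//; last first.
  move=> c _; apply: esum_ge0 => y _; rewrite lee_fin mulr_ge0// mulr_ge0// nc_ge0//.
rewrite setTI esum_set1; last first.
  by apply: esum_ge0 => y _; rewrite lee_fin mulr_ge0// mulr_ge0// nc_ge0.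
apply: (@le_trans _ _ (\esum_(y in [set: seq Z]) (wt k * (nc (X k y) * nc (ze y)))%:E)%E).
  apply: le_esum => y _; rewrite lee_fin Normc.normcM -[leLHS]mul1r ler_wpM2r ?mulr_ge0 ?nc_ge0//.
  exact: wt_ge1.
rewrite leeDl//; apply: esum_ge0 => c _; apply: esum_ge0 => y _.
by rewrite lee_fin mulr_ge0// mulr_ge0// nc_ge0.
Qed.

Definition fieldat (Y : Z -> seq Z -> C) (ze : seq Z -> C) (k : Z) : C :=
  csum [set: seq Z] (fun y => Y k y * ze y).

Lemma X_rows_norm (ze : seq Z -> C) (b : nat -> R) :
  (forall l, (l <= D)%N -> (words_norm l ze <= (b l)%:E)%E) ->
  (l1norm s (fieldat X ze) <=
   (Lam * b 1%N + 2 * e * W1 s ^+ D * \sum_(1 <= l < D.+1) b l)%:E)%E.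
Proof.
move=> hb; apply: le_trans (field_words_norm okX D0 Lam0 e0 hb).
have w0 c : 0 <= wt c by exact: wt_ge0.
apply: le_esum => k _; have h := X_row_isum k hb.
have /isum_le h2 := h; case: h => fin _.
pose g y := X k y * ze y.
apply: (@le_trans _ _ ((wt k)%:E * nsum g)%E).
  change ((wt k)%:E * (nc (fieldat X ze k))%:E <= (wt k)%:E * nsum g)%E.
  by apply: lee_wpmul2l; [rewrite lee_fin|exact: h2].
rewrite /nsum -esumZ//; last by move=> y; rewrite nc_ge0.
by apply: le_esum => y _; rewrite Normc.normcM.
Qed.

Lemma taylor_fin m : (l1norm s (taylor m) < +oo)%E.
Proof.
have [N mN] := ubnP m; elim: N m mN => // N IH [|m] mN; first by rewrite taylor0.
have hb l : (l <= D)%N -> (words_norm l (fun y => prod_coef taylor y m) <= (cpow taylor_norm l m)%:E)%E.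
  move=> _; apply: (@prod_coef_norm _ _ _ s hs taylor taylor_norm l m) => // [i|i im]; first exact: taylor_norm_ge0.
  rewrite /taylor_norm fineK// ge0_fin_numE ?l1norm_ge0//; apply: IH.
  by rewrite (leq_ltn_trans im).
apply: le_lt_trans (ltry ((m.+1%:R)^-1 * (Lam * cpow taylor_norm 1 m + 2 * e * W1 s ^+ D * \sum_(1 <= l < D.+1) cpow taylor_norm l m))).
apply: (@esum_leZ _ _ _ _ (fun k => wt k * nc (csum [set: seq Z] (fun y => X k y * prod_coef taylor y m)))).
- by rewrite invr_ge0.
- by move=> k; apply: mulr_ge0; [exact: wt_ge0|exact: nc_ge0].
- by move=> k; rewrite taylorS nc_div [_ / _]mulrC mulrCA; exact: lexx.
exact: (X_rows_norm hb).
Qed.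

Lemma taylor_normE m : l1norm s (taylor m) = (taylor_norm m)%:E.
Proof. by rewrite /taylor_norm fineK// ge0_fin_numE ?l1norm_ge0// taylor_fin. Qed.

Lemma prod_coef_bound l m : (words_norm l (fun y => prod_coef taylor y m) <= (cpow taylor_norm l m)%:E)%E.
Proof. by apply: (@prod_coef_norm _ _ _ s hs taylor taylor_norm l m) => // [i|i im]; rewrite ?taylor_norm_ge0 ?taylor_normE. Qed.

Lemma taylor_rec m k : isum (fun y => X k y * prod_coef taylor y m) (m.+1%:R * taylor m.+1 k).
Proof.
have := X_row_isum k (fun l _ => prod_coef_bound l m); rewrite taylorS mulrC divfK//.
Qed.

(** The scalar recursion to which [scalar_bound] applies. *)
Lemma taylor_norm_rec m : m.+1%:R * taylor_norm m.+1 <=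
  Lam * taylor_norm m + 2 * e * W1 s ^+ D * \sum_(1 <= l < D.+1) cpow taylor_norm l m.
Proof.
have h := X_rows_norm (b := fun l => cpow taylor_norm l m) (fun l _ => prod_coef_bound l m).
rewrite cpow1 in h; rewrite -lee_fin EFinM -taylor_normE; apply: le_trans h.
rewrite /l1norm -esumZ//; last by move=> k; apply: mulr_ge0; [exact: wt_ge0|exact: nc_ge0].
apply: le_esum => k _; rewrite lee_fin taylorS nc_div mulrCA [m.+1%:R * _]mulrC divfK ?pnatr_eq0//.

Qed.

End power_series.

(** * The flow as a power series in time *)

Section cauchy.
Variables (R : realType) (nonneg : bool) (d : nat).
Local Notation Z := (mode nonneg d).
Local Notation C := R[i].
Local Notation nc := (@Normc.normc R).

(** The pairs (i, j) are reindexed by (i + j, i). *)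
Lemma isum_cauchy (f g : nat -> C) a b : isum f a -> isum g b ->
  isum (fun m => \sum_(0 <= i < m.+1) f i * g (m - i)%N) (a * b).
Proof.
move=> hf hg; pose h (p : nat * nat) := ((p.1 + p.2)%N, p.1).
pose F (m i : nat) : C := if (i <= m)%N then f i * g (m - i)%N else 0.
have hi : injective h by move=> [i j] [i' j'] [E ii]; move: E; rewrite ii => /addnI ->.
apply: (isum_pairI (F := F)); last first.
  move=> m; rewrite /index_iota subn0.
  have -> : \sum_(i <- iota 0 m.+1) f i * g (m - i)%N = \sum_(i <- iota 0 m.+1) F m i.
    by rewrite big_seq [RHS]big_seq; apply: eq_bigr => i; rewrite mem_iota ltnS /F => /andP[_ ->].
  apply: isum_seq; first exact: iota_uniq.
  by move=> i; rewrite mem_iota ltnS /F => /= /negbTE ->.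
apply/(isum_reindex (h := h) (f := fun p : nat * nat => F p.1 p.2)) => //.
  move=> [m i] H; rewrite /F /=; case: ifP => // im; exfalso.
  by apply: (H (i, (m - i)%N)); rewrite /h /= subnKC.
apply: isum_eq (isum_mul hf hg) _ => -[i j].
by rewrite /F /= leq_addr addKn.
Qed.

Lemma prod_coef_scale (u : nat -> Z -> C) (c : C) y m :
  prod_coef (fun i k => c ^+ i * u i k) y m = c ^+ m * prod_coef u y m.
Proof.
elim: y m => [|k y IH] m /=; first by case: m => [|m] /=; rewrite ?expr0 ?mulr1 ?mulr0.
rewrite big_distrr /= big_nat [RHS]big_nat; apply: eq_bigr => i /andP[_ im].
by rewrite IH mulrACA -exprD subnKC.
Qed.

Lemma prod_coef_isum (u : nat -> Z -> C) (V : Z -> C) :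
  (forall k, isum (fun m => u m k) (V k)) ->
  forall y, isum (fun m => prod_coef u y m) (monomial y V).
Proof.
move=> h; elim=> [|k y IH]; rewrite /monomial ?big_nil ?big_cons.
  by apply: isum_eq (isum_pt 0%N 1) _ => m /=; case: (m == 0%N).
exact: isum_cauchy.
Qed.

Variable s : R.
(** The triangle inequality for a series in l^1_s, which also yields the
    pointwise summability. *)
Lemma l1norm_csum (f : nat -> Z -> C) (b : nat -> R) (B : R) :
  0 <= s -> (forall m, (l1norm s (f m) <= (b m)%:E)%E) ->
  (forall N, \sum_(0 <= m < N) b m <= B) ->
  (forall k, isum (fun m => f m k) (csum [set: nat] (fun m => f m k))) /\
  (l1norm s (fun k => csum [set: nat] (fun m => f m k)) <= B%:E)%E.
Proof.
move=> hs hb hB.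
have w0 (k : Z) : 0 <= anorm R k.1 `^ s by exact: wt_ge0.
have wf0 (k : Z) m : 0 <= anorm R k.1 `^ s * nc (f m k) by rewrite mulr_ge0// nc_ge0.
have b0 m : 0 <= b m.
  rewrite -lee_fin; apply: le_trans (hb m); apply: esum_ge0 => k _.
  by rewrite lee_fin.
have tot : (\esum_(k in [set: Z]) \esum_(m in [set: nat]) (anorm R k.1 `^ s * nc (f m k))%:E <= B%:E)%E.
  rewrite tonelliC => [|k m]; last by rewrite lee_fin.
  apply: le_trans (esum_nat_le b0 hB); apply: le_esum => m _; exact: hb.
have rowE k : ((anorm R k.1 `^ s)%:E * nsum (fun m => f m k) =
    \esum_(m in [set: nat]) (anorm R k.1 `^ s * nc (f m k))%:E)%E.
  by rewrite esumZ// => m; exact: nc_ge0.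
have row k : (\esum_(m in [set: nat]) (anorm R k.1 `^ s * nc (f m k))%:E <= B%:E)%E.
  apply: le_trans tot; rewrite [leRHS](esumID [set k])//; last first.
    by move=> c _; apply: esum_ge0 => m _; rewrite lee_fin.
  rewrite setTI esum_set1; last by apply: esum_ge0 => m _; rewrite lee_fin.
  rewrite leeDl//; apply: esum_ge0 => c _; apply: esum_ge0 => m _.
  by rewrite lee_fin.
have sm k : isum (fun m => f m k) (csum [set: nat] (fun m => f m k)).
  apply: isum_csum; apply: le_lt_trans (ltry B); apply: le_trans (row k).
  rewrite -rowE -[leLHS]mul1e; apply: lee_wpmul2r; first exact: nsum_ge0.
  by rewrite lee_fin; apply: wt_ge1.
split=> //; apply: le_trans tot; apply: le_esum => k _; rewrite -rowE.
by rewrite EFinM; apply: lee_wpmul2l; [rewrite lee_fin|exact: isum_le (sm k)].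
Qed.

(** A crude second-order Taylor estimate on [0,1]; the factor 2^m, easily
    obtained by induction on m, is absorbed in the weights of the Taylor
    coefficients. *)
Lemma pow_taylor2 (t t' : R) m : 0 <= t <= 1 -> 0 <= t' <= 1 ->
  `|t' ^+ m - t ^+ m - m%:R * t ^+ m.-1 * (t' - t)| <= 2 ^+ m * (t' - t) ^+ 2.
Proof.
move=> /andP[t0 t1] /andP[t'0 t'1]; elim: m => [|m IH].
  by rewrite !expr0 subrr !mul0r subrr normr0 mul1r sqr_ge0.
have -> : t' ^+ m.+1 - t ^+ m.+1 - m.+1%:R * t ^+ m.+1.-1 * (t' - t) =
   t' * (t' ^+ m - t ^+ m - m%:R * t ^+ m.-1 * (t' - t)) + m%:R * t ^+ m.-1 * (t' - t) ^+ 2.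
  case: m {IH} => [|m]; rewrite ?expr1 ?expr0 /=; first ring.
  by rewrite !exprS -[m.+2%:R]natr1 ; ring.
rewrite (le_trans (ler_normD _ _))//.
have -> : 2 ^+ m.+1 * (t' - t) ^+ 2 = 2 ^+ m * (t' - t) ^+ 2 + 2 ^+ m * (t' - t) ^+ 2 by rewrite exprS; ring.
apply: lerD.
  rewrite normrM (ger0_norm t'0) -[leRHS]mul1r; apply: ler_pM => //.
rewrite normrM [X in _ * X]ger0_norm ?sqr_ge0//; apply: ler_wpM2r; first exact: sqr_ge0.
rewrite normrM normr_nat ger0_norm ?exprn_ge0// -[leRHS]mulr1; apply: ler_pM; rewrite ?exprn_ge0//.
  by rewrite -natrX ler_nat ltnW// ltn_expl.
by rewrite exprn_ile1.
Qed.
End cauchy.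

Section ode.
Variables (R : realType) (nonneg : bool) (d : nat).
Local Notation Z := (mode nonneg d).
Local Notation C := R[i].
Local Notation nc := (@Normc.normc R).
Variables (s : R) (hs : 0 <= s).
Variables (X : Z -> seq Z -> C) (D : nat) (Lam e : R) (z : Z -> C).
Hypotheses (okX : field_ok X D Lam e) (D0 : (0 < D)%N) (Lam0 : 0 <= Lam) (e0 : 0 <= e).
Hypothesis zfin : (l1norm s z < +oo)%E.
Local Notation u := (taylor X z).
Local Notation taylor_norm := (taylor_norm s X z).
Variables (B Bp : R).
Hypothesis hB : forall N, \sum_(0 <= m < N) 2 ^+ m * taylor_norm m <= B.
Hypothesis hBp : forall l N, (l <= D)%N -> \sum_(0 <= m < N) 2 ^+ m * cpow taylor_norm l m <= Bp.

Definition taylor_sum (t : R) (k : Z) : C := csum [set: nat] (fun m => (t%:C)%C ^+ m * u m k).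

Let Yr0 m : 0 <= taylor_norm m. Proof. exact: taylor_norm_ge0. Qed.
Let cY0 l m : 0 <= cpow taylor_norm l m. Proof. exact: cpow_ge0. Qed.

Lemma nc_tpow (t : R) m : 0 <= t <= 1 -> nc ((t%:C)%C ^+ m) <= 1.
Proof. by move=> /andP[t0 t1]; rewrite nc_exp ncR// exprn_ile1. Qed.

Lemma pow2_ge1 m : 1 <= 2 ^+ m :> R.
Proof. by rewrite exprn_ege1// ler1n. Qed.

Lemma scaled_l1norm (c : nat -> C) (b : nat -> R) m : (nc (c m) <= b m) ->
  (l1norm s (fun k => c m * u m k)%R <= (b m * taylor_norm m)%:E)%E.
Proof.
move=> hc; have b0 : 0 <= b m by apply: le_trans hc; exact: nc_ge0.
apply: (@esum_leZ _ _ (b m) _ (fun k : Z => anorm R k.1 `^ s * nc (u m k))) => //.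
- by move=> k; apply: mulr_ge0; [exact: wt_ge0|exact: nc_ge0].
- move=> k; rewrite Normc.normcM mulrCA; apply: ler_pM => //; first exact: nc_ge0.
  by apply: mulr_ge0; [exact: wt_ge0|exact: nc_ge0].
by have := taylor_normE hs okX D0 Lam0 e0 zfin m; rewrite /l1norm => ->.
Qed.

Lemma taylor_sum_isum t k : 0 <= t <= 1 -> isum (fun m => (t%:C)%C ^+ m * u m k) (taylor_sum t k).
Proof.
move=> ht; have [] := @l1norm_csum R nonneg d s (fun m k => (t%:C)%C ^+ m * u m k) (fun m => 1 * taylor_norm m) B hs.
- by move=> m; apply: (@scaled_l1norm (fun m => (t%:C)%C ^+ m) (fun=> 1)); exact: nc_tpow.
- move=> N; apply: le_trans (hB N); apply: ler_sum => m _; apply: ler_wpM2r => //.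
  exact: pow2_ge1.
by move=> h _; exact: h.
Qed.

Lemma taylor_sum_norm t : 0 <= t <= 1 -> (l1norm s (taylor_sum t) <= B%:E)%E.
Proof.
move=> ht; have [] := @l1norm_csum R nonneg d s (fun m k => (t%:C)%C ^+ m * u m k) (fun m => 1 * taylor_norm m) B hs.
- by move=> m; apply: (@scaled_l1norm (fun m => (t%:C)%C ^+ m) (fun=> 1)); exact: nc_tpow.
- move=> N; apply: le_trans (hB N); apply: ler_sum => m _; apply: ler_wpM2r => //.
  exact: pow2_ge1.
by [].
Qed.

Lemma taylor_sum0 : taylor_sum 0 = z.
Proof.
apply/funext => k; have h : isum (fun m : nat => if m == 0%N then z k else 0) (z k) by exact: isum_pt.
have h2 := taylor_sum_isum k (t := 0); rewrite lexx ler01 in h2.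
apply: isum_uniq (h2 isT) _; apply: isum_eq h _ => -[|m] /=; first by rewrite expr0 mul1r.
by rewrite exprS mul0r mul0r.
Qed.

(** Substituting the power series in the field and rearranging gives the
    differentiated series; the rearrangement is licensed by the bound on the
    powers of the series of norms. *)
Lemma field_taylor_sum t k : 0 <= t <= 1 ->
  isum (fun m => m.+1%:R * (t%:C)%C ^+ m * u m.+1 k) (fieldat X (fun y => monomial y (taylor_sum t)) k).
Proof.
move=> ht; pose F (m : nat) (y : seq Z) : C := X k y * ((t%:C)%C ^+ m * prod_coef u y m).
have rows m : isum (F m) (m.+1%:R * (t%:C)%C ^+ m * u m.+1 k).
  have h := isumZ ((t%:C)%C ^+ m) (taylor_rec hs okX D0 Lam0 e0 zfin m k).
  rewrite -mulrA mulrCA; apply: isum_eq h _ => y; rewrite /F; ring.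
have cols y : isum (fun m => F m y) (X k y * monomial y (taylor_sum t)).
  apply: isumZ; apply: isum_eq (prod_coef_isum (u := fun m k => (t%:C)%C ^+ m * u m k) _ y) _.
    by move=> k'; exact: taylor_sum_isum.
  by move=> m; rewrite prod_coef_scale.
have fin : (nsum (fun p : nat * seq Z => F p.1 p.2) < +oo)%E.
  rewrite nsum_pair.
  pose b m := Lam * cpow taylor_norm 1 m + 2 * e * W1 s ^+ D * \sum_(1 <= l < D.+1) cpow taylor_norm l m.
  have b0 m : 0 <= b m.
    apply: addr_ge0; first exact: mulr_ge0.
    apply: mulr_ge0; last by apply: sumr_ge0 => l _.
    by apply: mulr_ge0; [exact: mulr_ge0|apply: exprn_ge0; apply: le_trans (W1_ge1 hs)].
  have hb N : \sum_(0 <= m < N) b m <= Lam * Bp + 2 * e * W1 s ^+ D * \sum_(1 <= l < D.+1) Bp.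
    have cB l N' : (l <= D)%N -> \sum_(0 <= m < N') cpow taylor_norm l m <= Bp.
      move=> lD; apply: le_trans (hBp N' lD); apply: ler_sum => m _.
      by rewrite -[leLHS]mul1r; apply: ler_wpM2r => //; exact: pow2_ge1.
    rewrite big_split -!mulr_sumr; apply: lerD.
      by apply: ler_wpM2l => //; exact: (cB 1%N N D0).
    apply: ler_wpM2l.
      by apply: mulr_ge0; [exact: mulr_ge0|apply: exprn_ge0; apply: le_trans (W1_ge1 hs)].
    rewrite exchange_big big_nat [leRHS]big_nat; apply: ler_sum => l /andP[_ lD].
    exact: cB.
  apply: le_lt_trans (le_trans _ (esum_nat_le b0 hb)) (ltry _).
  apply: le_esum => m _.
  have h := field_words_norm hs okX D0 Lam0 e0 (fun l _ => prod_coef_bound hs okX D0 Lam0 e0 zfin l m).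
  apply: le_trans h.
  rewrite [leRHS](esumID [set k])//; last first.
    move=> c _; apply: esum_ge0 => y _; rewrite lee_fin; apply: mulr_ge0; first exact: wt_ge0.
    by rewrite mulr_ge0// nc_ge0.
  rewrite setTI esum_set1; last first.
    apply: esum_ge0 => y _; rewrite lee_fin; apply: mulr_ge0; first exact: wt_ge0.
    by rewrite mulr_ge0// nc_ge0.
  rewrite -[leLHS]adde0; apply: leeD; last first.
    apply: esum_ge0 => c _; apply: esum_ge0 => y _; rewrite lee_fin; apply: mulr_ge0; first exact: wt_ge0.
    by rewrite mulr_ge0// nc_ge0.
  apply: le_esum => y _; rewrite lee_fin /F /= Normc.normcM Normc.normcM.
  rewrite -[leLHS]mul1r; apply: ler_pM => //; first by rewrite !mulr_ge0 ?nc_ge0.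
    exact: wt_ge1.
  apply: ler_wpM2l; first exact: nc_ge0.
  by rewrite -[leRHS]mul1r; apply: ler_wpM2r; [exact: nc_ge0|exact: nc_tpow].
have h1 := isum_csum fin.
have h2 := isum_pairI h1 rows.
rewrite /fieldat; have -> : csum [set: seq Z] (fun y => X k y * monomial y (taylor_sum t)) =
  csum [set: nat * seq Z] (fun p : nat * seq Z => F p.1 p.2); last exact: h2.
have hsw : isum (fun p : seq Z * nat => F p.2 p.1) (csum [set: nat * seq Z] (fun p : nat * seq Z => F p.1 p.2)).
  pose sw (p : seq Z * nat) := (p.2, p.1).
  apply/(isum_reindex (h := sw) (f := fun p : nat * seq Z => F p.1 p.2)) => //.
    by move=> [a b] [a' b'] [-> ->].
  by move=> [a b] H; case: (H (b, a)).
by have [] := isum_pairI hsw cols.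
Qed.

(** The second-order remainder of the series, which gives differentiability
    in the norm of l^1_s and not only componentwise. *)
Lemma taylor_sum_step t t' : 0 <= t <= 1 -> 0 <= t' <= 1 ->
  (l1norm s (fun k => taylor_sum t' k - taylor_sum t k -
     ((t' - t)%:C)%C * fieldat X (fun y => monomial y (taylor_sum t)) k)%R <= (B * (t' - t) ^+ 2)%:E)%E.
Proof.
move=> ht ht'.
pose c (m : nat) : C := ((t' ^+ m - t ^+ m - m%:R * t ^+ m.-1 * (t' - t))%:C)%C.
have hc m : (l1norm s (fun k => c m * u m k)%R <= (2 ^+ m * (t' - t) ^+ 2 * taylor_norm m)%:E)%E.
  by apply: (@scaled_l1norm c (fun m => 2 ^+ m * (t' - t) ^+ 2)); rewrite ncZ; exact: pow_taylor2.
have hN N : \sum_(0 <= m < N) 2 ^+ m * (t' - t) ^+ 2 * taylor_norm m <= B * (t' - t) ^+ 2.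
  rewrite [leRHS]mulrC; apply: le_trans (ler_wpM2l (sqr_ge0 _) (hB N)).
  by rewrite mulr_sumr; apply: ler_sum => m _; rewrite mulrAC [leRHS]mulrC; exact: lexx.
have [_ h] := l1norm_csum hs hc hN.
apply: le_trans h.
rewrite le_eqVlt; apply/orP; left; apply/eqP; congr (l1norm s _); apply/funext => k.
have hF := isum_shift (f := fun m => m%:R * (t%:C)%C ^+ m.-1 * u m k) (field_taylor_sum k ht).
rewrite !mul0r add0r in hF.
have hS := isumB (isumB (taylor_sum_isum k ht') (taylor_sum_isum k ht)) (isumZ ((t' - t)%:C)%C hF).
case: hS => _ <-; congr csum; apply/funext => m.
rewrite /c !rmorphB !rmorphM !rmorphXn rmorph_nat /=; ring.
Qed.
End ode.

(** * The duality between a derivation and its field *)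

Section pairing.
Variables (R : realType) (nonneg : bool) (d : nat).
Local Notation Z := (mode nonneg d).
Local Notation C := R[i].
Local Notation nc := (@Normc.normc R).
Variables (X : Z -> seq Z -> C) (D : nat) (BX : R).
Hypothesis Xsupp : forall k y, X k y != 0 -> mom1 k = momentum y /\ (size y <= D)%N.
Hypothesis Xbnd : forall k y, nc (X k y) <= BX.

(** A word of length at most M has at most (M+1)^2 decompositions in three
    factors. *)
Lemma split_summable (M : nat) (a : seq Z -> R) :
  (forall v, 0 <= a v) -> (forall v, (M < size v)%N -> a v = 0) ->
  (\esum_(v in [set: seq Z]) (a v)%:E < +oo)%E ->
  (\esum_(t in [set: seq Z * seq Z * seq Z]) (a (t.1.1 ++ t.1.2 ++ t.2))%:E < +oo)%E.
Proof.
move=> a0 aM afin.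
pose h (t : seq Z * seq Z * seq Z) := (t.1.1 ++ t.1.2 ++ t.2, (size t.1.1, size t.1.2)).
pose b (p : seq Z * (nat * nat)) : R :=
  if (p.2.1 + p.2.2 <= size p.1)%N then a p.1 else 0.
have b0 p : 0 <= b p by rewrite /b; case: ifP.
have hinj : injective h.
  move=> [[x y] z] [[x' y'] z'] [] E sx sy.
  have := congr1 (take (size x)) E; rewrite take_size_cat// sx take_size_cat// => xx.
  have := congr1 (drop (size x)) E; rewrite drop_size_cat// sx drop_size_cat// => E2.
  have := congr1 (take (size y)) E2; rewrite take_size_cat// sy take_size_cat// => yy.
  have := congr1 (drop (size y)) E2; rewrite drop_size_cat// sy drop_size_cat// => zz.
  by rewrite xx yy zz.
have bout p : (forall t, h t <> p) -> (b p)%:E = 0%E.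
  move: p => [v [i j]] H; rewrite /b /=; case: ifP => // ij; exfalso.
  apply: (H ((take i v, take j (drop i v)), drop j (drop i v))).
  rewrite /h /= cat_take_drop cat_take_drop !size_take_min size_drop.
  by congr (_, (_, _)); lia.
have -> : \esum_(t in [set: seq Z * seq Z * seq Z]) (a (t.1.1 ++ t.1.2 ++ t.2))%:E =
   \esum_(p in [set: seq Z * (nat * nat)]) (b p)%:E.
  rewrite (esum_supp (h := h))//; apply: eq_esum => -[[x y] z] _ /=.
  by rewrite /b /= !size_cat addnA leq_addr.
rewrite (tonelli (F := fun v ij => (b (v, ij))%:E)) => [|v ij]; last by rewrite lee_fin.
apply: (@le_lt_trans _ _ (\esum_(v in [set: seq Z]) ((M.+1 * M.+1)%:R * a v)%:E)%E); last first.
  by rewrite esumZ// lte_mul_pinfty// lee_fin.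
apply: le_esum => v _.
rewrite (@esum_seq _ _ [seq (i, j) | i <- iota 0 M.+1, j <- iota 0 M.+1]); last 3 first.
- by apply: allpairs_uniq; rewrite ?iota_uniq// => -[i j] [i' j'].
- by move=> ij.
- move=> [i j] ijM; rewrite /b /=; case: ifP => // ij.
  have [vM|vM] := ltnP M (size v); first exact: aM.
  case/negP: ijM; apply: allpairs_f; rewrite mem_iota /= add0n ltnS; apply: leq_trans vM; apply: leq_trans ij; rewrite ?leq_addr ?leq_addl//.
rewrite lee_fin; apply: (@le_trans _ _ (\sum_(ij <- [seq (i, j) | i <- iota 0 M.+1, j <- iota 0 M.+1]) a v)).
  by apply: ler_sum => ij _; rewrite /b; case: ifP.
by rewrite big_const_seq count_predT iter_addr_0 size_allpairs !size_iota mulr_natl.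
Qed.

Variables (f ze : seq Z -> C) (N : nat) (F : R) (Dk : seq Z -> Z -> seq Z -> C).
Hypothesis fbnd : forall w, nc (f w) <= F.
Hypothesis fsupp : forall w, (N < size w)%N -> f w = 0.
Hypothesis zfin : (\esum_(v in [set: seq Z]) (if (size v <= N + D)%N then nc (ze v) else 0)%:E < +oo)%E.
Hypothesis HD : forall x k z, isum (fun y => X k y * ze (x ++ y ++ z)) (Dk x k z).

Let G (q : (seq Z * seq Z * seq Z) * Z) : C :=
  X q.2 q.1.1.2 * f (q.1.1.1 ++ q.2 :: q.1.2) * ze (q.1.1.1 ++ q.1.1.2 ++ q.1.2).

Let F0 : 0 <= F. Proof. exact: le_trans (nc_ge0 _) (fbnd [::]). Qed.

(** The index is a decomposition x y z of a word together with a letter k.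
    Contracting y to k, or expanding k to y, gives the two ways of reading
    the same family. *)
Lemma G_summable : (nsum G < +oo)%E.
Proof.
pose a v : R := if (size v <= N + D)%N then nc (ze v) else 0.
have a0 v : 0 <= a v by rewrite /a; case: ifP => // _; exact: nc_ge0.
have aM v : (N + D < size v)%N -> a v = 0 by rewrite /a ltnNge => /negbTE ->.
have afin := split_summable a0 aM zfin.
rewrite nsum_pair; pose a3 (t : seq Z * seq Z * seq Z) := a (t.1.1 ++ t.1.2 ++ t.2).
apply: (@le_lt_trans _ _ (\esum_(t in [set: seq Z * seq Z * seq Z]) (2 * `|BX| * F * a3 t)%:E)%E); last first.
  rewrite esumZ ?mulr_ge0// => [|t]; last exact: a0.
  by rewrite lte_mul_pinfty// ?lee_fin ?mulr_ge0.
apply: le_esum => -[[x y] z] _.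
pose g k := nc (G (x, y, z, k)).
have gb k : g k <= `|BX| * F * a3 (x, y, z).
  rewrite /g /G /a3 /a /=; set w := x ++ k :: z; set v := x ++ y ++ z.
  have [->|Xn] := eqVneq (X k y) 0.
    by rewrite !mul0r Normc.normc0 !mulr_ge0//; case: ifP => // _; exact: nc_ge0.
  have [yD|wN] : (size v <= N + D)%N \/ (N < size w)%N.
    have [_ yD] := Xsupp Xn; rewrite /v /w !size_cat /=.
    have [h|h] := leqP (size x + (size z).+1)%N N; last by right.
    left; rewrite addnCA addnC; apply: leq_add => //.
    by rewrite addnS in h; exact: ltnW.
    rewrite yD !Normc.normcM; apply: ler_wpM2r; first exact: nc_ge0.
    apply: ler_pM; [exact: nc_ge0|exact: nc_ge0| |exact: fbnd].
    exact: le_trans (Xbnd _ _) (ler_norm _).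
  rewrite (fsupp wN) mulr0 mul0r Normc.normc0 !mulr_ge0//.
  by case: ifP => // _; exact: nc_ge0.
have -> : nsum (fun k => G (x, y, z, k)) = (\sum_(k <- cand nonneg (momentum y)) g k)%:E.
  rewrite /nsum; apply: esum_seq; [exact: uniq_cand|by move=> k; exact: nc_ge0|].
  move=> k; rewrite mem_cand => ky; rewrite /G /=.
  have [->|/Xsupp[e _]] := eqVneq (X k y) 0; first by rewrite !mul0r Normc.normc0.
  by rewrite e eqxx in ky.
rewrite lee_fin; apply: le_trans (ler_sum _ (fun k _ => gb k)) _.
rewrite big_const_seq count_predT iter_addr_0 -[_ *+ size _]mulr_natl -!mulrA; apply: ler_wpM2r.
  by rewrite !mulr_ge0//; exact: a0.
by rewrite ler_nat size_cand.
Qed.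

Let S := csum [set: (seq Z * seq Z * seq Z) * Z] G.
Let GS : isum G S. Proof. exact: isum_csum G_summable. Qed.

(** Group the family by the word x y z. *)
Lemma pairing_left : isum (fun v => L X f v * ze v) S.
Proof.
pose h (q : (seq Z * seq Z * seq Z) * Z) :=
  (q.1.1.1 ++ q.1.1.2 ++ q.1.2, (size q.1.1.1, (size q.1.1.2, q.2))).
pose E v i p k : C := if (i + p <= size v)%N then
   X k (take p (drop i v)) * f (take i v ++ k :: drop (i + p) v) * ze v else 0.
pose F1 (v : seq Z) (t : nat * (nat * Z)) : C := E v t.1 t.2.1 t.2.2.
have hinj : injective h.
  move=> [[[x y] z] k] [[[x' y'] z'] k'] [] e sx sy kk.
  have := congr1 (take (size x)) e; rewrite take_size_cat// sx take_size_cat// => xx.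
  have := congr1 (drop (size x)) e; rewrite drop_size_cat// sx drop_size_cat// => e2.
  have := congr1 (take (size y)) e2; rewrite take_size_cat// sy take_size_cat// => yy.
  have := congr1 (drop (size y)) e2; rewrite drop_size_cat// sy drop_size_cat// => zz.
  by rewrite xx yy zz kk.
have tot : isum (fun p => F1 p.1 p.2) S.
  apply/(isum_reindex (h := h) (f := fun p : seq Z * (nat * (nat * Z)) => F1 p.1 p.2)) => //.
    move=> [v [i [p k]]] H; rewrite /F1 /E /=; case: ifP => // ip; exfalso.
    apply: (H ((take i v, take p (drop i v), drop p (drop i v)), k)).
    rewrite /h /= cat_take_drop cat_take_drop !size_take_min size_drop.
    by congr (_, (_, (_, _))); lia.
  apply: isum_eq GS _ => -[[[x y] z] k].
  rewrite /G /F1 /E /= !size_cat addnA leq_addr drop_size_cat// take_size_cat//.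
  by rewrite take_size_cat// catA -size_cat drop_size_cat.
apply: (isum_pairI (F := F1) tot) => v.
have [fv _] := isum_fubini tot.
have hv := isum_pairI (F := fun i (t : nat * Z) => E v i t.1 t.2) (fv v).
have [fi _] := isum_fubini (F := fun t : nat * (nat * Z) => E v t.1 t.2.1 t.2.2) (fv v).
have Erow i p : isum (E v i p) (\sum_(k <- cand nonneg (momentum (take p (drop i v)))) E v i p k).
  apply: isum_seq; first exact: uniq_cand.
  move=> k; rewrite mem_cand /E => ky; case: ifP => // _.
  have [->|/Xsupp[e _]] := eqVneq (X k (take p (drop i v))) 0; first by rewrite !mul0r.
  by rewrite e eqxx in ky.
have Epi i : isum (fun t : nat * Z => E v i t.1 t.2)
   (\sum_(p <- iota 0 (size v - i).+1) \sum_(k <- cand nonneg (momentum (take p (drop i v)))) E v i p k).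
  have h0 := fi i; rewrite /= in h0.
  have h1 := isum_pairI (F := E v i) h0 (Erow i).
  have h2 : isum (fun p => \sum_(k <- cand nonneg (momentum (take p (drop i v)))) E v i p k)
     (\sum_(p <- iota 0 (size v - i).+1) \sum_(k <- cand nonneg (momentum (take p (drop i v)))) E v i p k).
    apply: isum_seq; first exact: iota_uniq.
    move=> p; rewrite mem_iota /= add0n ltnS -ltnNge => ip; rewrite big1// => k _.
    rewrite /E ifF//; apply/negbTE; rewrite -ltnNge; move: ip.
    by move: (size v) => sv; lia.
  by rewrite (isum_uniq h2 h1).
have Ei := hv _ Epi.
have Es : isum (fun i => \sum_(p <- iota 0 (size v - i).+1) \sum_(k <- cand nonneg (momentum (take p (drop i v)))) E v i p k)
   (L X f v * ze v).
  have -> : L X f v * ze v = \sum_(i <- iota 0 (size v).+1)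
     \sum_(p <- iota 0 (size v - i).+1) \sum_(k <- cand nonneg (momentum (take p (drop i v)))) E v i p k.
    rewrite L_sumE mulr_suml [in LHS]/index_iota subn0.
    rewrite big_seq [RHS]big_seq; apply: eq_bigr => i; rewrite mem_iota add0n ltnS => /andP[_ iv].
    rewrite mulr_suml subn0.
    rewrite big_seq [RHS]big_seq; apply: eq_bigr => p; rewrite mem_iota add0n ltnS => /andP[_ pv].
    rewrite mulr_suml; apply: eq_bigr => k _; rewrite /E ifT//; move: iv pv; move: (size v) => sv; lia.
  apply: isum_seq; first exact: iota_uniq.
  move=> i; rewrite mem_iota /= add0n ltnS -ltnNge => iv; rewrite big1// => p _; rewrite big1// => k _.
  by rewrite /E ifF//; apply/negbTE; rewrite -ltnNge; move: iv; move: (size v) => sv; lia.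
by rewrite (isum_uniq Es Ei); exact: (fv v).
Qed.

(** Group the family by the word x k z. *)
Lemma pairing_right : isum (fun w => f w * \sum_(0 <= i < size w)
   (if drop i w is k :: z then Dk (take i w) k z else 0)) S.
Proof.
pose h (q : (seq Z * seq Z * seq Z) * Z) :=
  (q.1.1.1 ++ q.2 :: q.1.2, (size q.1.1.1, q.1.1.2)).
pose E w i y : C := if drop i w is k :: z then
   X k y * f w * ze (take i w ++ y ++ z) else 0.
pose F1 (v : seq Z) (t : nat * seq Z) : C := E v t.1 t.2.
have hinj : injective h.
  move=> [[[x y] z] k] [[[x' y'] z'] k'] [] e sx ->.
  have := congr1 (take (size x)) e; rewrite take_size_cat// sx take_size_cat// => xx.
  have := congr1 (drop (size x)) e; rewrite drop_size_cat// sx drop_size_cat// => -[kk zz].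
  by rewrite xx zz kk.
have tot : isum (fun p => F1 p.1 p.2) S.
  apply/(isum_reindex (h := h) (f := fun p : seq Z * (nat * seq Z) => F1 p.1 p.2)) => //.
    move=> [w [i y]] H; rewrite /F1 /E /=; case e : (drop i w) => [//|k z]; exfalso.
    have iw : (i < size w)%N by rewrite ltnNge; apply/negP => /drop_oversize; rewrite e.
    apply: (H ((take i w, y, z), k)).
    by rewrite /h /= -e cat_take_drop size_takel// ltnW.
  apply: isum_eq GS _ => -[[[x y] z] k].
  by rewrite /G /F1 /E /= drop_size_cat// take_size_cat.
apply: (isum_pairI (F := F1) tot) => w.
have [fw _] := isum_fubini tot.
have Erow i : isum (E w i) (if drop i w is k :: z then f w * Dk (take i w) k z else 0).
  rewrite /E; case: (drop i w) => [|k z]; first exact: isum0.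
  by apply: isum_eq (isumZ (f w) (HD (take i w) k z)) _ => y; rewrite mulrA [X _ _ * _]mulrC.
have h1 := isum_pairI (F := E w) (fw w) Erow.
have h2 : isum (fun i => if drop i w is k :: z then f w * Dk (take i w) k z else 0)
  (f w * \sum_(0 <= i < size w) (if drop i w is k :: z then Dk (take i w) k z else 0)).
  have -> : f w * \sum_(0 <= i < size w) (if drop i w is k :: z then Dk (take i w) k z else 0) =
     \sum_(i <- iota 0 (size w)) (if drop i w is k :: z then f w * Dk (take i w) k z else 0).
    rewrite mulr_sumr /index_iota subn0; apply: eq_bigr => i _.
    by case: (drop i w) => [|k z]; rewrite ?mulr0.
  apply: isum_seq; first exact: iota_uniq.
  by move=> i; rewrite mem_iota /= add0n -leqNgt => /drop_oversize ->.
by rewrite (isum_uniq h2 h1); exact: (fw w).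
Qed.
End pairing.

(** * Lie series *)

Section lie_series.
Variables (R : realType) (nonneg : bool) (d : nat).
Local Notation Z := (mode nonneg d).
Local Notation C := R[i].
Local Notation nc := (@Normc.normc R).

Section truncated_product.
Variables (u : nat -> Z -> C) (N : nat).

(** Truncating the series to polynomials turns the combinatorics of products
    into the ring structure of polynomials. *)
Definition upoly (k : Z) : {poly C} := \poly_(i < N) u i k.
Definition wpoly (w : seq Z) : {poly C} := \prod_(k <- w) upoly k.

Lemma wpoly_cat w v : wpoly (w ++ v) = wpoly w * wpoly v.
Proof. by rewrite /wpoly big_cat. Qed.

Lemma wpoly_coef w m : (m < N)%N -> (wpoly w)`_m = prod_coef u w m.
Proof.
elim: w m => [|k w IH] m mN; first by rewrite /wpoly big_nil coef1.
rewrite /wpoly big_cons coefM /= big_mkord; apply: eq_bigr => -[i /= im] _.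
rewrite coef_poly (leq_ltn_trans _ mN)//; congr (_ * _); apply: IH.
by rewrite (leq_ltn_trans (leq_subr _ _)).
Qed.

(** The product rule for a product of polynomials indexed by a word. *)
Lemma deriv_wpoly w : (wpoly w)^`() = \sum_(0 <= i < size w)
  (if drop i w is k :: z then wpoly (take i w) * (upoly k)^`() * wpoly z else 0).
Proof.
elim: w => [|k w IH]; first by rewrite /wpoly big_nil big_geq ?derivC.
have wnil : wpoly [::] = 1 by rewrite /wpoly big_nil.
have wcons c v : wpoly (c :: v) = upoly c * wpoly v by rewrite /wpoly big_cons.
rewrite wcons derivM IH big_nat_recl//= ?take0 ?drop0 wnil mul1r.
congr (_ + _); rewrite mulr_sumr; apply: eq_bigr => i _.
by case: (drop i w) => [|c z]; rewrite ?mulr0// wcons !mulrA.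
Qed.

(** Summing over the word that fills the slot of the letter k replaces the
    series of k by its derivative: this is the differential equation at the
    level of coefficients. *)
Lemma wpoly_slot (X : Z -> seq Z -> C) m x k z :
  (forall i, isum (fun y => X k y * prod_coef u y i) (i.+1%:R * u i.+1 k)) -> (m.+1 < N)%N ->
  isum (fun y => X k y * prod_coef u (x ++ y ++ z) m) (wpoly x * (upoly k)^`() * wpoly z)`_m.
Proof.
move=> hX mN; have mN' : (m < N)%N by exact: ltnW.
have -> : wpoly x * (upoly k)^`() * wpoly z = (upoly k)^`() * (wpoly x * wpoly z) by ring.
rewrite coefM -(big_mkord predT (fun i => ((upoly k)^`())`_i * (wpoly x * wpoly z)`_(m - i))).
have h : isum (fun y => \sum_(0 <= i < m.+1) X k y * prod_coef u y i * (wpoly x * wpoly z)`_(m - i))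
   (\sum_(0 <= i < m.+1) ((upoly k)^`())`_i * (wpoly x * wpoly z)`_(m - i)).
  apply: isum_sumn => i /andP[_ im]; apply: isumZr.
  by rewrite coef_deriv coef_poly ifT ?(leq_ltn_trans _ mN)// -mulr_natl.
apply: isum_eq h _ => y.
rewrite -(wpoly_coef _ mN') !wpoly_cat.
have -> : wpoly x * (wpoly y * wpoly z) = wpoly y * (wpoly x * wpoly z) by ring.
rewrite coefM mulr_sumr big_mkord; apply: eq_bigr => -[i /= im] _.
by rewrite -mulrA; congr (_ * (_ * _)); rewrite wpoly_coef// (leq_ltn_trans _ mN').
Qed.
End truncated_product.

Variables (s : R) (hs : 0 <= s).
Variables (X : Z -> seq Z -> C) (D : nat) (Lam e : R) (z : Z -> C).
Hypotheses (okX : field_ok X D Lam e) (D0 : (0 < D)%N) (Lam0 : 0 <= Lam) (e0 : 0 <= e).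
Hypothesis zfin : (l1norm s z < +oo)%E.
Local Notation u := (taylor X z).

Lemma prod_coef_summable N m :
  (\esum_(v in [set: seq Z]) (if (size v <= N)%N then nc (prod_coef u v m) else 0)%:E < +oo)%E.
Proof.
pose g l v : R := if size v == l then wtw s v * nc (prod_coef u v m) else 0.
have g0 l v : 0 <= g l v.
  by rewrite /g; case: ifP => // _; apply: mulr_ge0; [exact: wtw_ge0|exact: nc_ge0].
apply: (@le_lt_trans _ _ (\esum_(v in [set: seq Z]) (\sum_(0 <= l < N.+1) g l v)%:E)%E).
  apply: le_esum => v _; rewrite lee_fin; case: ifP => vN; last exact: sumr_ge0.
  have mv : size v \in index_iota 0 N.+1 by rewrite mem_index_iota.
  rewrite (bigD1_seq (size v) mv (iota_uniq _ _)) /= -[leLHS]addr0; apply: lerD.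
    rewrite /g eqxx -[leLHS]mul1r; apply: ler_wpM2r; [exact: nc_ge0|exact: wtw_ge1].
  exact: sumr_ge0.
rewrite esum_sumr//.
apply: (@le_lt_trans _ _ (\sum_(0 <= l < N.+1) (cpow (taylor_norm s X z) l m)%:E)%E).
  by apply: lee_sum => l _; exact: (prod_coef_bound hs okX D0 Lam0 e0 zfin).
by rewrite sumEFin ltry.
Qed.

(** The coordinate function z_j, as a coefficient function. *)
Definition letter (j : Z) (w : seq Z) : C := (w == [:: j])%:R.

Lemma iterL_supp j a : exists N F, [/\ 0 <= F, forall w, (N < size w)%N -> iter a (L X) (letter j) w = 0 &
  forall w, nc (iter a (L X) (letter j) w) <= F].
Proof.
have [Xs Xb] := okX.
elim: a => [|a [N [F [F0 sN bF]]]] /=.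
  exists 1%N, 1; split=> // w; first by case: w => [|c [|c' w]]//; rewrite /letter eqseq_cons andbF.
  by rewrite /letter; case: eqP => _; rewrite nc_nat.
have sL w : (N + D < size w)%N -> L X (iter a (L X) (letter j)) w = 0.
  move=> hw; apply: (L_closed (P := fun x => x = 0)) => [//|x y -> ->|x y v k xyv _]; first by rewrite addr0.
  have [->|Xn] := eqVneq (X k y) 0; first by rewrite mul0r.
  rewrite sN ?mulr0//; have [_ /andP[_ yD]] := Xs k y Xn.
  move: hw; rewrite -xyv !size_cat /=; move: yD; move: (size x) (size y) (size v) => p q r; lia.
pose B := (Lam + e) * F; have B0 : 0 <= B by rewrite mulr_ge0// addr_ge0.
exists (N + D)%N, ((2 * (N + D).+1 ^ 2)%:R * B); split=> //; first by rewrite mulr_ge0.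
move=> w; have [hw|hw] := ltnP (N + D) (size w).
  by rewrite sL// Normc.normc0 mulr_ge0.
apply: le_trans (L_bound (nu := nc) (B := B) _ _ B0 _) _; first exact: Normc.normc0.
- exact: ncD.
- move=> x y v k _ _; rewrite Normc.normcM; apply: ler_pM; rewrite ?nc_ge0//.
  by apply: le_trans (Xb k y) _; case: ifP => _; rewrite ?add0r// lerDr.
apply: ler_wpM2r => //; rewrite ler_nat leq_mul2l leq_exp2r//.
Qed.

(** Induction on a: one derivation is moved to the other side of the
    pairing, where by the product rule it becomes the derivative with
    respect to time of the product of series. *)
Lemma lie_pairing j a b :
  isum (fun w => iter a (L X) (letter j) w * prod_coef u w b) (((a + b) ^_ a)%:R * u (a + b) j).
Proof.
elim: a b => [|a IH] b.
  rewrite add0n ffactn0 mul1r; apply: isum_eq (isum_pt [:: j] (u b j)) _ => w.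
  rewrite /= /letter; case: eqP => [->|_]; last by rewrite mul0r.
  rewrite mul1r /= big_nat_recr//= subnn mulr1 big_nat big1 ?add0r// => i /andP[_ ib].
  by rewrite subn_eq0 leqNgt ib mulr0.
have [N [F [F0 fN fF]]] := iterL_supp j a; have [Xs Xb] := okX.
have hS k y : X k y != 0 -> mom1 k = momentum y /\ (size y <= D)%N.
  by move=> /Xs[-> /andP[_ ->]].
have hB k y : nc (X k y) <= Lam + e.
  by apply: le_trans (Xb k y) _; case: ifP => _; rewrite ?add0r// lerDr.
have hD x k v := @wpoly_slot u b.+2 X b x k v
  (fun i => taylor_rec hs okX D0 Lam0 e0 zfin i k) (leqnn _).
have hf := prod_coef_summable (N + D) b.
rewrite iterS.
have pl := pairing_left hS hB fF fN hf.
have pr := pairing_right hS hB fF fN hf hD.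
have key w : \sum_(0 <= i < size w) (if drop i w is k :: v then
    (wpoly u b.+2 (take i w) * (upoly u b.+2 k)^`() * wpoly u b.+2 v)`_b else 0) =
    b.+1%:R * prod_coef u w b.+1.
  rewrite -(@wpoly_coef u b.+2)// mulr_natl -coef_deriv deriv_wpoly coef_sum.
  by apply: eq_bigr => i _; case: (drop i w) => [|k v]; rewrite ?coef0.
have h := isumZ b.+1%:R (IH b.+1).
have pr2 := isum_eq pr (fun w => congr1 (fun t => _ * t) (key w)).
have E : csum [set: seq Z] (fun w => iter a.+1 (L X) (letter j) w * prod_coef u w b)
   = b.+1%:R * (((a + b.+1) ^_ a)%:R * u (a + b.+1) j).
  have [_ ->] := pl; apply: isum_uniq pr2 _; apply: isum_eq h _ => w.
  by rewrite mulrCA.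
have -> : ((a.+1 + b) ^_ a.+1)%:R * u (a.+1 + b) j = b.+1%:R * (((a + b.+1) ^_ a)%:R * u (a + b.+1) j).
  rewrite addSnnS ffactnSr addKn natrM; ring.
by rewrite -E; split=> //; have [] := pl.
Qed.

(** The flow is the exponential of the derivation, coefficient by
    coefficient. *)
Lemma lie_series_coef j m :
  isum (fun w => iter m (L X) (letter j) w * monomial w z) (m`!%:R * u m j).
Proof.
have := lie_pairing j m 0; rewrite addn0 ffactnn => /isum_eq; apply => w; congr (_ * _).
elim: w => [|k w IH] /=; first by rewrite /monomial big_nil.
by rewrite big_nat1 subnn IH /monomial big_cons.
Qed.
End lie_series.

(** * Majorants of polynomials and tails of expansions *)

Section majorant.
Variables (nonneg : bool) (d : nat).
Local Notation Z := (mode nonneg d).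

(** Positivity of all the structure constants makes the derivation monotone
    with respect to majorants. *)
Lemma L_major (A : comNzRingType) (R : realType) (nu : A -> R) (X : Z -> seq Z -> A)
  (xp : Z -> seq Z -> R) (f : seq Z -> A) (fp : seq Z -> R) v :
  nu 0 = 0 -> (forall x y, nu (x + y) <= nu x + nu y) ->
  (forall x y, nu (x * y) <= nu x * nu y) -> (forall x, 0 <= nu x) ->
  (forall k y, nu (X k y) <= xp k y) -> (forall w, nu (f w) <= fp w) ->
  nu (L X f v) <= L xp fp v.
Proof.
move=> nu0 nuD nuM nuge hX hf.
have nu_sum (I : Type) (r : seq I) (g : I -> A) : nu (\sum_(i <- r) g i) <= \sum_(i <- r) nu (g i).
  elim: r => [|i r IH]; first by rewrite !big_nil nu0.
  by rewrite !big_cons (le_trans (nuD _ _))// lerD2l.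
rewrite !L_sumE; apply: le_trans (nu_sum _ _ _) _; apply: ler_sum => i _.
apply: le_trans (nu_sum _ _ _) _; apply: ler_sum => p _.
apply: le_trans (nu_sum _ _ _) _; apply: ler_sum => k _.
by apply: le_trans (nuM _ _) _; apply: ler_pM.
Qed.
End majorant.

Section polynomial_norm.
Variable R : realType.
Local Notation C := R[i].
Local Notation nc := (@Normc.normc R).

Definition normp (x : {poly C}) : {poly R} := \poly_(i < size x) nc x`_i.
(** The polynomial with the absolute values of the coefficients, evaluated
    at T; a submultiplicative norm that dominates all the values at |h| <=
    T. *)
Definition pnorm (T : R) (x : {poly C}) : R := (normp x).[T].

Lemma coef_normp x i : (normp x)`_i = nc x`_i.
Proof.
rewrite coef_poly; case: ltnP => // h.
by rewrite nth_default// Normc.normc0.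
Qed.

Lemma horner_le (p q : {poly R}) (T T' : R) : 0 <= T -> T <= T' ->
  (forall i, 0 <= p`_i) -> (forall i, p`_i <= q`_i) -> p.[T] <= q.[T'].
Proof.
move=> T0 TT p0 h; rewrite (@horner_coef_wide _ (maxn (size p) (size q)))  ?leq_maxl//.
rewrite (@horner_coef_wide _ (maxn (size p) (size q)) q) ?leq_maxr//.
apply: ler_sum => i _; apply: ler_pM => //; first exact: exprn_ge0.
by apply: lerXn2r; rewrite ?nnegrE// (le_trans T0).
Qed.

Lemma pnorm0 T : pnorm T 0 = 0.
Proof. by rewrite /pnorm /normp size_poly0 poly_def big_ord0 horner0. Qed.

Lemma pnorm_ge0 T x : 0 <= T -> 0 <= pnorm T x.
Proof.
move=> T0; rewrite -(@horner0 _ T); apply: horner_le => // i; first by rewrite coef0.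
by rewrite coef0 coef_normp nc_ge0.
Qed.

Lemma pnormD T x y : 0 <= T -> pnorm T (x + y) <= pnorm T x + pnorm T y.
Proof.
move=> T0; rewrite /pnorm -hornerD; apply: horner_le => // i; rewrite ?coefD !coef_normp ?nc_ge0//.
by rewrite coefD ncD.
Qed.

Lemma pnormM T x y : 0 <= T -> pnorm T (x * y) <= pnorm T x * pnorm T y.
Proof.
move=> T0; rewrite /pnorm -hornerM; apply: horner_le => // i; rewrite ?coef_normp ?nc_ge0//.
rewrite !coefM (le_trans (nc_sum _ _ _))//; apply: ler_sum => j _.
by rewrite Normc.normcM !coef_normp.
Qed.

Lemma pnormC T (c : C) : pnorm T c%:P = nc c.
Proof.
have -> : pnorm T c%:P = ((nc c)%:P).[T].
  congr horner; apply/polyP => i; rewrite coef_normp !coefC; case: ifP => // _.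
  exact: Normc.normc0.
by rewrite hornerC.
Qed.

Lemma esum_pnorm T (x : {poly C}) : 0 <= T ->
  (\esum_(k in [set: nat]) (T ^+ k * nc x`_k)%:E = (pnorm T x)%:E)%E.
Proof.
move=> T0; rewrite (@esum_seq _ _ (iota 0 (size x))) ?iota_uniq//; last 2 first.
- by move=> k; rewrite mulr_ge0 ?exprn_ge0// nc_ge0.
- move=> k; rewrite mem_iota /= add0n -leqNgt => h.
  by rewrite nth_default// Normc.normc0 mulr0.
rewrite /pnorm (@horner_coef_wide _ (size x)) ?size_poly//.
rewrite -(big_mkord predT (fun i => (normp x)`_i * T ^+ i)) /index_iota subn0.
by congr EFin; apply: eq_bigr => i _; rewrite coef_normp mulrC.
Qed.

Lemma isum_horner (h : C) (x : {poly C}) : isum (fun k => h ^+ k * x`_k) x.[h].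
Proof.
rewrite horner_coef -(big_mkord predT (fun i => x`_i * h ^+ i)) /index_iota subn0.
apply: isum_eq (isum_seq (f := fun i => x`_i * h ^+ i) (iota_uniq 0 (size x)) _) _.
  move=> i; rewrite mem_iota /= add0n -leqNgt => hh.
  by rewrite nth_default// mul0r.
by move=> k; rewrite mulrC.
Qed.

Lemma nc_horner (h T : R) x : 0 <= h -> h <= T -> nc x.[(h%:C)%C] <= pnorm T x.
Proof.
move=> h0 hT; apply: (@le_trans _ _ (pnorm h x)); last first.
  by apply: horner_le => // i; rewrite coef_normp ?nc_ge0.
apply: (isum_ler (isum_horner _ _)); rewrite -esum_pnorm//.
apply: le_esum => k _; rewrite lee_fin Normc.normcM nc_exp ncR//.
Qed.
End polynomial_norm.

Section tail.
Variables (R : realType) (W : choiceType).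
Local Notation C := R[i].
Local Notation nc := (@Normc.normc R).
Variables (c : nat -> W -> nat -> C) (T0 h mu : R) (n : nat).
Hypotheses (h0 : 0 < h) (hT : h <= T0).
Let Fc (p : nat * (W * nat)) : C := (T0%:C)%C ^+ p.2.2 * c p.1 p.2.1 p.2.2.
Hypothesis cfin : (nsum Fc <= mu%:E)%E.
Variables (b : nat -> W -> C) (a : nat -> C) (V : C) (E : nat -> W -> C).
Hypothesis hb : forall m w, isum (fun k => (h%:C)%C ^+ k * c m w k) (b m w).
Hypothesis ha : forall m, isum (b m) (a m).
Hypothesis hV : isum a V.
Hypothesis hE : forall k w, (k <= n)%N -> isum (fun m => c m w k) (E k w).

Let F (p : nat * (W * nat)) : C := (h%:C)%C ^+ p.2.2 * c p.1 p.2.1 p.2.2.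
Let T00 : 0 < T0. Proof. exact: lt_le_trans hT. Qed.

Let F_nsum (G : nat * (W * nat) -> C) (q : R) : 0 <= q ->
  (forall p, nc (G p) <= q * nc (Fc p)) -> (nsum G <= (q * mu)%:E)%E.
Proof.
move=> q0 hG; apply: (@le_trans _ _ (q%:E * nsum Fc)%E); last first.
  by rewrite EFinM; apply: lee_wpmul2l.
have -> : (q%:E * nsum Fc = nsum (fun p => (q%:C)%C * Fc p)%R)%E by rewrite nsumZ ncR.
by apply: nsum_le => p; rewrite Normc.normcM ncR.
Qed.

(** The terms of order k > n carry a factor h^k = (h/T0)^k T0^k <=
    (h/T0)^(n+1) T0^k, and the sum with T0 in place of h is bounded; the
    terms of order at most n are summed over m first. *)
Lemma tail_bound :
  nc (V - \sum_(0 <= k < n.+1) (h%:C)%C ^+ k * csum [set: W] (E k)) <= (h / T0) ^+ n.+1 * mu.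
Proof.
have hge : 0 <= h by exact: ltW.
have hT1 : h / T0 <= 1 by rewrite ler_pdivrMr// mul1r.
have hq : 0 <= h / T0 by rewrite divr_ge0// ltW.
have FcE p : nc (Fc p) = T0 ^+ p.2.2 * nc (c p.1 p.2.1 p.2.2).
  by rewrite Normc.normcM nc_exp ncR// ltW.
have FE p : nc (F p) = (h / T0) ^+ p.2.2 * nc (Fc p).
  rewrite FcE Normc.normcM nc_exp ncR// mulrA -exprMn divfK// gt_eqF//.
have Ffin : (nsum F < +oo)%E.
  apply: le_lt_trans (ltry (1 * mu)); apply: F_nsum => // p.
  by rewrite FE; apply: ler_wpM2r; [exact: nc_ge0|exact: exprn_ile1].
have FV : isum F V.
  apply: (isum_pairE (F := fun m q => F (m, q)) (g := a)) => //.
  move=> m; have [fm _] := isum_fubini (isum_csum Ffin).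
  apply: (isum_pairE (F := fun w k => F (m, (w, k))) (g := b m)) => //.
    by have [] := fm m.
  by move=> w; exact: hb.
pose F2 (p : nat * (W * nat)) : C := if (n < p.2.2)%N then F p else 0.
have F2n : (nsum F2 <= ((h / T0) ^+ n.+1 * mu)%:E)%E.
  apply: F_nsum => [|p]; first exact: exprn_ge0.
  rewrite /F2; case: ifP => np; last by rewrite Normc.normc0 mulr_ge0 ?exprn_ge0 ?nc_ge0.
  rewrite FE; apply: ler_wpM2r; [exact: nc_ge0|].
  by rewrite -(subnKC np) exprD -[leRHS]mulr1; apply: ler_wpM2l; [exact: exprn_ge0|exact: exprn_ile1].
have F2s : isum F2 (csum [set: nat * (W * nat)] F2) by apply: isum_csum; exact: le_lt_trans F2n (ltry _).
set t2 := csum _ F2 in F2s.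
pose G (k : nat) (q : W * nat) : C := if (n < k)%N then 0 else (h%:C)%C ^+ k * c q.2 q.1 k.
have GS : isum (fun p : nat * (W * nat) => G p.1 p.2) (V - t2).
  pose sw (p : nat * (W * nat)) := (p.2.2, (p.2.1, p.1)).
  apply/(isum_reindex (h := sw) (f := fun p : nat * (W * nat) => G p.1 p.2)).
  - by move=> [m [w k]] [m' [w' k']] [-> -> ->].
  - by move=> [k [w m]] H; case: (H (m, (w, k))).
  apply: isum_eq (isumB FV F2s) _ => -[m [w k]].
  by rewrite /G /F2 /F /=; case: ifP; rewrite ?subrr ?subr0.
have [Gk Gs] := isum_fubini GS; rewrite /= in Gk Gs.
have GE k : csum [set: W * nat] (fun q => G k q) = if (k <= n)%N then (h%:C)%C ^+ k * csum [set: W] (E k) else 0.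
  have gk := Gk k; case: leqP => kn; last first.
    apply: isum_uniq gk _; apply: isum_eq (isum0 _ _) _ => q.
    by rewrite /G kn.
  have hk0 : (h%:C)%C ^+ k != 0 :> C.
    by rewrite expf_neq0//; apply/eqP => -[/eqP]; rewrite gt_eqF.
  have E2 : (fun q => G k q) = fun q : W * nat => (fun w m => (h%:C)%C ^+ k * c m w k) q.1 q.2.
    by apply/funext => -[w m]; rewrite /G ltnNge kn.
  rewrite E2 in gk *.
  have rows w : isum (fun m => (h%:C)%C ^+ k * c m w k) ((h%:C)%C ^+ k * E k w).
    by apply: isumZ; exact: hE.
  have g1 := isum_pairI gk rows.
  have g2 := isumZ ((h%:C)%C ^+ k)^-1 g1.
  have g3 : isum (E k) (csum [set: W] (E k)).
    by apply: isum_csum; have [+ _] := isum_eq g2 (fun w => mulKf hk0 (E k w)).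
  exact: isum_uniq g1 (isumZ _ g3).
have Gs2 : isum (fun k => csum [set: W * nat] (fun q => G k q))
   (\sum_(0 <= k < n.+1) (h%:C)%C ^+ k * csum [set: W] (E k)).
  have -> : \sum_(0 <= k < n.+1) (h%:C)%C ^+ k * csum [set: W] (E k) =
     \sum_(k <- iota 0 n.+1) csum [set: W * nat] (fun q => G k q).
    rewrite /index_iota subn0 big_seq [RHS]big_seq; apply: eq_bigr => k.
    by rewrite mem_iota add0n ltnS GE => /andP[_ ->].
  apply: isum_seq; first exact: iota_uniq.
  by move=> k; rewrite mem_iota add0n /= ltnS GE => /negbTE ->.
rewrite (isum_uniq Gs2 Gs) subKr.
exact: isum_ler F2s F2n.
Qed.
End tail.

(** * Expansion in the step size *)

Section evaluated_series.
Variables (R : realType) (nonneg : bool) (d : nat).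
Local Notation Z := (mode nonneg d).
Local Notation C := R[i].
Local Notation nc := (@Normc.normc R).
Local Notation io := (('i%C : C)%:P : {poly C}).

Lemma nsum_nonneg (T : choiceType) (f : T -> C) c : isum f c ->
  (forall x, exists2 r, 0 <= r & f x = (r%:C)%C) -> nsum f = (nc c)%:E.
Proof.
move=> [fin <-] fr.
have fE x : f x = ((nc (f x))%:C)%C by have [r r0 ->] := fr x; rewrite ncR.
have -> : csum [set: T] f = ((fine (nsum f))%:C)%C.
  rewrite /csum; congr (_ +i* _)%C; last first.
    rewrite (_ : (fun x => complex.Im (f x)) = fun=> 0).
      by rewrite rsum_ge0E ?esum1.
    by apply/funext => x; rewrite fE.
  rewrite (_ : (fun x => complex.Re (f x)) = fun x => nc (f x)).
    by rewrite rsum_ge0E => // x; exact: nc_ge0.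
  by apply/funext => x; rewrite {1}fE.
by rewrite ncR ?fine_ge0 ?nsum_ge0// -nsumE.
Qed.

Lemma iter_L_map (A B : comNzRingType) (phi : A -> B) (X : Z -> seq Z -> A) m f w :
  phi 0 = 0 -> {morph phi : x y / x + y} -> {morph phi : x y / x * y} ->
  phi (iter m (L X) f w) = iter m (L (fun k y => phi (X k y))) (fun w => phi (f w)) w.
Proof.
move=> p0 pD pM; elim: m w => [|m IH] w //=.
by rewrite L_map//; apply: eq_L.
Qed.

Variables (s : R) (hs : 0 <= s) (K : seq Z -> {poly C}) (D : nat) (Lam e T0 h B Bp : R) (z : Z -> C).
Hypotheses (D0 : (0 < D)%N) (Lam0 : 0 <= Lam) (e0 : 0 <= e) (h0 : 0 < h) (hT : h <= T0).
Hypothesis Ksupp : forall w, K w != 0 -> momentum w = 0 /\ (2 <= size w <= D.+1)%N.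
Hypothesis Kpnorm : forall k y, pnorm T0 (hf io K k y) <= (if y == [:: k] then Lam else 0) + e.
Hypothesis zfin : (l1norm s z < +oo)%E.

Definition evalf (k : Z) (y : seq Z) : C := (hf io K k y).[(h%:C)%C].
(** The field with nonnegative coefficients that dominates [evalf] for every
    step size up to T0.  As it is again a field, with a flow of its own, the
    absolute convergence of all the expansions reduces to the bound on its
    Taylor coefficients. *)
Definition majf (k : Z) (y : seq Z) : C := ((pnorm T0 (hf io K k y))%:C)%C.
Definition absz (k : Z) : C := ((nc (z k))%:C)%C.

Let T00 : 0 <= T0. Proof. exact: le_trans (ltW h0) hT. Qed.

Lemma hf_supp k y : hf io K k y != 0 -> mom1 k = momentum y /\ (1 <= size y <= D)%N.
Proof.
rewrite /hf; have [->|/Ksupp[mk sk]] := eqVneq (K (ibar k :: y)) 0; first by rewrite mulr0 eqxx.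
move=> _; split; last by move: sk; rewrite /= !ltnS.
by move: mk; rewrite mom_cons mom1_bar addrC => /eqP; rewrite subr_eq0 => /eqP.
Qed.

Lemma evalf_ok : field_ok evalf D Lam e.
Proof.
split=> k y.
  rewrite /evalf; have [->|H _] := eqVneq (hf io K k y) 0; first by rewrite horner0 eqxx.
  exact: hf_supp.
by apply: le_trans (Kpnorm k y); apply: nc_horner => //; exact: ltW.
Qed.

Lemma majf_ok : field_ok majf D Lam e.
Proof.
split=> k y; last by rewrite /majf ncR ?pnorm_ge0.
rewrite /majf; have [->|H _] := eqVneq (hf io K k y) 0; first by rewrite pnorm0 eqxx.
exact: hf_supp.
Qed.

Lemma absz_norm : l1norm s absz = l1norm s z.
Proof. by apply: eq_esum => k _; rewrite /absz ncR// nc_ge0. Qed.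

Let afin : (l1norm s absz < +oo)%E. Proof. by rewrite absz_norm. Qed.

Lemma monomial_absz w : monomial w absz = ((nc (monomial w z))%:C)%C.
Proof.
elim: w => [|k w IH]; rewrite /monomial ?big_nil ?big_cons; first by rewrite (nc_nat _ 1).
by rewrite -!/(monomial _ _) IH Normc.normcM -rmorphM.
Qed.

Hypothesis hB : forall N, \sum_(0 <= m < N) 2 ^+ m * taylor_norm s evalf z m <= B.
Hypothesis hBa : forall N, \sum_(0 <= m < N) 2 ^+ m * taylor_norm s majf absz m <= B.

Let letterR (j : Z) (w : seq Z) : R := (w == [:: j])%:R.
Let letterP (j : Z) := poly_of (@letter R nonneg d j).
Let itP j m w := iterL io K m (letterP j) w.

Lemma iter_majf j m w : iter m (L majf) (@letter R nonneg d j) w =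
  ((iter m (L (fun k y => pnorm T0 (hf io K k y))) (letterR j) w)%:C)%C.
Proof.
rewrite (iter_L_map (phi := fun x : R => (x%:C)%C)) => //; last 2 first.
- by move=> x y; rewrite rmorphD.
- by move=> x y; rewrite rmorphM.
congr (iter m _ _ w); apply/funext => v; rewrite /letter /letterR.
by case: (v == _).
Qed.

Lemma iter_evalf j m w : iter m (L evalf) (@letter R nonneg d j) w = (itP j m w).[(h%:C)%C].
Proof.
rewrite /itP /iterL (iter_L_map (phi := fun x : {poly C} => x.[(h%:C)%C])) => //; last 3 first.
- by rewrite horner0.
- by move=> x y; rewrite hornerD.
- by move=> x y; rewrite hornerM.
by congr (iter m _ _ w); apply/funext => v; rewrite /letterP /poly_of hornerC.
Qed.

Lemma iter_pnorm j m w : pnorm T0 (itP j m w) <=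
  iter m (L (fun k y => pnorm T0 (hf io K k y))) (letterR j) w.
Proof.
rewrite /itP /iterL; elim: m w => [|m IH] w.
  rewrite /= /letterP /poly_of pnormC /letter /letterR.
  by rewrite nc_nat.
rewrite !iterS; apply: L_major => //.
- exact: pnorm0.
- by move=> x y; exact: pnormD.
- by move=> x y; exact: pnormM.
- by move=> x; exact: pnorm_ge0.
Qed.

Let cf j (m : nat) (w : seq Z) (k : nat) : C := (itP j m w)`_k / m`!%:R * monomial w z.

(** All the terms of the majorant are nonnegative, so the sum of absolute
    values is a genuine Lie series, evaluated at the absolute values of z. *)
Lemma majorant_sum j :
  (nsum (fun p : nat * (seq Z * nat) => (T0%:C)%C ^+ p.2.2 * cf j p.1 p.2.1 p.2.2)%R
   <= nsum (fun m => taylor majf absz m j))%E.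
Proof.
rewrite nsum_pair; apply: le_esum => m _; rewrite nsum_pair.
have F0 : (m`!%:R : C) != 0 by rewrite pnatr_eq0 -lt0n fact_gt0.
have hm := isumZ (m`!%:R^-1) (lie_series_coef hs majf_ok D0 Lam0 e0 afin j m).
rewrite mulKf// in hm.
pose rw w : R := m`!%:R^-1 * (iter m (L (fun k y => pnorm T0 (hf io K k y))) (letterR j) w * nc (monomial w z)).
have it0 w : 0 <= iter m (L (fun k y => pnorm T0 (hf io K k y))) (letterR j) w.
  by apply: le_trans (iter_pnorm j m w); exact: pnorm_ge0.
have rw0 w : 0 <= rw w by rewrite /rw !mulr_ge0 ?invr_ge0// nc_ge0.
have rwE w : m`!%:R^-1 * (iter m (L majf) (letter R j) w * monomial w absz) = ((rw w)%:C)%C.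
  by rewrite iter_majf monomial_absz /rw !rmorphM fmorphV rmorph_nat.
rewrite -(nsum_nonneg hm) => [|w]; last by exists (rw w).
apply: le_esum => w _; rewrite rwE ncR//.
pose q := m`!%:R^-1 * nc (monomial w z).
have q0 : 0 <= q by rewrite mulr_ge0 ?invr_ge0// nc_ge0.
have -> : nsum (fun k => (T0%:C)%C ^+ k * cf j m w k) = (q * pnorm T0 (itP j m w))%:E.
  rewrite EFinM -esum_pnorm// -esumZ//; last by move=> k; rewrite mulr_ge0 ?exprn_ge0// nc_ge0.
  apply: eq_esum => k _; congr EFin.
  by rewrite /cf !Normc.normcM Normc.normcV nc_nat nc_exp ncR// /q; ring.
rewrite lee_fin /rw /q -mulrA; apply: ler_wpM2l; first by rewrite invr_ge0.
by rewrite mulrC; apply: ler_wpM2r; [exact: nc_ge0|exact: iter_pnorm].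
Qed.

Lemma majorant_total : (\esum_(j in [set: Z]) ((anorm R j.1 `^ s)%:E * nsum (fun m => taylor majf absz m j)) <= B%:E)%E.
Proof.
have w0 (k : Z) : 0 <= anorm R k.1 `^ s by exact: wt_ge0.
have -> : \esum_(j in [set: Z]) ((anorm R j.1 `^ s)%:E * nsum (fun m => taylor majf absz m j))%E =
  \esum_(j in [set: Z]) \esum_(m in [set: nat]) (anorm R j.1 `^ s * nc (taylor majf absz m j))%:E.
  by apply: eq_esum => j _; rewrite esumZ// => m; exact: nc_ge0.
rewrite tonelliC => [|j m]; last by rewrite lee_fin mulr_ge0// nc_ge0.
have Y0 m : 0 <= taylor_norm s majf absz m by exact: taylor_norm_ge0.
apply: le_trans (esum_nat_le Y0 (B := B) _) => [|N].
  apply: le_esum => m _.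
  by have := taylor_normE hs majf_ok D0 Lam0 e0 afin m; rewrite /l1norm => ->.
apply: le_trans (hBa N); apply: ler_sum => m _; rewrite -[leLHS]mul1r; apply: ler_wpM2r => //.
exact: pow2_ge1.
Qed.

Lemma majorant_row j : (nsum (fun m => taylor majf absz m j) < +oo)%E.
Proof.
apply: le_lt_trans (ltry B); apply: le_trans majorant_total.
have w0 (k : Z) : 0 <= anorm R k.1 `^ s by exact: wt_ge0.
have t0 (k : Z) : (0 <= (anorm R k.1 `^ s)%:E * nsum (fun m => taylor majf absz m k))%E.
  by apply: mule_ge0; [rewrite lee_fin|exact: nsum_ge0].
rewrite [leRHS](esumID [set j])//.
rewrite setTI esum_set1// -[leLHS]adde0; apply: leeD; last exact: esum_ge0.
rewrite -[leLHS]mul1e; apply: lee_wpmul2r; first exact: nsum_ge0.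
by rewrite lee_fin; apply: wt_ge1.
Qed.

Variables (n : nat) (Ek : Z -> nat -> seq Z -> C).
Hypothesis hE : forall j k w, (k <= n)%N -> isum (Eterm K (@letter R nonneg d j) w k) (Ek j k w).

(** The time-one flow agrees with its expansion in the step size up to order
    n, in norm and uniformly on balls. *)
Lemma series_tail :
  (l1norm s (fun j => taylor_sum evalf z 1 j - \sum_(0 <= k < n.+1)
     (h%:C)%C ^+ k * csum [set: seq Z] (fun w => Ek j k w * monomial w z))%R
   <= ((h / T0) ^+ n.+1 * B)%:E)%E.
Proof.
have w0 (k : Z) : 0 <= anorm R k.1 `^ s by exact: wt_ge0.
pose mu j := fine (nsum (fun m => taylor majf absz m j)).
have muE j : nsum (fun m => taylor majf absz m j) = (mu j)%:E by rewrite /mu -nsumE// majorant_row.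
have mu0 j : 0 <= mu j by apply: fine_ge0; exact: nsum_ge0.
have T0gt : 0 < T0 by exact: lt_le_trans hT.
have q0 : 0 <= (h / T0) ^+ n.+1 by rewrite exprn_ge0// divr_ge0// ltW.
apply: (@esum_leZ _ _ _ _ (fun j : Z => anorm R j.1 `^ s * mu j)) => //.
- by move=> j; apply: mulr_ge0.
- move=> j; rewrite mulrCA; apply: ler_wpM2l => //.
  have cE k w : (k <= n)%N -> isum (fun m => cf j m w k) (Ek j k w * monomial w z).
    by move=> kn; apply: isumZr; exact: hE.
  apply: (tail_bound (c := cf j) (b := fun m w => m`!%:R^-1 * ((itP j m w).[(h%:C)%C] * monomial w z))
    (a := fun m => taylor evalf z m j) h0 hT _ _ _ _ cE).
  + by rewrite -muE; exact: majorant_sum.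
  + move=> m w; have h1 := isum_horner (h%:C)%C (itP j m w).
    have h2 := isumZ (m`!%:R^-1 * monomial w z) h1.
    rewrite [X in isum _ X](_ : _ = m`!%:R^-1 * monomial w z * (itP j m w).[(h%:C)%C]); last by ring.
    apply: isum_eq h2 _ => k; rewrite /cf; ring.
  + move=> m; have hm := lie_series_coef hs evalf_ok D0 Lam0 e0 zfin j m.
    have F0 : (m`!%:R : C) != 0 by rewrite pnatr_eq0 -lt0n fact_gt0.
    have := isumZ (m`!%:R^-1) hm; rewrite mulKf// => /isum_eq; apply => w.
    by rewrite iter_evalf.
  + have := taylor_sum_isum hs evalf_ok D0 Lam0 e0 zfin hB j (t := 1); rewrite lexx ler01 => /(_ isT) /isum_eq.
    by apply => m; rewrite expr1n mul1r.
apply: le_trans majorant_total; apply: le_esum => j _.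
by rewrite muE -EFinM.
Qed.

End evaluated_series.

(** * Vector fields of polynomial Hamiltonians *)

Section hamiltonian_fields.
Variables (R : realType) (nonneg : bool) (d : nat).
Local Notation Z := (mode nonneg d).
Local Notation C := R[i].
Local Notation nc := (@Normc.normc R).

(** Expanding the l-th power of a sum over the modes. *)
Lemma words_sum (g : Z -> R) (G : R) l : (forall c, 0 <= g c) -> 0 <= G ->
  (\esum_(c in [set: Z]) (g c)%:E <= G%:E)%E ->
  (\esum_(w in [set: seq Z]) (if size w == l then \prod_(c <- w) g c else 0)%:E <= (G ^+ l)%:E)%E.
Proof.
move=> g0 G0 gG; have p0 (w : seq Z) : 0 <= \prod_(c <- w) g c by apply: prodr_ge0.
elim: l => [|l IH].
  rewrite (eq_esum (b := fun w : seq Z => (if w == [::] then 1 else 0 : R)%:E)).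
    by rewrite esum_pt.
  by move=> [|c w] _ //=; rewrite big_nil.
rewrite esum_words_cons//.
apply: (@le_trans _ _ (\esum_(c in [set: Z]) (G ^+ l * g c)%:E)%E).
  apply: le_esum => c _; rewrite mulrC EFinM.
  have -> : \esum_(y in [set: seq Z]) (if size y == l then \prod_(c0 <- c :: y) g c0 else 0)%:E =
     ((g c)%:E * \esum_(y in [set: seq Z]) (if size y == l then \prod_(c0 <- y) g c0 else 0)%:E)%E.
    rewrite -esumZ//; last by move=> y; case: ifP.
    by apply: eq_esum => y _; rewrite big_cons; case: ifP; rewrite ?mulr0.
  by apply: lee_wpmul2l; rewrite ?lee_fin.
by rewrite esumZ ?exprn_ge0// exprSr EFinM; apply: lee_wpmul2l; rewrite ?lee_fin ?exprn_ge0.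
Qed.

(** Sums over a subset become sums over the whole type, to which the
    previous tools apply. *)
Lemma csum_restrict (T : choiceType) (A : set T) (f : T -> C) :
  csum A f = csum [set: T] (fun x => if x \in A then f x else 0).
Proof.
have rE (g : T -> R) : rsum A g = rsum [set: T] (fun x => if x \in A then g x else 0).
  rewrite /rsum; congr (fine (_ - _))%E; rewrite esum_mkcond; apply: eq_esum => x _;
    rewrite ?funeposE ?funenegE /=; case: ifP => //= _; by rewrite ?oppr0 maxxx.
rewrite /csum !rE; congr (_ +i* _)%C; congr rsum; apply/funext => x; by case: ifP.
Qed.

Definition truncated (k : nat) (w : seq Z) : bool :=
  (momentum w == 0) && (2 <= size w <= k)%N.

Lemma words_summable (g : Z -> R) (G : R) (k : nat) (f : seq Z -> C) (Bf : R) :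
  (forall c, 0 <= g c) -> 0 <= G -> 0 <= Bf ->
  (\esum_(c in [set: Z]) (g c)%:E <= G%:E)%E ->
  (forall w, (k < size w)%N -> f w = 0) ->
  (forall w, nc (f w) <= Bf * \prod_(c <- w) g c) ->
  (nsum f <= (Bf * \sum_(0 <= l < k.+1) G ^+ l)%:E)%E.
Proof.
move=> g0 G0 B0 gG fk fb; have p0 (w : seq Z) : 0 <= \prod_(c <- w) g c by apply: prodr_ge0.
pose h l (w : seq Z) := if size w == l then \prod_(c <- w) g c else 0.
have h0 l w : 0 <= h l w by rewrite /h; case: ifP.
apply: (@esum_leZ _ _ Bf _ (fun w => \sum_(0 <= l < k.+1) h l w)) => //.
- by move=> w; apply: sumr_ge0.
- move=> w; have [wk|wk] := ltnP k (size w).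
    by rewrite fk// Normc.normc0 mulr_ge0// sumr_ge0.
  apply: le_trans (fb w) _; apply: ler_wpM2l => //.
  have mw : size w \in index_iota 0 k.+1 by rewrite mem_index_iota.
  rewrite (bigD1_seq (size w) mw (iota_uniq _ _)) /= {1}/h eqxx.
  by rewrite -[leLHS]addr0 lerD2l sumr_ge0.
rewrite esum_sumr// -sumEFin; apply: lee_sum => l _; exact: words_sum.
Qed.

Lemma monomial_prod (z : Z -> C) w : nc (monomial w z) = \prod_(c <- w) nc (z c).
Proof.
elim: w => [|c w IH]; rewrite /monomial ?big_nil ?big_cons; first exact: (nc_nat _ 1).
by rewrite Normc.normcM -/(monomial w z) IH.
Qed.

Definition cut (k : nat) (a : seq Z -> C) (w : seq Z) : C := if truncated k w then a w else 0.

Lemma polynomial_isum k a (Ba : R) (z : Z -> C) : (forall w, nc (a w) <= Ba) ->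
  (nsum z < +oo)%E -> isum (fun w => cut k a w * monomial w z) (polynomial_of k a z).
Proof.
move=> ha zfin; pose f l w : C := if (momentum w == 0) && (size w == l) then a w * monomial w z else 0.
have Ba0 : 0 <= Ba by apply: le_trans (ha [::]); exact: nc_ge0.
have fl l : isum (f l) (csum (zero_momentum l) (fun w => a w * monomial w z)).
  rewrite csum_restrict; have -> : (fun w => if w \in @zero_momentum nonneg d l then a w * monomial w z else 0) = f l.
    apply/funext => w; rewrite /f; congr (if _ then _ else _).
    apply/idP/idP; first by rewrite inE => -[-> ->]; rewrite !eqxx.
    by move=> /andP[/eqP mw /eqP sw]; rewrite inE.
  apply: isum_csum; apply: le_lt_trans (ltry _).
  apply: (@words_summable (fun c => nc (z c)) (fine (nsum z)) l _ Ba) => //.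
  - by move=> c; exact: nc_ge0.
  - by apply: fine_ge0; exact: nsum_ge0.
  - by rewrite -nsumE.
  - by move=> w lw; rewrite /f; case: eqP => // _; case: eqP => // wl; rewrite wl ltnn in lw.
  - move=> w; rewrite /f; case: ifP => _.
      by rewrite Normc.normcM monomial_prod; apply: ler_wpM2r => //; apply: prodr_ge0 => c _; exact: nc_ge0.
    by rewrite Normc.normc0 mulr_ge0//; apply: prodr_ge0 => c _; exact: nc_ge0.
have := isum_sumn (m := 2) (n := k.+1) (fun l _ => fl l) => /isum_eq; apply => w.
rewrite /cut /truncated /f; have [mw|mw] /= := eqVneq (momentum w) 0; last by rewrite big1 ?mul0r.
have [wk|wk] := boolP (2 <= size w <= k)%N; last first.
  rewrite mul0r big_nat big1// => l lk; case: eqP => // wl; exfalso.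
  by move: wk; rewrite wl -ltnS lk.
have mw2 : size w \in index_iota 2 k.+1 by rewrite mem_index_iota.
rewrite (bigD1_seq (size w) mw2 (iota_uniq _ _)) /= eqxx big1 ?addr0// => l lw.
by rewrite eq_sym (negbTE lw).
Qed.

(** The cyclically invariant coefficient function of the Hamiltonian vector
    field: the derivative of a monomial along a mode sees all the positions
    of that mode, hence all the rotations of the word. *)
Definition cycsum (k : nat) (a : seq Z -> C) (w : seq Z) : C :=
  if truncated k w then \sum_(0 <= i < size w) a (rotr i w) else 0.

Section derivative.
Variables (k : nat) (a : seq Z -> C) (Ba : R) (z : Z -> C) (b : Z).
Hypotheses (ha : forall w, nc (a w) <= Ba) (zfin : (nsum z < +oo)%E).

(** The Taylor coefficients, in t, of the modes of z moved by t along the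
    mode b; with this choice the polynomials [wpoly] are the perturbed
    monomials. *)
Definition perturb (i : nat) (c : Z) : C :=
  match i with 0%N => z c | 1%N => (c == b)%:R | _ => 0 end.
Local Notation Q w := (wpoly perturb 2 w).
Local Notation g := (fun c : Z => nc (z c) + (c == b)%:R).

Let Ba0 : 0 <= Ba. Proof. exact: le_trans (nc_ge0 _) (ha [::]). Qed.
Let g0 c : 0 <= g c. Proof. by rewrite addr_ge0// nc_ge0. Qed.

Lemma gsum : (\esum_(c in [set: Z]) (g c)%:E <= (fine (nsum z) + 1)%:E)%E.
Proof.
rewrite EFinD -nsumE// [leLHS](_ : _ = \esum_(c in [set: Z]) ((nc (z c))%:E + (if c == b then 1 else 0)%:E)%E).
  rewrite esumD => [|c _|c _]; rewrite ?lee_fin ?nc_ge0//; last by case: ifP.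
  by rewrite esum_pt.
by apply: eq_esum => c _; rewrite EFinD; case: eqP.
Qed.

Lemma horner_perturb w (t : C) :
  monomial w (fun c => if c == b then z c + t else z c) = (Q w).[t].
Proof.
rewrite /wpoly horner_prod; apply: eq_bigr => c _.
rewrite /upoly horner_poly !big_ord_recl big_ord0 /= expr0 mulr1 addr0 expr1.
by case: eqP => _; rewrite ?mul1r// mul0r addr0.
Qed.

Lemma pnorm_perturb w : pnorm 1 (Q w) <= \prod_(c <- w) g c.
Proof.
elim: w => [|c w IH]; first by rewrite /wpoly !big_nil (pnormC 1 1) (nc_nat _ 1).
rewrite /wpoly !big_cons; apply: le_trans (pnormM _ _ ler01) _.
apply: ler_pM; rewrite ?pnorm_ge0//.
rewrite -lee_fin -esum_pnorm// (@esum_seq _ _ [:: 0%N; 1%N])//; last 2 first.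
- by move=> i; rewrite expr1n mul1r nc_ge0.
- move=> i; rewrite !inE negb_or => /andP[i0 i1]; rewrite nth_default ?Normc.normc0 ?mulr0//.
  by apply: leq_trans (size_poly _ _) _; case: i i0 i1 => [|[|i]].
rewrite !big_cons big_nil !coef_poly /= expr1n expr1 !mul1r addr0.
by rewrite nc_nat.
Qed.

Lemma horner_taylor1 (p : {poly C}) (t : C) : nc t <= 1 ->
  nc (p.[t] - p`_0 - t * p`_1) <= nc t ^+ 2 * pnorm 1 p.
Proof.
move=> t1; pose q := drop_poly 2 p.
have -> : p.[t] - p`_0 - t * p`_1 = t ^+ 2 * q.[t].
  rewrite -{1}(poly_take_drop 2 p) hornerD hornerM hornerXn /take_poly horner_poly.
  by rewrite !big_ord_recl big_ord0 /= /q; ring.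
rewrite Normc.normcM nc_exp; apply: ler_wpM2l; first by rewrite exprn_ge0// nc_ge0.
apply: (@le_trans _ _ (pnorm 1 q)).
  apply: (isum_ler (isum_horner _ _)); rewrite -esum_pnorm//.
  apply: le_esum => i _; rewrite lee_fin Normc.normcM nc_exp; apply: ler_wpM2r; first exact: nc_ge0.
  by rewrite expr1n; apply: exprn_ile1 => //; exact: nc_ge0.
pose p2 := q * 'X^2.
have -> : pnorm 1 q = (normp q * 'X^2).[1] by rewrite hornerM hornerXn expr1n mulr1.
apply: horner_le => // i; rewrite coefMXn; case: ifP => // h; rewrite ?coef_normp ?nc_ge0//.
by rewrite /q coef_drop_poly subnK// leqNgt h.
Qed.

(** A word with a marked letter b is the same as a word b y with a rotation;
    both sides sum over these. *)
Lemma rotation_sum : isum (fun w => cut k a w * (Q w)`_1)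
  (csum [set: seq Z] (fun y => cycsum k a (b :: y) * monomial y z)).
Proof.
pose G (w : seq Z) (i : nat) : C := if (i < size w)%N then
   (if rot i w is c :: y then if c == b then cut k a w * monomial y z else 0 else 0) else 0.
have Gw w : isum (G w) (cut k a w * (Q w)`_1).
  have -> : (Q w)`_1 = ((Q w)^`())`_0 by rewrite coef_deriv.
  rewrite deriv_wpoly coef_sum mulr_sumr /index_iota subn0.
  rewrite [X in isum _ X](_ : _ = \sum_(i <- iota 0 (size w)) G w i); last first.
    rewrite big_seq [RHS]big_seq; apply: eq_bigr => i; rewrite mem_iota add0n /= => iw.
    rewrite /G iw /rot; case e: (drop i w) => [|c y] /=.
      by move: iw; rewrite -subn_gt0 -size_drop e.
    rewrite !coef0M coef_deriv coef_poly /= !wpoly_coef// mulr1n.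
    have zm v : prod_coef perturb v 0 = monomial v z.
      elim: v => [|c' v IH] /=; first by rewrite /monomial big_nil.
      by rewrite big_nat1 subnn IH /monomial big_cons.
    rewrite !zm; have -> : monomial (y ++ take i w) z = monomial y z * monomial (take i w) z.
      by rewrite /monomial big_cat.
    by case: eqP => _ /=; ring.
  apply: isum_seq; first exact: iota_uniq.
  by move=> i; rewrite mem_iota add0n /= /G => /negbTE ->.
have gp w : 0 <= \prod_(c <- w) g c by apply: prodr_ge0.
have Gb w i : nc (G w i) <= (if truncated k w then Ba else 0) * \prod_(c <- w) g c.
  have tr0 : 0 <= (if truncated k w then Ba else 0) by case: ifP.
  rewrite /G; case: ifP => _; last by rewrite Normc.normc0 mulr_ge0.
  have E : \prod_(c <- w) g c = \prod_(c <- rot i w) g c by apply: perm_big; rewrite perm_sym perm_rot.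
  rewrite {}E; case: (rot i w) => [|c y]; first by rewrite Normc.normc0 big_nil mulr1.
  case: eqP => [->|_]; last by rewrite Normc.normc0 mulr_ge0.
  rewrite Normc.normcM; apply: ler_pM; rewrite ?nc_ge0//.
    by rewrite /cut; case: ifP => // _; rewrite Normc.normc0.
  rewrite big_cons eqxx monomial_prod -[leLHS]mul1r; apply: ler_pM => //.
  - by apply: prodr_ge0 => c' _; exact: nc_ge0.
  - by rewrite lerDr nc_ge0.
  - by apply: ler_prod => c' _; rewrite nc_ge0 lerDl ler0n.
have Gfin : (nsum (fun p : seq Z * nat => G p.1 p.2) < +oo)%E.
  rewrite nsum_pair.
  pose f w : C := ((k%:R * ((if truncated k w then Ba else 0) * \prod_(c <- w) g c))%:C)%C.
  have f0 w : 0 <= k%:R * ((if truncated k w then Ba else 0) * \prod_(c <- w) g c).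
    by rewrite !mulr_ge0//; case: ifP.
  apply: le_lt_trans (le_trans (_ : _ <= nsum f)%E _) (ltry _); last first.
    apply: (@words_summable g (fine (nsum z) + 1) k f (k%:R * Ba)) => //.
    - by rewrite addr_ge0// fine_ge0// nsum_ge0.
    - by rewrite mulr_ge0.
    - exact: gsum.
    - by move=> w kw; rewrite /f /truncated ltnNge in kw *; rewrite (negbTE kw) !andbF mul0r mulr0.
    - move=> w; rewrite /f ncR// mulrA; apply: ler_wpM2r => //; apply: ler_wpM2l => //.
      by case: ifP.
  apply: le_esum => w _; rewrite /f ncR//.
  have [tw|tw] := boolP (truncated k w); last first.
    rewrite /nsum esum1 ?(negbTE tw) ?mul0r ?mulr0// => i _ /=.
    by apply/eqP; rewrite eqe eq_le nc_ge0 andbT (le_trans (Gb w i))// (negbTE tw) mul0r.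
  rewrite /nsum (@esum_seq _ _ (iota 0 (size w))) ?iota_uniq//; last 2 first.
  - by move=> i; exact: nc_ge0.
  - by move=> i; rewrite mem_iota add0n /= /G => /negbTE ->; rewrite Normc.normc0.
  rewrite lee_fin; apply: le_trans (ler_sum _ (fun i _ => Gb w i)) _.
  rewrite big_const_seq count_predT iter_addr_0 size_iota tw -[_ *+ size w]mulr_natl.
  apply: ler_wpM2r; first exact: mulr_ge0.
  by rewrite ler_nat; case/and3P: tw.
have GS := isum_csum Gfin; set S := csum _ _ in GS.
have Gl := isum_pairI GS Gw.
pose h (p : seq Z * nat) := (rotr p.2 (b :: p.1), p.2).
pose H (y : seq Z) (i : nat) : C := if (i < (size y).+1)%N then cut k a (rotr i (b :: y)) * monomial y z else 0.
have HS : isum (fun p : seq Z * nat => H p.1 p.2) S.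
  have := GS; rewrite (isum_reindex (h := h)).
  - move=> /isum_eq; apply => -[y i]; rewrite /G /h /H /= size_rotr rotrK eqxx.
    by rewrite ltnS.
  - by move=> [y i] [y' i'] [] + ii; rewrite /= ii => /rotr_inj [->].
  - move=> [w i] hw; rewrite /G /=; case: ifP => // iw; case e : (rot i w) => [//|c y].
    case: eqP => // cb; exfalso; apply: (hw (y, i)); rewrite /h /=.
    by rewrite -cb -e rotK.
have momp v i : momentum (rotr i v) = momentum v :> 'rV[int]_d.
  by apply: perm_big; rewrite perm_rotr.
have Hy y : isum (H y) (cycsum k a (b :: y) * monomial y z).
  have -> : cycsum k a (b :: y) * monomial y z = \sum_(i <- iota 0 (size y).+1) H y i.
    rewrite /cycsum; case: ifP => tr; last first.
      rewrite mul0r big1// => i _; rewrite /H /cut /truncated momp size_rotr.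
      by rewrite /truncated in tr; rewrite tr mul0r; case: ifP.
    rewrite mulr_suml [in LHS]/index_iota subn0 big_seq [RHS]big_seq; apply: eq_bigr => i.
    rewrite mem_iota add0n /= /H ltnS => ->.
    by rewrite /cut /truncated momp size_rotr; rewrite /truncated in tr; rewrite tr.
  apply: isum_seq; first exact: iota_uniq.
  by move=> i; rewrite mem_iota add0n /= /H => /negbTE ->.
have [_ ->] := isum_pairI HS Hy.
exact: Gl.
Qed.

(** The Taylor remainders of the monomials are summable, being dominated by
    the monomials at |z| increased by one at the mode b. *)
Lemma partial_remainder (t : C) : nc t <= 1 ->
  nc (polynomial_of k a (fun c => if c == b then z c + t else z c) - polynomial_of k a z
     - t * csum [set: seq Z] (fun y => cycsum k a (b :: y) * monomial y z))
  <= nc t ^+ 2 * (Ba * \sum_(0 <= l < k.+1) (fine (nsum z) + 1) ^+ l).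
Proof.
move=> t1; have gp w : 0 <= \prod_(c <- w) g c by apply: prodr_ge0.
have zt : (nsum (fun c => if c == b then z c + t else z c)%R < +oo)%E.
  apply: le_lt_trans (le_trans _ gsum) (ltry _); apply: le_esum => c _; rewrite lee_fin.
  by case: eqP => _; rewrite ?addr0// (le_trans (ncD _ _))// lerD2l.
have h1 := polynomial_isum k ha zt; have h0 := polynomial_isum k ha zfin.
have h := isumB (isumB h1 h0) (isumZ t rotation_sum).
apply: (isum_ler h).
rewrite mulrA; apply: (@words_summable g (fine (nsum z) + 1) k _ (nc t ^+ 2 * Ba)) => //.
- by rewrite addr_ge0// fine_ge0// nsum_ge0.
- by rewrite mulr_ge0// exprn_ge0// nc_ge0.
- exact: gsum.
- by move=> w kw; rewrite /cut /truncated [(size w <= k)%N]leqNgt kw !andbF !mul0r mulr0 !subr0.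
move=> w; rewrite horner_perturb.
have -> : monomial w z = (Q w)`_0.
  by rewrite -horner_coef0 -horner_perturb; congr (monomial w); apply/funext => c; rewrite addr0 if_same.
have -> : cut k a w * (Q w).[t] - cut k a w * (Q w)`_0 - t * (cut k a w * (Q w)`_1) =
   cut k a w * ((Q w).[t] - (Q w)`_0 - t * (Q w)`_1) by ring.
rewrite Normc.normcM [nc t ^+ 2 * _]mulrC -mulrA; apply: ler_pM; rewrite ?nc_ge0//.
  by rewrite /cut; case: ifP => // _; rewrite Normc.normc0.
apply: le_trans (horner_taylor1 _ t1) _.
by apply: ler_wpM2l; [rewrite exprn_ge0// nc_ge0|exact: pnorm_perturb].
Qed.

(** The complex derivative is a limit of difference quotients, and the
    remainder is quadratic. *)
Lemma partialE : partial (polynomial_of k a) b z =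
  csum [set: seq Z] (fun y => cycsum k a (b :: y) * monomial y z).
Proof.
set Dv := csum _ _; pose Br := Ba * \sum_(0 <= l < k.+1) (fine (nsum z) + 1) ^+ l.
have Br0 : 0 <= Br.
  rewrite mulr_ge0// sumr_ge0// => l _; apply: exprn_ge0.
  by rewrite addr_ge0// fine_ge0// nsum_ge0.
have ncE (x : C) : `|x| = ((nc x)%:C)%C by [].
rewrite /partial /derive1.
apply: (@cvg_lim (C^o : normedModType C)); first exact: norm_hausdorff.
apply/cvgrPdist_le => /= eps eps0.
have epsE : eps = ((nc eps)%:C)%C by rewrite -ncE gtr0_norm.
have neps0 : 0 < nc eps by move: eps0; rewrite {1}epsE ltcR.
pose dl : R := Num.min 1 (nc eps / (Br + 1)).
have dl0 : 0 < dl by rewrite lt_min ltr01 divr_gt0// ltr_wpDl.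
near=> t.
have t0 : t != 0 by near: t; exact: withinT.
have tdl : nc t <= dl.
  have : `|t| <= (dl%:C)%C by near: t; apply: (@dnbhs0_le C (C^o)); rewrite ltcR.
  by rewrite ncE lecR.
have t1 : nc t <= 1 by apply: le_trans tdl _; rewrite ge_min lexx.
have := partial_remainder t1; rewrite -/Dv -/Br.
rewrite [t + 0]addr0; have -> : (fun c => if c == b then z c + 0 else z c) = z.
  by apply/funext => c; rewrite addr0 if_same.
set Ft := polynomial_of k a _; set F0 := polynomial_of k a _ => hr.
have -> : Dv - t^-1 *: (Ft - F0) = - (t^-1 * (Ft - F0 - t * Dv)).
  by rewrite [RHS](_ : _ = t^-1 * t * Dv - t^-1 * (Ft - F0)); [rewrite mulVf// mul1r|ring].
rewrite normrN ncE [leRHS]epsE lecR Normc.normcM Normc.normcV.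
have nt0 : 0 < nc t by rewrite lt_neqAle nc_ge0 andbT eq_sym; apply: contra_neq t0 => /Normc.eq0_normc.
rewrite mulrC ler_pdivrMr//; apply: le_trans hr _.
rewrite expr2 -mulrA mulrC; apply: ler_wpM2r; first exact: ltW.
have tle : nc t <= nc eps / (Br + 1) by apply: le_trans tdl _; rewrite ge_min lexx orbT.
have : nc t * (Br + 1) <= nc eps by rewrite -ler_pdivlMr// ltr_wpDl.
by apply: le_trans; apply: ler_wpM2l; [exact: nc_ge0|rewrite lerDl].
Unshelve. all: by end_near. Qed.
End derivative.

Lemma cycsum_bound k a (Ba : R) w : (forall w, nc (a w) <= Ba) -> nc (cycsum k a w) <= k%:R * Ba.
Proof.
move=> ha; have Ba0 : 0 <= Ba by apply: le_trans (ha [::]); exact: nc_ge0.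
rewrite /cycsum; case: ifP => [/and3P[_ _ wk]|_]; last by rewrite Normc.normc0 mulr_ge0.
apply: le_trans (nc_sum _ _ _) _; apply: le_trans (ler_sum _ (fun i _ => ha _)) _.
rewrite big_const_seq count_predT iter_addr_0 /index_iota size_iota subn0 -[_ *+ size w]mulr_natl.
by apply: ler_wpM2r => //; rewrite ler_nat.
Qed.

Lemma hamiltonian_fieldE k a (Ba : R) (z : Z -> C) j : (forall w, nc (a w) <= Ba) ->
  (nsum z < +oo)%E -> hamiltonian_field (polynomial_of k a) z j =
  fieldat (hf ('i%C : C) (cycsum k a)) (fun y => monomial y z) j.
Proof.
move=> ha zfin; rewrite /hamiltonian_field (partialE k _ ha zfin) /fieldat /hf -/(sg _ _).
have Ba0 : 0 <= Ba by apply: le_trans (ha [::]); exact: nc_ge0.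
have h : isum (fun y => cycsum k a (ibar j :: y) * monomial y z)
   (csum [set: seq Z] (fun y => cycsum k a (ibar j :: y) * monomial y z)).
  apply: isum_csum; apply: le_lt_trans (ltry _).
  apply: (@words_summable (fun c => nc (z c)) (fine (nsum z)) k _ (k%:R * Ba)) => //.
  - by move=> c; exact: nc_ge0.
  - by apply: fine_ge0; exact: nsum_ge0.
  - exact: mulr_ge0.
  - by rewrite -nsumE.
  - move=> w kw; rewrite /cycsum /truncated /= ltnS [(_ < k)%N]ltnNge (ltnW kw) andbF andbF.
    by rewrite mul0r.
  - move=> w; rewrite Normc.normcM monomial_prod; apply: ler_wpM2r.
      by apply: prodr_ge0 => c _; exact: nc_ge0.
    exact: cycsum_bound.
have [_ <-] := isumZ (sg 'i%C j) h.
by congr csum; apply/funext => y; rewrite mulrA.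
Qed.

Lemma cycsum_cyc k a : cyc (cycsum k a).
Proof.
move=> c v; have E : rcons v c = rot 1 (c :: v) by rewrite rot1_cons.
have tr : truncated k (rcons v c) = truncated k (c :: v).
  rewrite /truncated size_rcons; congr ((_ == 0) && _).
  by apply: perm_big; rewrite perm_rcons.
rewrite /cycsum tr size_rcons /=; case: ifP => // _.
rewrite big_nat_recl// big_nat_recr//= addrC; congr (_ + _).
  by rewrite E /rotr size_rot /= subn0 subSn// subnn rot_oversize ?size_rot.
apply: eq_big_nat => i /andP[_ iv]; congr a.
rewrite E /rotr size_rot /= -rotD /=; last by rewrite subSS addn1 ltnS leq_subr.
by rewrite subSS addn1 subSn// ltnW.
Qed.

Lemma cycsum_real k a : (forall w, a (map (@ibar _ _) w) = conjc (a w)) ->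
  forall w, cycsum k a (map (@ibar _ _) w) = conjc (cycsum k a w).
Proof.
move=> ra w; rewrite /cycsum /truncated mom_bar oppr_eq0 size_map.
have [_|_] := boolP ((momentum w == 0) && (2 <= size w <= k)%N); last by rewrite cjz.
rewrite rmorph_sum; apply: eq_bigr => i _.
by rewrite -map_rotr ra.
Qed.

(** Every cyclically invariant function comes from a Hamiltonian: divide by
    the length of the words. *)
Lemma cycsum_average k (A : seq Z -> C) w : cyc A ->
  cycsum k (fun w => A w / (size w)%:R) w = cut k A w.
Proof.
move=> cA; rewrite /cycsum /cut; case: ifP => // /and3P[_ w2 _].
rewrite (eq_bigr (fun=> A w / (size w)%:R)) => [|i _]; last first.
  by rewrite size_rotr /rotr /rot cyc_cat// cat_take_drop.
rewrite sumr_const_nat subn0 -[_ *+ size w]mulr_natl mulrC divfK//.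
by rewrite pnatr_eq0 -lt0n (leq_trans _ w2).
Qed.
End hamiltonian_fields.

(** * Existence of flows and uniform bounds *)

Section flow_construction.
Variables (R : realType) (nonneg : bool) (d : nat).
Local Notation Z := (mode nonneg d).
Local Notation C := R[i].
Local Notation nc := (@Normc.normc R).

(** The form in which strong differentiability is checked, on a closed
    interval with one-sided derivatives at its ends. *)
Lemma cvg_le_linear (t c : R) (I : set R) (f : R -> \bar R) : 0 <= c ->
  (forall t', I t' -> t' != t -> (0 <= f t' <= (c * `|t' - t|)%:E)%E) ->
  f t' @[t' --> within I (t^')] --> 0%E.
Proof.
move=> c0 hf; pose g (t' : R) := c * `|t' - t|.
have gc : g t' @[t' --> within I (t^')] --> (0 : R).
  have -> : 0 = c * `|t - t| by rewrite subrr normr0 mulr0.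
  apply: cvg_within_filter; apply: cvg_within_filter.
  apply: cvgMr; apply: cvg_norm; apply: cvgB; [exact: cvg_id|exact: cvg_cst].
apply: (squeeze_cvge (f := fun=> 0%E) (h := fun t' => (g t')%:E)).
- rewrite near_withinE; near=> t' => It'; apply: hf => //.
  by near: t'; exact: nbhs_dnbhs_neq.
- exact: cvg_cst.
- by apply: cvg_EFin => //; apply: nearW.
Unshelve. all: by end_near. Qed.

Variables (s : R) (hs : 0 <= s).
Variables (X : Z -> seq Z -> C) (D : nat) (Lam e : R) (z : Z -> C).
Hypotheses (okX : field_ok X D Lam e) (D0 : (0 < D)%N) (Lam0 : 0 <= Lam) (e0 : 0 <= e).
Hypothesis zfin : (l1norm s z < +oo)%E.
Variables (B Bp : R).
Hypothesis hB : forall N, \sum_(0 <= m < N) 2 ^+ m * taylor_norm s X z m <= B.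
Hypothesis hBp : forall l N, (l <= D)%N -> \sum_(0 <= m < N) 2 ^+ m * cpow (taylor_norm s X z) l m <= Bp.

(** The solution of the rescaled equation on [0,1] is transported to [0,h]
    by the change of time t / h. *)
Lemma flow_of_series (HF : (Z -> C) -> Z -> C) (h : R) : 0 < h ->
  (forall z', (l1norm s z' < +oo)%E -> forall j,
     HF z' j = ((h^-1)%:C)%C * fieldat X (fun y => monomial y z') j) ->
  flow s HF h z (taylor_sum X z 1).
Proof.
move=> h0 hHF; exists (fun t => taylor_sum X z (t / h)); split; last first.
- by rewrite divff// gt_eqF.
- by rewrite mul0r; exact: (taylor_sum0 hs okX D0 Lam0 e0 zfin hB).
have B0 : 0 <= B by have := hB 0; rewrite big_geq.
have unit t : 0 <= t <= h -> 0 <= t / h <= 1.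
  by move=> /andP[t0 th]; rewrite divr_ge0 ?(ltW h0)//= ler_pdivrMr// mul1r.
have Vfin t : 0 <= t <= h -> (l1norm s (taylor_sum X z (t / h)) < +oo)%E.
  move=> ht; apply: le_lt_trans (ltry B).
  exact: (taylor_sum_norm hs okX D0 Lam0 e0 zfin hB (unit t ht)).
move=> t ht; split; first exact: Vfin.
apply: (@cvg_le_linear t (B / h ^+ 2)); first by rewrite divr_ge0// exprn_ge0// ltW.
move=> t' /=; rewrite in_itv /= => ht' tt; rewrite (l1norm_ge0 hs) /=.
have step := taylor_sum_step hs okX D0 Lam0 e0 zfin hB hBp (unit t ht) (unit t' ht').
have d0 : 0 < `|t' - t| by rewrite normr_gt0 subr_eq0.
have -> : B / h ^+ 2 * `|t' - t| = `|t' - t|^-1 * (B * (t' / h - t / h) ^+ 2).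
  rewrite -mulrBl exprMn -[(t' - t) ^+ 2]real_normK ?num_real//.
  by field; rewrite !gt_eqF.
apply: (@esum_leZ _ _ _ _ _ _ _ _ _ step); first by rewrite invr_ge0.
  by move=> k; apply: mulr_ge0; [exact: wt_ge0|exact: nc_ge0].
move=> k; rewrite (hHF _ (Vfin t ht)) [leRHS]mulrCA; apply: ler_wpM2l; first exact: wt_ge0.
set Fv := fieldat X _ k; set a := taylor_sum X z (t' / h) k; set b := taylor_sum X z (t / h) k.
have -> : ((t' - t)^-1)%:C%C * (a - b) - (h^-1)%:C%C * Fv =
   ((t' - t)^-1)%:C%C * (a - b - (t' / h - t / h)%:C%C * Fv).
  have hE : ((h^-1)%:C)%C = ((t' - t)^-1)%:C%C * (t' / h - t / h)%:C%C :> C.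
    by rewrite -rmorphM -mulrBl mulrA mulVf ?mul1r// subr_eq0.
  by rewrite [in LHS]hE [RHS]mulrBr [in RHS]mulrA.
by rewrite Normc.normcM ncZ normfV.
Qed.
End flow_construction.

Section uniform_bounds.
Variables (R : realType) (nonneg : bool) (d : nat).
Local Notation Z := (mode nonneg d).
Local Notation C := R[i].
Local Notation nc := (@Normc.normc R).

(** The smallness e of the nonlinear part and the bounds depend only on the
    ball, on Lam and on the degree, hence not on the step size. *)
Lemma uniform_series_bound (s : R) (D : nat) (Lam M : R) : 0 <= s -> (0 < D)%N -> 0 < Lam -> 0 < M ->
  exists e B Bp, [/\ 0 < e, 0 <= B & forall (X : Z -> seq Z -> C) z, field_ok X D Lam e ->
     l1ball s M z ->
     (forall N, \sum_(0 <= m < N) 2 ^+ m * taylor_norm s X z m <= B) /\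
     forall l N, (l <= D)%N -> \sum_(0 <= m < N) 2 ^+ m * cpow (taylor_norm s X z) l m <= Bp].
Proof.
move=> hs D0 Lam0 M0; have [e1 [B [Bp [e10 B0 Bp0 hsb]]]] := scalar_bound Lam0 D M0.
have W0 : 0 < W1 s by apply: lt_le_trans (W1_ge1 hs).
exists (e1 / (2 * W1 s ^+ D)), B, Bp; split=> //.
  by rewrite divr_gt0// mulr_gt0// exprn_gt0.
move=> X z okX zM.
have zfin : (l1norm s z < +oo)%E by exact: le_lt_trans zM (ltry _).
set e := _ / _ in okX; have e0 : 0 <= e by rewrite ltW// divr_gt0// mulr_gt0// exprn_gt0.
apply: (hsb (2 * e * W1 s ^+ D)).
- by apply: mulr_ge0; [exact: mulr_ge0|apply: exprn_ge0; exact: ltW].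
- by rewrite /e -mulrA mulrCA divfK// gt_eqF// mulr_gt0// exprn_gt0.
- by move=> i; exact: taylor_norm_ge0.
- by rewrite -lee_fin -(taylor_normE hs okX D0 (ltW Lam0) e0 zfin).
- by move=> m; exact: (taylor_norm_rec hs okX D0 (ltW Lam0) e0 zfin).
Qed.

Lemma l1norm_nsum_fin (s : R) (z : Z -> C) : 0 <= s -> (l1norm s z < +oo)%E -> (nsum z < +oo)%E.
Proof. by move=> hs; apply: le_lt_trans; exact: l1norm_nsum. Qed.
End uniform_bounds.

(** * The two flows *)

Section assembly.
Variables (R : realType) (nonneg : bool) (d : nat).
Local Notation Z := (mode nonneg d).
Local Notation bar := (@ibar nonneg d).
Local Notation C := R[i].
Local Notation nc := (@Normc.normc R).
Local Notation io := (('i%C : C)%:P : {poly C}).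

Lemma l1norm_triangle (s : R) (f g : Z -> C) : 0 <= s ->
  (l1norm s (fun j => f j - g j)%R <= l1norm s f + l1norm s g)%E.
Proof.
move=> hs; have w0 (k : Z) : 0 <= anorm R k.1 `^ s by exact: wt_ge0.
rewrite /l1norm -esumD => [|j _|j _]; try by rewrite lee_fin mulr_ge0// nc_ge0.
apply: le_esum => j _; rewrite -EFinD lee_fin -mulrDr; apply: ler_wpM2l => //.
by rewrite -(ncN (g j)) ncD.
Qed.

Lemma field_summable (s : R) (X : Z -> seq Z -> C) (D : nat) (Lam e : R) (z : Z -> C) j : 0 <= s ->
  field_ok X D Lam e -> (0 < D)%N -> 0 <= Lam -> 0 <= e -> (l1norm s z < +oo)%E ->
  isum (fun y => X j y * monomial y z) (fieldat X (fun y => monomial y z) j).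
Proof.
move=> hs okX D0 Lam0 e0 zfin.
apply: (@X_row_isum _ _ _ s hs X D Lam e okX D0 Lam0 e0 (fun y => monomial y z) (fun l => fine (l1norm s z) ^+ l)).
move=> l _.
have w0 (k : Z) : 0 <= anorm R k.1 `^ s * nc (z k) by rewrite mulr_ge0 ?nc_ge0//; exact: wt_ge0.
have := @words_sum R nonneg d (fun c => anorm R c.1 `^ s * nc (z c)) (fine (l1norm s z)) l w0.
rewrite fine_ge0 ?esum_ge0//; last by move=> k _; rewrite lee_fin.
move=> /(_ isT); rewrite fineK; last by rewrite ge0_fin_numE// esum_ge0// => k _; rewrite lee_fin.
move=> /(_ (lexx _)); apply: le_trans; apply: le_esum => y _; rewrite lee_fin; case: ifP => // _.
by rewrite monomial_prod /wtw -big_split.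
Qed.

Lemma expiD (x y : R) : expi (x + y) = expi x * expi y.
Proof. by rewrite /expi cosD sinD; simpc; congr (_ +i* _)%C; ring. Qed.

Lemma expi0 : expi (0 : R) = 1.
Proof. by rewrite /expi cos0 sin0. Qed.

Lemma linear_flowE (lam : lattice nonneg d -> R) (z : Z -> C) j :
  linear_flow lam z j = expi (- (if j.2 then lam j.1 else - lam j.1)) * z j.
Proof. by rewrite /linear_flow /expi; case: (j.2); rewrite ?opprK. Qed.

(** The factor is the one of [Eterm_matching], so that the two expansions
    agree term by term. *)
Lemma monomial_linear_flow (lam : lattice nonneg d -> R) (z : Z -> C) w :
  monomial w (linear_flow lam z) = expi (- theta lam w) * monomial w z.
Proof.
elim: w => [|j w IH]; rewrite /monomial ?big_nil ?big_cons /theta ?big_nil ?big_cons.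
  by rewrite oppr0 expi0 mulr1.
rewrite -/(monomial w _) IH linear_flowE opprD expiD -/(theta lam w) -/(monomial w z); ring.
Qed.

Lemma l1norm_linear_flow (s : R) (lam : lattice nonneg d -> R) (z : Z -> C) :
  l1norm s (linear_flow lam z) = l1norm s z.
Proof.
by apply: eq_esum => j _; rewrite linear_flowE Normc.normcM nc_expi mul1r.
Qed.

Lemma pnorm_small (T B : R) (n : nat) (x : {poly C}) : 0 <= T -> T <= 1 -> 0 <= B ->
  (size x <= n.+1)%N -> (forall i, nc x`_i <= B) -> pnorm T x <= nc x`_0 + T * (n%:R * B).
Proof.
move=> T0 T1 B0 sx hx; rewrite /pnorm (@horner_coef_wide _ n.+1); last first.
  by apply: leq_trans sx; exact: size_poly.
rewrite big_ord_recl coef_normp expr0 mulr1 lerD2l.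
apply: (@le_trans _ _ (\sum_(i < n) (T * B))); last first.
  by rewrite sumr_const card_ord mulr_natl mulrnAr.
apply: ler_sum => i _; rewrite coef_normp mulrC; apply: ler_pM; rewrite ?nc_ge0 ?exprn_ge0//.
by rewrite exprS -[leRHS]mulr1; apply: ler_wpM2l => //; exact: exprn_ile1.
Qed.

Lemma hf_pnorm (T B Lam : R) (n : nat) (K : seq Z -> {poly C}) k y : 0 <= T -> T <= 1 -> 0 <= B ->
  (forall w, (size (K w) <= n.+1)%N) -> (forall w i, nc (K w)`_i <= B) ->
  nc (K (bar k :: y))`_0 <= (if y == [:: k] then Lam else 0) ->
  pnorm T (hf io K k y) <= (if y == [:: k] then Lam else 0) + T * (n%:R * B).
Proof.
move=> T0 T1 B0 sK hK h0; rewrite /hf; apply: le_trans (pnormM _ _ T0) _.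
have -> : pnorm T (sg io k) = 1.
  by rewrite /sg; case: (k.2); rewrite -?polyCN pnormC ?ncN nc_ii.
rewrite mul1r; apply: le_trans (pnorm_small T0 T1 B0 (sK _) (hK _)) _.
by rewrite lerD2r.
Qed.

(** The Hamiltonian t P, as a polynomial in the step size t.  The flow of P
    at time h is thereby treated in the same way as that of K(h), with no
    linear part. *)
Definition timesX (A : seq Z -> C) (w : seq Z) : {poly C} := 'X * (A w)%:P.

Lemma iterL_timesX A f m w :
  iterL io (timesX A) m (poly_of f) w = 'X^m * (iter m (L (hf ('i%C : C) A)) f w)%:P.
Proof.
rewrite /iterL; elim: m w => [|m IH] w; first by rewrite /= mul1r.
rewrite !iterS (eq_L _ _ IH) LfZ.
rewrite (eq_LX (Y := fun k y => 'X * (hf ('i%C : C) A k y)%:P)); last first.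
  by move=> k y; rewrite /hf /timesX /sg; case: (k.2); rewrite polyCM ?polyCN; ring.
rewrite LXZ (L_map (phi := @polyC C)) ?polyC0//; last 2 first.
- by move=> x y; rewrite polyCD.
- by move=> x y; rewrite polyCM.
by rewrite exprSr mulrA.
Qed.

(** Only the term m = k contributes, because t P is homogeneous of degree
    one in t. *)
Lemma Eterm_timesX A f w k :
  isum (Eterm (timesX A) f w k) (iter k (L (hf ('i%C : C) A)) f w / k`!%:R).
Proof.
apply: isum_eq (isum_pt k _) _ => m; rewrite /Eterm iterL_timesX coefXnM coefC.
case: ltngtP => [mk|km|->]; rewrite ?mul0r ?subnn//.
by rewrite subn_eq0 leqNgt km mul0r.
Qed.
End assembly.

Section interpolation.
Variables (R : realType) (nonneg : bool) (d : nat).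
Local Notation Z := (mode nonneg d).
Local Notation bar := (@ibar nonneg d).
Local Notation C := R[i].
Local Notation nc := (@Normc.normc R).
Local Notation io := (('i%C : C)%:P : {poly C}).

(** Existence of the flow and its expansion in the step size, in the form
    that is used for both Hamiltonians. *)
Lemma evaluated_flow (s M : R) (K : seq Z -> {poly C}) (D n : nat) (Lam e T0 h B Bp : R) (z : Z -> C)
    (Ek : Z -> nat -> seq Z -> C) (HF : (Z -> C) -> Z -> C) :
  0 <= s -> (0 < D)%N -> 0 <= Lam -> 0 <= e -> 0 < h -> h <= T0 ->
  (forall (X : Z -> seq Z -> C) (z : Z -> C), field_ok X D Lam e -> l1ball s M z ->
     (forall N, \sum_(0 <= m < N) 2 ^+ m * taylor_norm s X z m <= B) /\
     forall l N, (l <= D)%N -> \sum_(0 <= m < N) 2 ^+ m * cpow (taylor_norm s X z) l m <= Bp) ->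
  (forall w, K w != 0 -> momentum w = 0 /\ (2 <= size w <= D.+1)%N) ->
  (forall k y, pnorm T0 (hf io K k y) <= (if y == [:: k] then Lam else 0) + e) ->
  l1ball s M z ->
  (forall z', (l1norm s z' < +oo)%E -> forall j,
     HF z' j = ((h^-1)%:C)%C * fieldat (evalf K h) (fun y => monomial y z') j) ->
  (forall j k w, (k <= n)%N -> isum (Eterm K (letter R j) w k) (Ek j k w)) ->
  flow s HF h z (taylor_sum (evalf K h) z 1) /\
  (l1norm s (fun j => taylor_sum (evalf K h) z 1 j - \sum_(0 <= k < n.+1)
     (h%:C)%C ^+ k * csum [set: seq Z] (fun w => Ek j k w * monomial w z))%R
   <= ((h / T0) ^+ n.+1 * B)%:E)%E.
Proof.
move=> hs D0 Lam0 e0 h0 hT unif Ks Kp zM hHF hE.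
have zfin : (l1norm s z < +oo)%E by exact: le_lt_trans zM (ltry _).
have okE := evalf_ok h0 hT Ks Kp.
have [b1 b2] := unif _ _ okE zM.
have aM : l1ball s M (absz z) by rewrite /l1ball /= absz_norm.
have [b3 _] := unif _ _ (majf_ok h0 hT Ks Kp) aM.
split; first exact: (flow_of_series hs okE D0 Lam0 e0 zfin b1 b2 h0 hHF).
exact: (series_tail hs D0 Lam0 e0 h0 hT Ks Kp zfin b1 b3 hE).
Qed.

Lemma fieldatZ (s : R) (X Y : Z -> seq Z -> C) (D : nat) (Lam e : R) (c : C) (z : Z -> C) j :
  0 <= s -> field_ok X D Lam e -> (0 < D)%N -> 0 <= Lam -> 0 <= e -> (l1norm s z < +oo)%E ->
  (forall k y, Y k y = c * X k y) ->
  fieldat Y (fun y => monomial y z) j = c * fieldat X (fun y => monomial y z) j.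
Proof.
move=> hs okX D0 Lam0 e0 zfin hY.
have [_ <-] := isumZ c (field_summable j hs okX D0 Lam0 e0 zfin).
by congr csum; apply/funext => y; rewrite hY mulrA.
Qed.

Lemma letter_lbnd (j : Z) : lbnd (@letter R nonneg d j).
Proof. by move=> N; exists 1; split=> // w _; rewrite /letter; case: eqP => _; rewrite nc_nat. Qed.

(** The properties required of P by the construction of K are inherited from
    its coefficients. *)
Lemma cycsum_Pinv (sp : bool) (r0 : nat) (a : seq Z -> C) (Ba : R) : (3 <= r0)%N ->
  real_coef a -> (forall w, nc (a w) <= Ba) -> (sp -> balanced_coef a) ->
  Pinv sp (r0 - 2) (cycsum r0 a) (r0%:R * Ba).
Proof.
move=> hr0 ra ba bal; split.
- exact: cycsum_cyc.
- exact: cycsum_real.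
- by rewrite mulr_ge0//; apply: le_trans (ba [::]); exact: nc_ge0.
- by move=> w; exact: cycsum_bound.
move=> w cw; rewrite /cycsum /truncated; case: ifP => // /andP[m0 sw].
have {cw} : ~~ (sp ==> balanced w).
  apply: contra cw => bw; rewrite /cond /adm m0 bw /= add0n mul1n subnK//.
  exact: leq_trans hr0.
rewrite negb_imply => /andP[spT nb].
rewrite big1// => i _; apply/eqP; apply: contraNT nb => /(bal spT) E.
have ct p : count p (rotr i w) = count p w.
  by have /permP -> : perm_eq (rotr i w) w by rewrite perm_rotr.
by rewrite /balanced -!ct E.
Qed.

(** Half of the letters contribute with each sign, so the two halves partly
    compensate: this is where nonnegative frequencies gain a factor two. *)
Lemma balanced_phase (lam : lattice nonneg d -> R) (b : R) (w : seq Z) : (forall x, 0 <= lam x <= b) ->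
  balanced w -> `|theta lam w| <= (size w)%:R / 2 * b.
Proof.
move=> hl /eqP bw.
have b0 : 0 <= b \/ w = [::].
  by case: w bw => [|k w] _; [right|left; have /andP[] := hl k.1; exact: le_trans].
case: b0 => [b0|->]; last by rewrite /theta big_nil normr0 !mul0r.
have hp : theta lam w <= (count (fun j : Z => j.2) w)%:R * b /\
   - ((count (fun j : Z => ~~ j.2) w)%:R * b) <= theta lam w.
  elim: w {bw} => [|k w [IH1 IH2]]; first by rewrite /theta big_nil /= !mul0r oppr0.
  rewrite /theta big_cons -/(theta lam w) /= !natrD.
  have /andP[l0 l1] := hl k.1.
  by case: (k.2) => /=; split; lra.
have sz : ((size w)%:R : R) / 2 * b = (count (fun j : Z => j.2) w)%:R * b.
  have -> : size w = (count (fun j : Z => j.2) w * 2)%N.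
    rewrite -(count_predC (fun j : Z => j.2) w) muln2 -addnn; congr (_ + _)%N.
    by rewrite bw; apply: eq_count.
  by rewrite natrM mulfK.
by case: hp => h1 h2; rewrite ler_norml sz h1 andbT {1}bw h2.
Qed.

Lemma plain_phase (lam : lattice nonneg d -> R) (b : R) (w : seq Z) : (forall x, `|lam x| <= b) ->
  `|theta lam w| <= (size w)%:R * b.
Proof.
move=> hl; elim: w => [|k w IH]; first by rewrite /theta big_nil normr0 mul0r.
rewrite /theta big_cons -/(theta lam w) (le_trans (ler_normD _ _))//.
rewrite /= -natr1 mulrDl mul1r addrC lerD//.
by case: (k.2); rewrite ?normrN.
Qed.

(** The estimate, under the two consequences of the filter that are needed:
    bounded phases and absence of resonances, uniformly in h. *)
Lemma interpolation (sp : bool) (omega : lattice nonneg d -> R) (alpha : R -> R)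
    (a : seq Z -> C) (r0 r : nat) (s M Ba kap Lam : R) :
  (3 <= r0)%N -> (r0 <= r)%N -> 0 <= s -> 0 < M ->
  real_coef a -> (forall w, nc (a w) <= Ba) -> (sp -> balanced_coef a) ->
  0 < Lam -> (forall h x, 0 < h -> `|alpha (h * omega x)| <= Lam) ->
  (forall h, 0 < h -> resonance_free sp (fun x => alpha (h * omega x)) r kap) ->
  interpolated r0 r s M alpha omega (polynomial_of r0 a).
Proof.
move=> hr0 hr hs M0 ra ba bal Lam0 hLam hres.
(* K has terms of order up to n, of degree at most n rho + 2 <= r *)
pose rho := (r0 - 2)%N; pose n := ((r - 2) %/ rho)%N.
have rho0 : (0 < rho)%N by rewrite /rho subn_gt0.
have r2 : (2 <= r)%N by apply: leq_trans hr; exact: leq_trans hr0.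
have hn : (n * rho + 2 <= r)%N by rewrite -(subnK r2) leq_add2r leq_trunc_div.
have Dr : (0 < r)%N by exact: leq_trans r2.
pose A := cycsum r0 a; pose BP := r0%:R * Ba.
have hP : Pinv sp rho A BP by exact: cycsum_Pinv.
have BP0 : 0 <= BP by case: hP.
have kap0 : 0 < kap by have [] := hres 1 ltr01.
pose KB := Kbound r kap BP Lam n.
have KB0 : 0 <= KB.
  have [K [[_ _ _ [K0 _] _] _]] := solution_exists rho0 (hres 1 ltr01) hP hn (ltW Lam0) (fun x => hLam 1 x ltr01).
  exact: K0.
have [e [B [Bp [e0 B0 unif]]]] := uniform_series_bound nonneg d hs Dr Lam0 M0.
pose Q := n%:R * KB + BP + 1.
have Q0 : 0 < Q by rewrite /Q ltr_wpDl// addr_ge0// mulr_ge0.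
(* T0 is small enough for the nonlinear parts of both fields, evaluated with T0
   in place of h, to be at most e *)
pose T0 := Num.min 1 (e / Q).
have T00 : 0 < T0 by rewrite lt_min ltr01 divr_gt0.
have T01 : T0 <= 1 by rewrite ge_min lexx.
have TQ : T0 * Q <= e by rewrite -ler_pdivlMr// ge_min lexx orbT.
have TK : T0 * (n%:R * KB) <= e.
  by apply: le_trans TQ; apply: ler_wpM2l; [exact: ltW|rewrite /Q; have := BP0; lra].
have TP : T0 * (1%:R * BP) <= e.
  apply: le_trans TQ; apply: ler_wpM2l; first exact: ltW.
  have nK0 : 0 <= n%:R * KB by exact: mulr_ge0.
  by rewrite mul1r /Q -addrA addrCA lerDl addr_ge0.
exists T0, (2 * B / T0 ^+ n.+1); split=> // h h0 hT.
pose lam x := alpha (h * omega x).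
have hlam x : `|lam x| <= Lam by exact: hLam.
have [K [[cK gK rK bK [K0 sK]] hQ]] := solution_exists rho0 (hres h h0) hP hn (ltW Lam0) hlam.
rewrite -/KB in bK; have [_ hKB] := bK.
have Kz w : K w != 0 -> adm sp w /\ (2 <= size w <= r)%N.
  move=> Kn; apply/andP; apply: contraNT Kn => cw; apply/eqP/polyP => i; rewrite coef0.
  have [ni|ni] := ltnP n i; first by rewrite nth_default// (leq_trans (sK w)).
  apply: gK; apply: contra cw => /and3P[-> -> sw] /=.
  apply: leq_trans sw (leq_trans _ hn).
  by rewrite addn0 leq_add2r leq_mul2r ni orbT.
have Ks w : K w != 0 -> momentum w = 0 /\ (2 <= size w <= r.+1)%N.
  by move=> /Kz[/andP[/eqP -> _] /andP[-> sw]]; split=> //; exact: leqW.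
have Kp k y : pnorm T0 (hf io K k y) <= (if y == [:: k] then Lam else 0) + e.
  apply: le_trans (lerD (lexx _) TK); apply: hf_pnorm => //; first exact: ltW.
  rewrite K0 /quad; case: y => [|c [|c' y]]; rewrite ?coef0 ?Normc.normc0//; last first.
    by rewrite eqseq_cons andbF.
  rewrite ibarK eqseq_cons andbT; case: eqP => _; last by rewrite coef0 Normc.normc0.
  by rewrite /lamA coefC eqxx ncZ; exact: hlam.
pose KP := timesX A.
have AP w : A w != 0 -> momentum w = 0 /\ (2 <= size w <= r0)%N.
  by rewrite /A /cycsum /truncated; case: ifP => [/andP[/eqP -> ->]|]; rewrite ?eqxx.
have KPs w : KP w != 0 -> momentum w = 0 /\ (2 <= size w <= r.+1)%N.
  rewrite /KP /timesX => H; have /AP[-> /andP[-> sw]] : A w != 0.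
    by apply: contraNneq H => ->; rewrite polyC0 mulr0.
  by split=> //; apply: leqW; exact: leq_trans hr.
have KPp k y : pnorm T0 (hf io KP k y) <= (if y == [:: k] then Lam else 0) + e.
  have [_ _ _ hA _] := hP.
  apply: le_trans (lerD (lexx _) TP); apply: hf_pnorm => //; first exact: ltW.
  - move=> w; rewrite /KP /timesX (leq_trans (size_polyMleq _ _))// size_polyX size_polyC.
    by case: (A w != 0).
  - move=> w i; rewrite /KP /timesX coefXM coefC; case: eqP => _; first by rewrite Normc.normc0.
    by case: eqP => _; rewrite ?Normc.normc0//; exact: hA.
  - by rewrite /KP /timesX coefXM eqxx Normc.normc0; case: eqP => // _; exact: ltW.
have z0M z : l1ball s M z -> l1ball s M (linear_flow lam z) by rewrite /l1ball /= l1norm_linear_flow.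
(* H_h is K(h) / h, so that its flow at time h is the flow of K(h) at time one *)
pose AH w : C := ((h^-1)%:C)%C * (K w).[(h%:C)%C].
pose aH w : C := AH w / (size w)%:R.
have AHb w : nc (AH w) <= h^-1 * (KB + T0 * (n%:R * KB)).
  rewrite /AH Normc.normcM ncR ?invr_ge0 ?(ltW h0)//; apply: ler_wpM2l; first by rewrite invr_ge0 ltW.
  apply: le_trans (nc_horner _ (ltW h0) hT) _.
  apply: le_trans (pnorm_small (ltW T00) T01 KB0 (sK w) (hKB w)) _.
  by rewrite lerD2r.
have aHb w : nc (aH w) <= h^-1 * (KB + T0 * (n%:R * KB)).
  apply: le_trans (AHb w); rewrite /aH nc_div.
  case: (size w) => [|m]; first by rewrite invr0 mulr0 nc_ge0.
  by rewrite ler_pdivrMr ?ltr0n// ler_peMr ?nc_ge0// ler1n.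
have AHc : cyc AH by move=> c v; rewrite /AH cK.
have aHE w : cycsum r aH w = AH w.
  rewrite cycsum_average// /cut /truncated; case: ifP => // tw.
  have [Kw|/Kz[/andP[m0 _] sw]] := eqVneq (K w) 0; first by rewrite /AH Kw horner0 mulr0.
  by rewrite m0 sw in tw.
have cjR (x : R) : conjc ((x%:C)%C : C) = (x%:C)%C by rewrite /= oppr0.
have hconj := cjR h.
have aHr : real_coef aH.
  move=> w; rewrite /aH size_map cjM cjV cj_nat; congr (_ / _).
  rewrite /AH cjM; congr (_ * _); first exact/esym/cjR.
  by rewrite rK /cj -[in LHS]hconj horner_map.
have okK := evalf_ok h0 hT Ks Kp; have okP := evalf_ok h0 hT KPs KPp.
have hn0 : ((h%:C)%C : C) != 0 by apply/eqP => -[/eqP]; rewrite gt_eqF.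
exists (polynomial_of r aH); split.
  by exists r, aH; split=> //; eexists; exact: aHb.
move=> z zM.
have flP := evaluated_flow (n := n) (Ek := fun j k w => iter k (L (hf ('i%C : C) A)) (letter R j) w / k`!%:R)
  (HF := hamiltonian_field (polynomial_of r0 a)) hs Dr (ltW Lam0) (ltW e0) h0 hT unif KPs KPp (z0M _ zM).
have flK := evaluated_flow (n := n) (Ek := fun j k w => expi (- theta lam w) *
    (iter k (L (hf ('i%C : C) A)) (letter R j) w / k`!%:R))
  (HF := hamiltonian_field (polynomial_of r aH)) hs Dr (ltW Lam0) (ltW e0) h0 hT unif Ks Kp zM.
have {flP}[] := flP.
- move=> z' z'fin j; rewrite (hamiltonian_fieldE _ _ ba) ?(l1norm_nsum_fin hs)//.
  apply: (fieldatZ j hs okP Dr (ltW Lam0) (ltW e0) z'fin) => k y.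
  rewrite /evalf /hf hornerM /KP /timesX hornerM hornerX hornerC rmorphV ?unitfE ?gt_eqF//=.
  have -> : (sg io k).[(h%:C)%C] = sg 'i%C k :> C by rewrite /sg; case: (k.2); rewrite ?hornerN hornerC.
  by rewrite -/A mulrCA mulKf.
- by move=> j k w kn; exact: Eterm_timesX.
move=> fl1 t1; have {flK}[] := flK.
- move=> z' z'fin j; rewrite (hamiltonian_fieldE _ _ aHb) ?(l1norm_nsum_fin hs)//.
  apply: (fieldatZ j hs okK Dr (ltW Lam0) (ltW e0) z'fin) => k y.
  rewrite /evalf /hf hornerM aHE /AH.
  have -> : (sg io k).[(h%:C)%C] = sg 'i%C k :> C by rewrite /sg; case: (k.2); rewrite ?hornerN hornerC.
  by rewrite mulrCA.
- move=> j k w kn.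
  exact: (Eterm_matching w rho0 hP (letter_lbnd j) gK bK sK K0 hQ hn kn).
move=> fl2 t2; exists (taylor_sum (evalf KP h) (linear_flow lam z) 1), (taylor_sum (evalf K h) z 1); split=> //.
set V1 := taylor_sum (evalf KP h) _ _ in t1 *; set V2 := taylor_sum (evalf K h) _ _ in t2 *.
pose S1 j := \sum_(0 <= k < n.+1) ((h%:C)%C : C) ^+ k * csum [set: seq Z] (fun w =>
   iter k (L (hf ('i%C : C) A)) (letter R j) w / k`!%:R * monomial w (linear_flow lam z)).
have -> : l1norm s (fun j => V1 j - V2 j) = l1norm s (fun j => (V1 j - S1 j) - (V2 j - S1 j))%R.
  by congr (l1norm s _); apply/funext => j; ring.
apply: le_trans (l1norm_triangle _ _ hs) _.
have E : S1 = fun j => \sum_(0 <= k < n.+1) ((h%:C)%C : C) ^+ k * csum [set: seq Z] (fun w =>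
   expi (- theta lam w) * (iter k (L (hf ('i%C : C) A)) (letter R j) w / k`!%:R) * monomial w z).
  apply/funext => j; apply: eq_bigr => k _; congr (_ * csum _ _); apply/funext => w.
  by rewrite monomial_linear_flow mulrA [expi _ * _]mulrC.
have t1' : (l1norm s (fun j => V1 j - S1 j)%R <= ((h / T0) ^+ n.+1 * B)%:E)%E by exact: t1.
have t2' : (l1norm s (fun j => V2 j - S1 j)%R <= ((h / T0) ^+ n.+1 * B)%:E)%E by rewrite E; exact: t2.
apply: le_trans (leeD t1' t2') _.
rewrite -EFinD lee_fin /interp_order -/rho -/n expr_div_n le_eqVlt; apply/orP; left; apply/eqP.
by set x := h ^+ n.+1; set y := (T0 ^+ n.+1)^-1; ring.
Qed.
End interpolation.

(** * The filter and the resonance condition *)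

Section filters.
Variable R : realType.

(** Beyond the cutoff the filter vanishes, and below it the monotone
    function beta is at most its value at c, which is smaller than y because
    c is smaller than the generalized inverse of beta at y. *)
Lemma truncated_filter_bound (beta : R -> R) (c y : R) : filter_function beta -> 0 < y ->
  (c%:E < beta_inv beta y)%E ->
  exists b, [/\ 0 <= b, b < y, forall x, `|truncated_filter beta c x| <= b &
     forall x, 0 <= x -> 0 <= truncated_filter beta c x].
Proof.
move=> [b0 _ binc] y0 hc.
have bge x : 0 <= x -> 0 <= beta x.
  rewrite le_eqVlt => /orP[/eqP <-|x0]; first by rewrite b0.
  by rewrite -b0 ltW// binc.
have pos x : 0 <= x -> 0 <= truncated_filter beta c x.
  move=> x0; rewrite /truncated_filter mulr_ge0 ?sgr_ge0//.
  by case: ifP => // _; apply: bge.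
have [c0|c0] := ltP 0 c; last first.
  exists 0; split=> // x; rewrite /truncated_filter ifF ?mulr0 ?normr0//.
  by apply/negbTE; rewrite -leNgt (le_trans c0).
exists (beta c); split=> //; first exact/bge/ltW.
  rewrite ltNge; apply/negP => yc; move: hc; rewrite ltNge => /negP; apply.
  by apply: ereal_inf_lbound; exists c => //=; split=> //; exact: ltW.
move=> x; rewrite /truncated_filter; case: ltP => [xc|_]; last first.
  by rewrite mulr0 normr0; exact/bge/ltW.
rewrite normrM -[leRHS]mul1r; apply: ler_pM => //.
  by rewrite normr_sg lern1 leq_b1.
by rewrite ger0_norm ?bge// ltW// binc.
Qed.
End filters.

Section resonance.
Variables (R : realType) (nonneg : bool) (d : nat).

(** The lower bound on the divisors depends only on the bound on the phases,
    hence it is the same for all step sizes. *)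
Lemma resonance_free_of_phase (sp : bool) (r : nat) (t0 : R) : t0 < 2 * pi ->
  exists kap, forall lam : lattice nonneg d -> R,
    (forall w, adm sp w -> (size w <= r)%N -> `|theta lam w| <= t0) ->
    resonance_free sp lam r kap.
Proof.
move=> /phi1_lower[kap kap0 hk]; exists kap => lam hlam; split=> // w aw sw.
by apply: hk; exact: hlam.
Qed.
End resonance.

Theorem theorem5p6 (R : realType) (nonneg : bool) (d : nat) (hd : (1 <= d)%N)
    (omega : lattice nonneg d -> R)
    (homega : exists C m : R, [/\ 0 < C, 0 < m &
       forall a, `|omega a| <= C * anorm R a `^ m])
    (beta : R -> R) (hbeta : filter_function beta)
    (r0 r : nat) (hr0 : (3 <= r0)%N) (hr : (r0 <= r)%N)
    (s M : R) (hs : 0 <= s) (hM : 0 < M)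
    (P : phase R nonneg d -> R[i]) (c : R) :
  (calP r0 P ->
   (c%:E < beta_inv beta (2 * pi / r%:R))%E ->
   interpolated r0 r s M (truncated_filter beta c) omega P)
  /\
  (calSP r0 P -> (forall a, 0 <= omega a) ->
   (c%:E < beta_inv beta (4 * pi / r%:R))%E ->
   interpolated r0 r s M (truncated_filter beta c) omega P).
Proof.
have rpos : 0 < r%:R :> R by rewrite ltr0n (leq_trans _ hr)// (leq_trans _ hr0).
have pi0 : 0 < pi :> R := pi_gt0 R.
split.
  move=> [a [ra [Ba hBa] ->]] hc.
  have y0 : 0 < 2 * pi / r%:R :> R by rewrite divr_gt0// mulr_gt0.
  have [b [b0 by_ hb _]] := truncated_filter_bound hbeta y0 hc.
  have t0 : r%:R * b < 2 * pi by rewrite mulrC -ltr_pdivlMr.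
  have [kap hkap] := resonance_free_of_phase nonneg d false r t0.
  apply: (@interpolation R nonneg d false omega _ a r0 r s M Ba kap (b + 1)) => //.
  - by rewrite ltr_wpDl.
  - by move=> h x _; rewrite (le_trans (hb _))// lerDl.
  - move=> h h0; apply: hkap => w _ sw.
    apply: le_trans (plain_phase (b := b) _ _) _; first by move=> x; exact: hb.
    by apply: ler_wpM2r => //; rewrite ler_nat.
move=> [a [ra [Ba hBa] bal ->]] om0 hc.
have y0 : 0 < 4 * pi / r%:R :> R by rewrite divr_gt0// mulr_gt0.
have [b [b0 by_ hb bp]] := truncated_filter_bound hbeta y0 hc.
have t0 : r%:R / 2 * b < 2 * pi.
  have h : b * r%:R < 4 * pi by rewrite -ltr_pdivlMr.
  by lra.
have [kap hkap] := resonance_free_of_phase nonneg d true r t0.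
apply: (@interpolation R nonneg d true omega _ a r0 r s M Ba kap (b + 1)) => //.
- by rewrite ltr_wpDl.
- by move=> h x _; rewrite (le_trans (hb _))// lerDl.
- move=> h h0; apply: hkap => w /andP[_ bw] sw.
  apply: le_trans (balanced_phase (b := b) _ bw) _.
    move=> x; rewrite bp ?(mulr_ge0 (ltW h0))//=.
    exact: le_trans (ler_norm _) (hb _).
  by apply: ler_wpM2r => //; apply: ler_wpM2r; [rewrite invr_ge0|rewrite ler_nat].
Qed.
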